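(* For every integer $n\ge1$ and every $\lambda\in\mathbb C$, $$2\sum_{j\ge1}v_n^Ts_{2j}\,\lambda^{2j}=D_n\,\lambda^{2n}\,G_n(\lambda).$$ Consequently, the Qu--Valkó power series $2\sum_{j\ge1}v_n^Ts_{2j}\lambda^{2j}$ and the Forrester Selberg-integral expression $D_n\lambda^{2n}G_n(\lambda)$ are identical as entire functions of $\lambda$.
   Context: Fix $n\ge1$ and put $N=2n$. Qu--Valkó side. Let $A_n,B_n\in\mathbb R^{n\times n}$ (indices $1\le k\le n$) be given by $$[A_n]_{k,k}=-k^2,\quad [A_n]_{k,k-1}=\tfrac12k(k+n),\quad [A_n]_{k,k+1}=\tfrac12k(k-n),\quad [B_n]_{k,k}=k,$$ with out-of-range entries omitted and all other entries zero. Let $e_n=(1,0,\ldots,0)^T\in\mathbb C^n$ and let $v_n\in\mathbb R^n$ have entries $[v_n]_k=(-1)^k\binom{2n}{n+k}/\binom{2n}{n}$, $1\le k\le n$. Define vectors $s_m\in\mathbb C^n$ by $$s_0=-\frac{n+1}{2}A_n^{-1}e_n,\qquad s_m=i\Bigl(mI-\frac2nA_n\Bigr)^{-1}B_ns_{m-1},\quad m\ge1.$$ (Qu and Valkó proved that the power series $2\sum_{j\ge1}v_n^Ts_{2j}\lambda^{2j}$ is entire and represents $4\pi^2$ times the pair correlation function of the $\mathrm{Sine}_{2n}$ process.) Selberg side. Let $$D_n=\frac{n^{2n}(n!)^3}{(2n)!\,(3n)!},\qquad W_n(u)=\prod_{j=1}^{N}u_j^{-1+1/n}(1-u_j)^{-1+1/n}\prod_{1\le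 j<k\le N}|u_j-u_k|^{2/n},\quad u\in[0,1]^N,$$ $\mathcal S_n=\int_{[0,1]^N}W_n(u)\,du$, and $$G_n(\lambda)=\frac{e^{-in\lambda}}{\mathcal S_n}\int_{[0,1]^N}e^{i\lambda\sum_{j=1}^Nu_j}\,W_n(u)\,du .$$ *)

(* Defs.v *)
From HB Require Import structures.
From mathcomp Require Import all_boot all_order all_algebra complex.
From mathcomp Require Import all_classical all_reals all_analysis.
Set Implicit Arguments.
Unset Strict Implicit.
Unset Printing Implicit Defensive.
Import Order.TTheory GRing.Theory Num.Theory.
Import numFieldNormedType.Exports.
Local Open Scope classical_set_scope.
Local Open Scope ring_scope.
Local Open Scope complex_scope.

Section TupleCons.
Variables (R : realType) (n : nat).
Local Notation RT := (measurableTypeR R).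

Definition tuple_cons (p : RT * n.-tuple RT) : n.+1.-tuple RT :=
  [tuple of p.1 :: p.2].

Definition tuple_uncons (t : n.+1.-tuple RT) : RT * n.-tuple RT :=
  (thead t, [tuple of behead t]).

Lemma tuple_consK : cancel tuple_cons tuple_uncons.
Proof. by move=> [x t]; congr pair; apply/val_inj. Qed.

Lemma tuple_unconsK : cancel tuple_uncons tuple_cons.
Proof. by move=> t; rewrite [RHS]tuple_eta; apply/val_inj. Qed.

Lemma measurable_tuple_cons : measurable_fun [set: RT * n.-tuple RT] tuple_cons.
Proof. exact: (measurable_cons measurable_fst measurable_snd). Qed.

Lemma measurable_tuple_uncons :
  measurable_fun [set: n.+1.-tuple RT] tuple_uncons.
Proof.
apply/measurable_fun_pairP; split; last exact: measurable_behead.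
exact: (measurable_tnth ord0).
Qed.

Variable mu : {sigma_finite_measure set (n.-tuple RT) -> \bar R}.

Definition cons_measure : set (n.+1.-tuple RT) -> \bar R :=
  pushforward (@lebesgue_measure R \x mu)%E tuple_cons.

Let m : {measure set (n.+1.-tuple RT) -> \bar R} :=
  measure_function_pushforward__canonical__measure_function_Measure
    (@lebesgue_measure R \x mu)%E measurable_tuple_cons.

HB.instance Definition _ := isMeasure.Build _ _ _ cons_measure
  (measure0 m) (measure_ge0 m) (@measure_semi_sigma_additive _ _ _ m).

Let cons_measure_sigma_finite : sigma_finite setT cons_measure.
Proof.
have /sigma_finiteP[F [FT ndF Foo]] := sigma_finiteT (@lebesgue_measure R).
have /sigma_finiteP[G [GT ndG Goo]] := sigma_finiteT mu.
exists (fun k => tuple_uncons @^-1` (F k `*` G k)).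
  rewrite -preimage_bigcup -[LHS](preimage_setT tuple_uncons); congr preimage.
  rewrite -setXTT FT GT predeqE => -[x y]; split.
    move=> [/= [i _ Fx] [k _ Gy]]; exists (maxn i k) => //; split.
    - by move: x Fx; exact/subsetPset/ndF/leq_maxl.
    - by move: y Gy; exact/subsetPset/ndG/leq_maxr.
  by move=> [k _ []/= ? ?]; split; exists k.
move=> k; have [mF Fk] := Foo k; have [mG Gk] := Goo k; split.
  by rewrite -[X in measurable X]setTI; apply: measurable_tuple_uncons => //;
    exact: measurableX.
rewrite /cons_measure /pushforward -comp_preimage.
rewrite (_ : _ \o _ = idfun); last by rewrite funeqE => p; exact: tuple_consK.
by rewrite preimage_id product_measure1E// lte_mul_pinfty// ge0_fin_numE.
Qed.

HB.instance Definition _ := Measure_isSigmaFinite.Build _ _ _ cons_measure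
  cons_measure_sigma_finite.

End TupleCons.

(* n-dimensional Lebesgue measure on R^n, represented as n-tuples with the
   product sigma-algebra; [tuple_lebesgue_box] gives its values on boxes. *)
Fixpoint tuple_lebesgue (R : realType) (n : nat) :
    {sigma_finite_measure set (n.-tuple (measurableTypeR R)) -> \bar R} :=
  if n is m.+1 then cons_measure (tuple_lebesgue R m)
  else dirac ([tuple] : 0.-tuple (measurableTypeR R)).

Lemma tuple_lebesgue_box (R : realType) (n : nat)
    (A : 'I_n -> set (measurableTypeR R)) :
  (forall i, measurable (A i)) ->
  tuple_lebesgue R n [set t | forall i, A i (tnth t i)] =
  (\prod_(i < n) lebesgue_measure (A i))%E.
Proof.
elim: n A => [|n IH] A mA.
  by rewrite big_ord0 /= diracE mem_set//= => -[].
set S := fun k (B : 'I_k -> set (measurableTypeR R)) =>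
  [set t : k.-tuple (measurableTypeR R) | forall i, B i (tnth t i)].
have mS k (B : 'I_k -> set (measurableTypeR R)) :
    (forall i, measurable (B i)) -> measurable (S k B).
  move=> mB; rewrite (_ : S k B =
      \bigcap_(i in [set: 'I_k]) ((fun t => tnth t i) @^-1` B i)).
    apply: fin_bigcap_measurable => // i _.
    by rewrite -[X in measurable X]setTI; exact: measurable_tnth.
  by apply/seteqP; split => t /= tB i => [_|]; exact: tB.
rewrite big_ord_recl /= -IH//.
rewrite -product_measure1E//; last exact: (mS n (fun i => A (lift ord0 i))).
rewrite /cons_measure /pushforward; congr (_ _); apply/seteqP; split.
  move=> [x t] /= At; split => [|i]; first exact: At ord0.
  by have := At (lift ord0 i); rewrite tnthS.
move=> [x t] [/= Ax At] i; case: (unliftP ord0 i) => [j ->|->//].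
by rewrite tnthS; exact: At.
Qed.

Section Complex.
Variable R : realType.
Local Notation C := (R[i]).

Definition cexp (z : C) : C :=
  (expR (complex.Re z) * cos (complex.Im z)) +i*
  (expR (complex.Re z) * sin (complex.Im z)).

Definition cintegral d (T : measurableType d)
    (mu : {measure set T -> \bar R}) (D : set T) (f : T -> C) : C :=
  (\int[mu]_(x in D) complex.Re (f x)) +i* (\int[mu]_(x in D) complex.Im (f x)).

(* Complex differentiability: R[i]^o is R[i] as a normed space over itself. *)
Definition entire (f : C^o -> C^o) := forall z : C^o, derivable f z 1.

End Complex.

Section QuValko.
Variables (R : realType) (n : nat).
Local Notation C := (R[i]).

(* The 1-based index k, 1 <= k <= n, is i.+1 for i : 'I_n. *)
Definition qv_A : 'M[R]_n := \matrix_(i, j)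
  let k : R := i.+1%:R in
  if j == i then - k ^+ 2
  else if j.+1 == i :> nat then 2^-1 * k * (k + n%:R)
  else if j == i.+1 :> nat then 2^-1 * k * (k - n%:R)
  else 0.

Definition qv_B : 'M[R]_n := diag_mx (\row_i i.+1%:R).

Definition qv_e : 'cV[C]_n := \col_i ((i == 0 :> nat)%:R).

Definition qv_v : 'cV[R]_n :=
  \col_i ((-1) ^+ i.+1 * 'C(2 * n, n + i.+1)%:R / 'C(2 * n, n)%:R).

Local Notation toC := (map_mx (real_complex R)).

(* [invmx] is the identity on singular matrices; here it is only applied to
   invertible ones: -A_n and m I - (2/n) A_n are tridiagonal with positive
   diagonal and negative products of symmetric off-diagonal entries. *)
Fixpoint qv_s (m : nat) : 'cV[C]_n :=
  if m is m'.+1 then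
    'i%C *: (toC (invmx (m%:R%:M - (2 / n%:R) *: qv_A)) *m toC qv_B *m qv_s m')
  else - ((n.+1%:R / 2) *: (toC (invmx qv_A) *m qv_e)).

Definition qv_partial_sum (lambda : C) (J : nat) : C^o :=
  \sum_(1 <= j < J.+1) ((toC qv_v)^T *m qv_s (2 * j)) 0 0 * lambda ^+ (2 * j).

Definition qv_series (lambda : C^o) : C^o :=
  2 * limn (qv_partial_sum lambda).

End QuValko.

Section Selberg.
Variables (R : realType) (n : nat).
Local Notation C := (R[i]).
Local Notation N := (2 * n)%N.
Local Notation point := (N.-tuple (measurableTypeR R)).

Definition selberg_D : R :=
  (n ^ (2 * n) * n`! ^ 3)%:R / ((2 * n)`! * (3 * n)`!)%:R.

(* [powR 0 a = 0] for a != 0, so for n > 1 the weight gets the value 0 where an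
   infinite factor occurs; this only affects a Lebesgue-null set. *)
Definition selberg_W (u : point) : R :=
  let x (j : 'I_N) : R := tnth u j in
  (\prod_(j < N) (x j `^ (-1 + n%:R^-1) * (1 - x j) `^ (-1 + n%:R^-1))) *
  \prod_(j < N) \prod_(k < N | (j < k)%N) `|x j - x k| `^ (2 / n%:R).

Definition unit_cube : set point :=
  [set u | forall j : 'I_N, 0 <= (tnth u j : R) <= 1].

Definition selberg_S : R := \int[tuple_lebesgue R N]_(u in unit_cube) selberg_W u.

Definition selberg_G (lambda : C) : C :=
  cexp (- ('i%C * n%:R * lambda)) / selberg_S%:C *
  cintegral (tuple_lebesgue R N) unit_cube (fun u =>
    cexp ('i%C * lambda * (\sum_(j < N) (tnth u j : R))%:C) * (selberg_W u)%:C).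

Definition forrester (lambda : C^o) : C^o :=
  selberg_D%:C * lambda ^+ (2 * n) * selberg_G lambda.

End Selberg.

(* Main.v *)
Require Import Defs.
From mathcomp Require Import all_boot all_order all_algebra fingroup perm complex.
From mathcomp Require Import all_classical all_reals all_analysis.
From mathcomp Require Import measurable_realfun ring lra zify.
Set Implicit Arguments.
Unset Strict Implicit.
Unset Printing Implicit Defensive.
Import Order.TTheory GRing.Theory Num.Theory.
Import numFieldNormedType.Exports.
Local Open Scope classical_set_scope.
Local Open Scope ring_scope.

(** Put x = i lambda, N = 2n and T(u) = sum_j (u_j - 1/2).

    The vectors s_m equal i^m t_m with t_m real.  Extended to the indices
    k = -n, ..., n by t_m(-k) = (-1)^m t_m(k) and t_m(0) = [m = 0], they are the
    Taylor coefficients of a vector S(x) with x S' = ((2/n) A + x B) S, where A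
    and B are given by the same formulas as A_n and B_n; the boundary terms
    of A vanish at k = n and k = -n.  Since t_0 is identically 1, the left-hand
    side of the theorem is the sum of v_k S_k(x) over all k, which is an N-th
    finite difference of S in k.  It is the first member F_0 of the family
    F_j = sum_k v_k (n+k)(n+k-1)...(n+k-j+1) S_k, and this family satisfies a
    linear system of its own, tridiagonal in j ([qv_diff_rec]): A does not
    raise the degree of a polynomial in k.

    On the other side, integrating the derivative in u_1 of
    u_1 (1 - u_1) u_2 ... u_p T^M W over the cube and symmetrising in pairs of
    variables gives Aomoto's identities ([selberg_aomoto]).  They say that
    J_p = int e^(x T) u_1 ... u_p W du also satisfies a tridiagonal system
    ([kappa_rec]).

    Both systems can be brought to the form x H' = (M_0 + x M_1) H with the same
    constant matrices: for the Selberg averages by H_p = x^(N+p) J_p, for the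
    differences by H_p = sum_j C_(p,j) x^j F_j with the explicit constants
    [gauge_coef].  The exponents of M_0 are N, once, and numbers smaller than
    N; hence a power series solution that vanishes to order N is determined
    by the coefficient of x^N in H_0 ([gauged_unique]).  That coefficient is
    computed on the Qu-Valko side from the entry F_N at x = 0 by a product
    formula ([qv_diff_diag]), and it produces the constant D_n.  So all Taylor
    coefficients agree ([qv_diff_moments]).

    The moments of T grow at most geometrically, so their exponential
    generating function converges to the integral for every lambda and defines
    an entire function ([char_fun_taylor], [char_fun_diff]).

    The integration by parts needs care because W is singular on the faces
    u_j = 0, 1 (for n > 1) and its derivative is singular on the diagonals.
    Replacing u_j, 1 - u_j and (u_j - u_k)^2 by themselves plus e > 0 makes W
    smooth on the closed cube; after symmetrisation every term is a bounded
    function times the regularised weight, which is dominated by an integrable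
    product, and e tends to 0 by dominated convergence ([cvg_reg_mean]). *)

(** * Recurrences for the weighted differences and their gauge transform *)

Section Recurrences.
Variables (R : realFieldType) (n : nat).
Hypothesis n_gt0 : (0 < n)%N.
Local Notation N := (2 * n)%N.

(** Multiplication by x on sequences of power series coefficients. *)
Definition lag (u : nat -> nat -> R) (m j : nat) : R :=
  if m is m'.+1 then u m' j else 0.

(** The subdiagonal coefficient of the system for the Selberg averages; up to a
    factor n - j it is also that of the system for the weighted differences. *)
Definition qv_coef (j : nat) : R := j%:R * (N%:R + 1 - j%:R) / n%:R.

Let n_neq0 : n%:R != 0 :> R.
Proof. by rewrite pnatr_eq0 -lt0n. Qed.

Lemma ffactnSr_ring (r j : nat) : (r ^_ j.+1)%:R = (r%:R - j%:R) * (r ^_ j)%:R :> R.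
Proof.
rewrite ffactnSr natrM mulrC; have [jr|rj] := leqP j r; first by rewrite natrB.
by rewrite ffact_small// !mulr0.
Qed.

Lemma ffactSn_ring (r j : nat) :
  (r.+1 ^_ j)%:R = (r ^_ j)%:R + j%:R * (r ^_ j.-1)%:R :> R.
Proof.
case: j => [|j]; first by rewrite !ffactn0 mul0r addr0.
by rewrite ffactSS natrM ffactnSr_ring /= -[r.+1%:R]natr1 -[j.+1%:R]natr1; ring.
Qed.

(** The entries of v_n, extended to k = -n, ..., n and indexed by r = n + k, which
    keeps all indices natural numbers. *)
Definition qv_weight (r : nat) : R := (-1) ^+ (n + r) * 'C(N, r)%:R / 'C(N, n)%:R.

Lemma qv_weightS (r : nat) :
  qv_weight r.+1 * r.+1%:R = - qv_weight r * (N%:R - r%:R).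
Proof.
rewrite /qv_weight addnS exprS.
have H : 'C(N, r.+1)%:R * r.+1%:R = 'C(N, r)%:R * (N%:R - r%:R) :> R.
  rewrite -natrM mulnC mul_bin_left natrM mulrC.
  have [rN|Nr] := leqP r N; first by rewrite natrB.
  by rewrite bin_small// !mul0r.
transitivity (- (-1) ^+ (n + r) * ('C(N, r.+1)%:R * r.+1%:R) / 'C(N, n)%:R : R).
  by ring.
by rewrite H; ring.
Qed.

(** Up to a constant, [qv_weight r * r ^_ j] is the alternating binomial weight of
    order N - j placed at r = j, ..., N: this is the coefficient of x^m in a finite
    difference of order N - j. *)
Definition qv_diff (t : nat -> nat -> R) (m j : nat) : R :=
  \sum_(r < N.+1) qv_weight r * (r ^_ j)%:R * t m r.

Section Differences.
Variable t : nat -> nat -> R.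
Hypothesis t_rec : forall m r, (r <= N)%N ->
  let k : R := r%:R - n%:R in
  m%:R * t m r = n%:R^-1 *
    (- 2 * k ^+ 2 * t m r + k * r%:R * t m r.-1 + k * (r%:R - N%:R) * t m r.+1)
    + k * lag t m r.
Local Notation f := (qv_diff t).

(** Summation by parts.  No boundary term appears: the factor r vanishes at the
    lower end and N - r at the upper end. *)
Lemma sum_qv_weight_pred (F : nat -> R) (g : nat -> R) :
  \sum_(r < N.+1) qv_weight r * F r * (r%:R * g r.-1) =
  \sum_(r < N.+1) - (qv_weight r * (N%:R - r%:R) * F r.+1) * g r.
Proof.
rewrite big_ord_recl /= mul0r mulr0 add0r [RHS]big_ord_recr /=.
rewrite subrr !(mulr0, mul0r, oppr0) addr0; apply: eq_bigr => i _ /=.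
rewrite /bump /= add1n.
transitivity (qv_weight i.+1 * i.+1%:R * F i.+1 * g i); first by ring.
by rewrite qv_weightS; ring.
Qed.

Lemma sum_qv_weight_succ (F : nat -> R) (g : nat -> R) :
  \sum_(r < N.+1) qv_weight r * F r * ((r%:R - N%:R) * g r.+1) =
  \sum_(r < N.+1) qv_weight r * r%:R * F r.-1 * g r.
Proof.
rewrite big_ord_recr /= subrr mul0r mulr0 addr0 [RHS]big_ord_recl /=.
rewrite !(mulr0, mul0r) add0r; apply: eq_bigr => i _ /=.
by rewrite /bump /= add1n qv_weightS; ring.
Qed.

(** The tridiagonal operator maps polynomials in k of degree d to polynomials of
    degree at most d, so its transpose sends the difference with index j to a
    combination of those with indices j and j - 1; multiplication by k = r - n
    raises the falling power by one. *)
Lemma qv_diff_rec m j :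
  (m%:R + (N%:R - j%:R) * (j%:R + 1) / n%:R) * f m j =
  lag f m j.+1 + (j%:R - n%:R) * lag f m j
    + qv_coef j * (n%:R - j%:R) * f m j.-1.
Proof.
have lagE i : lag f m i = \sum_(r < N.+1) qv_weight r * (r ^_ i)%:R * lag t m r.
  by case: m => //=; rewrite big1// => r _; rewrite mulr0.
rewrite mulrDl [m%:R * _]mulr_sumr.
pose k (r : nat) : R := r%:R - n%:R.
have -> : \sum_(r < N.+1) m%:R * (qv_weight r * (r ^_ j)%:R * t m r) =
  n%:R^-1 * (\sum_(r < N.+1) qv_weight r * (- 2 * k r ^+ 2 * (r ^_ j)%:R) * t m r
   + \sum_(r < N.+1) qv_weight r * (k r * (r ^_ j)%:R) * (r%:R * t m r.-1)
   + \sum_(r < N.+1) qv_weight r * (k r * (r ^_ j)%:R) * ((r%:R - N%:R) * t m r.+1))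
  + \sum_(r < N.+1) qv_weight r * (r ^_ j)%:R * (k r * lag t m r).
  rewrite -!big_split /= mulr_sumr -big_split /=; apply: eq_bigr => r _.
  rewrite mulrCA t_rec; last by rewrite -ltnS.
  by rewrite -/(k r); ring.
rewrite (sum_qv_weight_pred (fun r => k r * (r ^_ j)%:R)).
rewrite (sum_qv_weight_succ (fun r => k r * (r ^_ j)%:R)).
rewrite !lagE /qv_diff !mulr_sumr -!big_split /= mulr_sumr -!big_split /=.
apply: eq_bigr => r _.
(* The transposed tridiagonal operator applied to the falling power: the terms of
   degree j + 2 and j + 1 cancel. *)
suff H : (- 2 * k r ^+ 2 * (r ^_ j)%:R - (N%:R - r%:R) * (k r.+1 * (r.+1 ^_ j)%:R)
    + r%:R * (k r.-1 * (r.-1 ^_ j)%:R)) =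
    - ((N%:R - j%:R) * (j%:R + 1)) * (r ^_ j)%:R
    + j%:R * (N%:R + 1 - j%:R) * (n%:R - j%:R) * (r ^_ j.-1)%:R.
  rewrite ffactnSr_ring /qv_coef.
  transitivity (n%:R^-1 * qv_weight r * t m r *
    ((- 2 * k r ^+ 2 * (r ^_ j)%:R - (N%:R - r%:R) * (k r.+1 * (r.+1 ^_ j)%:R)
    + r%:R * (k r.-1 * (r.-1 ^_ j)%:R))
    + (N%:R - j%:R) * (j%:R + 1) * (r ^_ j)%:R)
    + qv_weight r * (r ^_ j)%:R * (k r * lag t m r)); first by ring.
  by rewrite H /k; ring.
have -> : r%:R * (k r.-1 * (r.-1 ^_ j)%:R) = (k r - 1) * (r ^_ j.+1)%:R :> R.
  rewrite /k; case: (nat_of_ord r) => [|r']; first by rewrite ffact0n mul0r mulr0.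
  by rewrite ffactSS natrM -[r'.+1%:R]natr1 /=; ring.
rewrite ffactSn_ring ffactnSr_ring /k natrM -natr1.
case: j => [|j /=]; first by rewrite /= ffactn0; ring.
rewrite ffactnSr_ring -[j.+1%:R]natr1; ring.
Qed.

Lemma qv_diff_denom_neq0 m j : (j <= N)%N -> (0 < m)%N || (j < N)%N ->
  m%:R + (N%:R - j%:R) * (j%:R + 1) / n%:R != 0 :> R.
Proof.
move=> jN H; have n0 : 0 < n%:R :> R by rewrite ltr0n.
have j0 : 0 < j%:R + 1 :> R by rewrite natr1 ltr0n.
apply: lt0r_neq0; case: m H => [/= jlt|m _].
  by rewrite add0r divr_gt0// mulr_gt0// subr_gt0 ltr_nat.
rewrite ltr_pwDl ?ltr0n// divr_ge0 ?(ltW n0)// mulr_ge0 ?(ltW j0)//.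
by rewrite subr_ge0 ler_nat.
Qed.

(** The factor on the left of [qv_diff_rec] is nonzero except at m = 0, j = N, so
    vanishing spreads by induction from m + j < N - 1 to m + j < N. *)
Lemma qv_diff_small m j : (m + j < N)%N -> f m j = 0.
Proof.
have step m' j' : (j' <= N)%N -> (0 < m')%N || (j' < N)%N ->
    lag f m' j'.+1 + (j'%:R - n%:R) * lag f m' j'
      + qv_coef j' * (n%:R - j'%:R) * f m' j'.-1 = 0 -> f m' j' = 0.
  move=> jN H; rewrite -qv_diff_rec => /eqP; rewrite mulf_eq0.
  by rewrite (negbTE (qv_diff_denom_neq0 jN H)) => /eqP.
elim: m j => [|m IHm] j.
  rewrite add0n; elim: j => [|j IHj] jN; apply: step; try lia.
    by rewrite /qv_coef /=; ring.
  by rewrite /= IHj ?(ltnW jN)//; ring.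
elim: j => [|j IHj] jN; apply: step; try lia.
  by rewrite /= !IHm ?/qv_coef; [ring|lia..].
by rewrite /= IHj ?IHm; [ring|lia..].
Qed.

Hypothesis t00 : t 0 N = 1.

Lemma qv_diff_top : f 0 N = (-1) ^+ n * n`!%:R ^+ 2.
Proof.
rewrite /qv_diff big_ord_recr /= big1 ?add0r; last first.
  by move=> i _; rewrite ffact_small ?mulr0 ?mul0r// ltn_ord.
rewrite t00 mulr1 ffactnn /qv_weight binn mulr1 exprD exprM sqrrN !expr1n mulr1.
have := @bin_fact N n; rewrite mulnC muln2 -addnn leq_addr addnK => /(_ isT) <-.
rewrite !natrM; field.
by rewrite pnatr_eq0 -lt0n bin_gt0 leq_addr.
Qed.

(** On the line m + j = N the other terms of [qv_diff_rec] vanish by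
    [qv_diff_small], and a two-term recurrence starting from [qv_diff_top] remains. *)
Lemma qv_diff_diag m : (m <= N)%N ->
  f m (N - m) * ((m`! * (3 * n) ^_ m)%:R) = (-1) ^+ n * n`!%:R ^+ 2 * n%:R ^+ m.
Proof.
elim: m => [|m IH] mN; first by rewrite subn0 qv_diff_top ffactn0 fact0 !mulr1.
have := qv_diff_rec m.+1 (N - m.+1); rewrite /= subnSK//.
rewrite (@qv_diff_small m (N - m.+1)) ?mulr0 ?addr0; last lia.
rewrite (_ : qv_coef _ * _ * _ = 0) ?addr0; last first.
  case: (N - m.+1)%N (subnK mN) => [|j] jE; first by rewrite /qv_coef !mul0r.
  by rewrite qv_diff_small ?mulr0//; lia.
move=> H; rewrite factS ffactnSr [n%:R ^+ m.+1]exprSr [RHS]mulrA -IH; last lia.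
rewrite -H !natrM !natrB; [|lia..].
rewrite !natrM -natr1; field.
by rewrite n_neq0.
Qed.

End Differences.

(** The constants that turn the system of the differences x^j F_j into that of the
    averages x^(N+p) J_p. *)
Definition gauge_coef (p j : nat) : R :=
  (-1) ^+ (p - j) * 'C(p, j)%:R * (n.+1 ^_ (p - j))%:R
  / (n%:R ^+ (p - j) * (N ^_ j)%:R).

(** The local exponents at x = 0 of the system satisfied by x^(N+p) J_p. *)
Definition gauge_exp (p : nat) : R :=
  N%:R - 3 * p%:R + p%:R * (p%:R - 1) / n%:R.

Let ffactN_neq0 j : (j <= N)%N -> (N ^_ j)%:R != 0 :> R.
Proof. by move=> jN; rewrite pnatr_eq0 -lt0n ffact_gt0. Qed.

Lemma gauge_coef_small p j : (p < j)%N -> gauge_coef p j = 0.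
Proof. by move=> pj; rewrite /gauge_coef bin_small// !(mulr0, mul0r). Qed.

(** With [gauge_coefSS], the only facts about the constants that the intertwining
    relations use. *)
Lemma gauge_coefSl p j : (j <= p.+1)%N ->
  (p%:R + 1 - j%:R) * gauge_coef p.+1 j =
  - ((p%:R + 1) * (n%:R + 1 - p%:R + j%:R)) / n%:R * gauge_coef p j.
Proof.
rewrite leq_eqVlt => /predU1P[->|]; last rewrite ltnS => jp.
  by rewrite [gauge_coef p _]gauge_coef_small// -natr1; ring.
have -> : n%:R + 1 - p%:R + j%:R = n.+1%:R - (p - j)%:R :> R.
  by rewrite natrB// -natr1; ring.
have B : (p%:R + 1 - j%:R) * 'C(p.+1, j)%:R = (p%:R + 1) * 'C(p, j)%:R :> R.
  rewrite natr1 -natrB ?leqW// -!natrM; congr (_%:R).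
  by have := mul_bin_down p.+1 j.
rewrite /gauge_coef subSn// ffactnSr_ring !exprS.
transitivity (((p%:R + 1 - j%:R) * 'C(p.+1, j)%:R) * (-1 * (-1) ^+ (p - j)) *
  ((n.+1%:R - (p - j)%:R) * (n.+1 ^_ (p - j))%:R) /
  (n%:R * n%:R ^+ (p - j) * (N ^_ j)%:R) : R); first by ring.
by rewrite B !invfM; ring.
Qed.

Lemma gauge_coefSS p j : (j < N)%N ->
  (j%:R + 1) * (N%:R - j%:R) * gauge_coef p.+1 j.+1 =
  (p%:R + 1) * gauge_coef p j.
Proof.
move=> jN; rewrite /gauge_coef subSS ffactnSr_ring.
have B : (j%:R + 1) * 'C(p.+1, j.+1)%:R = (p%:R + 1) * 'C(p, j)%:R :> R.
  by rewrite !natr1 -!natrM mul_bin_diag.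
have Nj0 := ffactN_neq0 (ltnW jN).
have NjE : N%:R - j%:R != 0 :> R by rewrite -natrB ?pnatr_eq0 ?subn_eq0 -?ltnNge// ltnW.
transitivity ((((j%:R + 1) * 'C(p.+1, j.+1)%:R) * (-1) ^+ (p - j) *
  (n.+1 ^_ (p - j))%:R) / (n%:R ^+ (p - j) * (N ^_ j)%:R) : R).
  by field; rewrite -natrM Nj0 NjE expf_neq0.
by rewrite B; ring.
Qed.

Section Gauge.
Variable f : nat -> nat -> R.
Hypothesis f_rec : forall m j,
  (m%:R + (N%:R - j%:R) * (j%:R + 1) / n%:R) * f m j =
  lag f m j.+1 + (j%:R - n%:R) * lag f m j
    + qv_coef j * (n%:R - j%:R) * f m j.-1.
Hypothesis f_top : forall m, f m N.+1 = 0.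

(** The coefficients of x^j F_j. *)
Definition qv_shear (m j : nat) : R := if (j <= m)%N then f (m - j) j else 0.

Definition qv_gauged (m p : nat) : R :=
  \sum_(j < N.+1) gauge_coef p j * qv_shear m j.

Lemma qv_shear_rec m j :
  (m%:R - j%:R + (N%:R - j%:R) * (j%:R + 1) / n%:R) * qv_shear m j =
  qv_shear m j.+1 + (j%:R - n%:R) * lag qv_shear m j
   + qv_coef j * (n%:R - j%:R) * lag qv_shear m j.-1.
Proof.
rewrite /qv_shear; have [jm|mj] := leqP j m; last first.
  rewrite leqNgt (ltn_trans mj)//= mulr0 add0r.
  case: m mj => [|m] mj /=; first by rewrite !mulr0 addr0.
  have -> : (j <= m)%N = false by lia.
  have -> : (j.-1 <= m)%N = false by lia.
  by rewrite !mulr0 addr0.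
rewrite -natrB// f_rec.
case: (ltngtP j m) jm => // [jm _|-> _].
  case: m jm => // m jm /=.
  rewrite subSS subSn; last lia.
  rewrite /= (_ : j <= m)%N; last lia.
  congr (_ + _); case: j jm => [|j] jm /=; first by rewrite /qv_coef !mul0r.
  rewrite (_ : j <= m)%N; last lia.
  by congr (_ * f _ _); lia.
rewrite subnn /= mulr0 !add0r.
case: m => [|m] /=; first by rewrite /qv_coef; ring.
by rewrite ltnn leqnn subnn mulr0 add0r.
Qed.

(** Intertwining of the constant parts of the two systems. *)
Lemma gauge_coef_rec_top p j : (p <= N)%N -> (j <= N)%N ->
  (N%:R - p%:R) * gauge_coef p.+1 j =
  (if j is j'.+1 then gauge_coef p j' else 0)
  + (j%:R - (N%:R - j%:R) * (j%:R + 1) / n%:R - gauge_exp p) * gauge_coef p j.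
Proof.
move=> pN jN; have [jp|pj] := leqP j p.+1; last first.
  rewrite !gauge_coef_small// ?(ltnW pj)//.
  by case: j pj {jN} => // j pj; rewrite gauge_coef_small//; ring.
have p0 : p%:R + 1 != 0 :> R by rewrite natr1 pnatr_eq0.
(* The factor p + 1 is what [gauge_coefSS] and [gauge_coefSl] need to express both
   sides through [gauge_coef p j] and [gauge_coef p.+1 j]. *)
apply: (mulfI p0); rewrite mulrDr.
have -> : (p%:R + 1) * (if j is j'.+1 then gauge_coef p j' else 0) =
   j%:R * (N%:R + 1 - j%:R) * gauge_coef p.+1 j.
  case: j jN {jp} => [|j] jN; first by rewrite mulr0 !mul0r.
  by rewrite -gauge_coefSS// -natr1; ring.
have -> : (p%:R + 1) * ((j%:R - (N%:R - j%:R) * (j%:R + 1) / n%:R - gauge_exp p)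
   * gauge_coef p j) = (N%:R - p%:R - j%:R) * (- ((p%:R + 1) * (n%:R + 1 - p%:R + j%:R)) / n%:R * gauge_coef p j).
  by rewrite /gauge_exp natrM; field.
by rewrite -gauge_coefSl//; ring.
Qed.

(** Intertwining of the parts proportional to x. *)
Lemma gauge_coef_rec_low p j : (p <= N)%N -> (j <= N)%N ->
  qv_coef j.+1 * (n%:R - j.+1%:R) * gauge_coef p j.+1 =
  (p%:R - j%:R) * gauge_coef p j + qv_coef p * (if p is p'.+1 then gauge_coef p' j else 0).
Proof.
move=> pN jN; rewrite /qv_coef; case: p pN => [|p] pN.
  rewrite gauge_coef_small// !(mul0r, mulr0) addr0.
  by case: j {jN} => [|j]; [|rewrite gauge_coef_small//]; ring.
move: jN; rewrite leq_eqVlt => /predU1P[->|jN].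
  rewrite [gauge_coef p _]gauge_coef_small ?mulr0 ?addr0//.
  rewrite [gauge_coef p.+1 N.+1]gauge_coef_small ?ltnS// mulr0.
  move: pN; rewrite leq_eqVlt => /predU1P[->|pN]; first by ring.
  by rewrite gauge_coef_small// mulr0.
have -> : j.+1%:R * (N%:R + 1 - j.+1%:R) / n%:R * (n%:R - j.+1%:R) * gauge_coef p.+1 j.+1 =
   (n%:R - j%:R - 1) / n%:R * ((j%:R + 1) * (N%:R - j%:R) * gauge_coef p.+1 j.+1).
  by rewrite -natr1; ring.
rewrite gauge_coefSS//; have [jp|pj] := leqP j p.+1; last first.
  by rewrite !gauge_coef_small// ?(ltnW pj)//; ring.
rewrite -[p.+1%:R]natr1 gauge_coefSl// natrM; field.
by [].
Qed.

Lemma qv_gauged_rec m p : (p <= N)%N ->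
  (m%:R - gauge_exp p) * qv_gauged m p =
  (N%:R - p%:R) * qv_gauged m p.+1 + (p%:R - n%:R) * lag qv_gauged m p
    + qv_coef p * (if p is p'.+1 then lag qv_gauged m p' else 0).
Proof.
move=> pN.
have lagE q : lag qv_gauged m q = \sum_(j < N.+1) gauge_coef q j * lag qv_shear m j.
  by case: m => //=; rewrite big1// => r _; rewrite mulr0.
have -> : qv_coef p * (if p is p'.+1 then lag qv_gauged m p' else 0) =
  \sum_(j < N.+1) qv_coef p * (if p is p'.+1 then gauge_coef p' j else 0) * lag qv_shear m j.
  case: p {pN} => [|p]; first by rewrite /qv_coef big1 => *; rewrite !mul0r.
  by rewrite lagE mulr_sumr; apply: eq_bigr => j _; rewrite mulrA.
rewrite lagE /qv_gauged.
have -> : (N%:R - p%:R) * (\sum_(j < N.+1) gauge_coef p.+1 j * qv_shear m j) =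
  \sum_(j < N.+1) gauge_coef p j * qv_shear m j.+1
  + \sum_(j < N.+1) (j%:R - (N%:R - j%:R) * (j%:R + 1) / n%:R - gauge_exp p) *
     gauge_coef p j * qv_shear m j.
  rewrite mulr_sumr.
  transitivity (\sum_(j < N.+1) ((if val j is j'.+1 then gauge_coef p j' else 0)
     * qv_shear m j + (j%:R - (N%:R - j%:R) * (j%:R + 1) / n%:R - gauge_exp p) *
     gauge_coef p j * qv_shear m j)).
    apply: eq_bigr => j _; rewrite mulrA gauge_coef_rec_top ?mulrDl//.
    by rewrite -ltnS.
  rewrite big_split; congr (_ + _).
  rewrite big_ord_recl /= mul0r add0r [RHS]big_ord_recr /=.
  by rewrite /qv_shear f_top if_same mulr0 addr0.
have -> : \sum_(j < N.+1) gauge_coef p j * qv_shear m j.+1 =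
  \sum_(j < N.+1) gauge_coef p j * ((m%:R - j%:R + (N%:R - j%:R) * (j%:R + 1) / n%:R) * qv_shear m j)
  - \sum_(j < N.+1) gauge_coef p j * (j%:R - n%:R) * lag qv_shear m j
  - \sum_(j < N.+1) qv_coef j.+1 * (n%:R - j.+1%:R) * gauge_coef p j.+1 * lag qv_shear m j.
  have -> : \sum_(j < N.+1) qv_coef j.+1 * (n%:R - j.+1%:R) * gauge_coef p j.+1 * lag qv_shear m j =
    \sum_(j < N.+1) gauge_coef p j * (qv_coef j * (n%:R - j%:R) * lag qv_shear m j.-1).
    rewrite big_ord_recr [RHS]big_ord_recl /=.
    rewrite {2}/qv_coef -natr1 subrr {2}/qv_coef !(mulr0, mul0r) addr0 add0r.
    by apply: eq_bigr => j _; rewrite /bump /= add1n; ring.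
  rewrite -!sumrB; apply: eq_bigr => j _.
  by rewrite qv_shear_rec; ring.
rewrite !mulr_sumr -!sumrB -!big_split; apply: eq_bigr => j _ /=.
rewrite gauge_coef_rec_low//; last by rewrite -ltnS.
by case: p {pN} => [|p] /=; ring.
Qed.

End Gauge.

(** For m >= N the number m - [gauge_exp p] is nonzero unless m = N and p = 0, so
    the row m is determined, by descending induction on p, by the row m - 1. *)
Lemma gauged_unique (d : nat -> nat -> R) :
  (forall m p, (p <= N)%N ->
  (m%:R - gauge_exp p) * d m p =
  (N%:R - p%:R) * d m p.+1 + (p%:R - n%:R) * lag d m p
    + qv_coef p * (if p is p'.+1 then lag d m p' else 0)) ->
  (forall m p, (m < N)%N -> (p <= N)%N -> d m p = 0) -> d N 0 = 0 ->
  forall m p, (p <= N)%N -> d m p = 0.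
Proof.
move=> d_rec d_small d_N0; elim=> [|m IHm] p pN.
  by apply: d_small => //; rewrite muln_gt0.
have [mN|Nm] := ltnP m.+1 N; first exact: d_small.
have n0 : 0 < n%:R :> R by rewrite ltr0n.
rewrite -(subKn pN); elim: (N - p)%N (leq_subr p N) => {p pN} [|q IHq] qN.
  have /(_ (leqnn N)) := d_rec m.+1 N; rewrite subrr mul0r subn0 add0r /=.
  have NN : N = N.-1.+1 by lia.
  rewrite IHm// NN /= IHm -?NN ?leq_pred// !mulr0 addr0 => /eqP.
  rewrite mulf_eq0 => /orP[|/eqP//]; rewrite /gauge_exp natrM => /eqP H.
  suff : 0 < m.+1%:R - (2 * n%:R - 3 * (2 * n%:R) + 2 * n%:R * (2 * n%:R - 1) / n%:R) :> R.
    by rewrite H ltxx.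
  have -> : m.+1%:R - (2 * n%:R - 3 * (2 * n%:R) + 2 * n%:R * (2 * n%:R - 1) / n%:R)
     = m.+1%:R + 2 :> R by field.
  by rewrite addr_gt0.
have [qE|qE] := eqVneq q.+1 N.
  have [mE|mE] := eqVneq m.+1 N; first by rewrite qE subnn mE.
  have /(_ isT) := d_rec m.+1 0%N.
  rewrite qE subnn /= (_ : d m.+1 1%N = 0); last first.
    by rewrite -(IHq (ltnW qN)) -qE subSn// subnn.
  rewrite IHm// /gauge_exp !(mul0r, mulr0, subr0, addr0) => /eqP.
  by rewrite mulf_eq0 subr_eq0 eqr_nat (negbTE mE) => /eqP.
have pS : (N - q = (N - q.+1).+1)%N by lia.
have := IHq (ltnW qN); rewrite pS; have : (0 < N - q.+1)%N by lia.
have : (N - q.+1 <= N)%N by lia.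
case: (N - q.+1)%N => // p pN _ dS.
have := d_rec m.+1 p.+1 pN; rewrite dS /= !IHm//; last exact: ltnW.
rewrite !(mulr0, addr0) => /eqP; rewrite mulf_eq0 => /orP[|/eqP//] /eqP H.
suff : 0 < m.+1%:R - gauge_exp p.+1 by rewrite H ltxx.
have -> : m.+1%:R - gauge_exp p.+1 = (m.+1%:R - N%:R) +
   (p.+1%:R * (3 * n%:R - p%:R)) / n%:R :> R.
  by rewrite /gauge_exp natrM -[p.+1%:R]natr1; field.
rewrite ltr_wpDl ?subr_ge0 ?ler_nat// divr_gt0// mulr_gt0 ?ltr0n//.
by rewrite -natrM subr_gt0 ltr_nat; lia.
Qed.

End Recurrences.

(** * The Qu-Valko vectors on the symmetric index range *)

Section QuValkoExtension.
Variables (R : realType) (n : nat).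
Hypothesis n_gt0 : (0 < n)%N.
Local Notation N := (2 * n)%N.
Local Notation C := (R[i]).
Local Notation toC := (map_mx (real_complex R)).

Let n_neq0 : n%:R != 0 :> R.
Proof. by rewrite pnatr_eq0 -lt0n. Qed.

(** The convention F 0 = 0 absorbs the omitted entry in the first row; in the last
    row the coefficient k - n is zero. *)
Lemma qv_A_mulE (x : 'cV[R]_n) (F : nat -> R) (i : 'I_n) :
  F 0%N = 0 -> (forall j : 'I_n, F j.+1 = x j 0) ->
  let k : R := i.+1%:R in
  (qv_A R n *m x) i 0 = - k ^+ 2 * F i.+1 + 2^-1 * k * (k + n%:R) * F i
                        + 2^-1 * k * (k - n%:R) * F i.+2.
Proof.
move=> F0 Fx k; rewrite mxE.
transitivity (\sum_(j < n | j == i :> nat) - k ^+ 2 * F j.+1 +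
  \sum_(j < n | j == i.-1 :> nat) 2^-1 * k * (k + n%:R) * (F j.+1 *+ (0 < i)) +
  \sum_(j < n | j == i.+1 :> nat) 2^-1 * k * (k - n%:R) * F j.+1).
  rewrite [\sum_(j < n | j == i :> nat) _]big_mkcond.
  rewrite [\sum_(j < n | j == i.-1 :> nat) _]big_mkcond.
  rewrite [\sum_(j < n | j == i.+1 :> nat) _]big_mkcond -!big_split /=.
  apply: eq_bigr => j _; rewrite mxE -/k -Fx -val_eqE /=.
  case: (ltngtP j i) => [ji|ij|->] /=.
  - have -> : (j == i.-1 :> nat) = (j.+1 == i :> nat) by lia.
    have -> : (j == i.+1 :> nat) = false by lia.
    by case: eqP => [<-|]; rewrite /= !(mulr1n, add0r, addr0, mul0r).
  - have -> : (j.+1 == i :> nat) = false by lia.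
    have -> : (j == i.-1 :> nat) = false by lia.
    by case: eqP => _; rewrite /= !(add0r, mul0r).
  - have -> : (i == i.+1 :> nat) = false by lia.
    case: eqP; last by rewrite !addr0.
    case: (nat_of_ord i) => [|i'] /=; last by lia.
    by rewrite mulr0n mulr0 !addr0.
rewrite (big_ord1_eq _ (fun j => _ * F j.+1) i) ltn_ord.
rewrite (big_ord1_eq _ (fun j => _ * (F j.+1 *+ _)) i.-1).
rewrite (big_ord1_eq _ (fun j => _ * F j.+1) i.+1).
rewrite (leq_ltn_trans (leq_pred _) (ltn_ord i)); congr (_ + _ + _).
  by case: (nat_of_ord i) => [|i'] /=; rewrite ?F0 ?mulr0n ?mulr1n.
case: ltnP => // ni; have iE : i.+1 = n by apply/eqP; rewrite eqn_leq ni ltn_ord.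
by rewrite /k iE subrr mulr0 mul0r.
Qed.

(** Entries by their one-based index, with 0 outside the range. *)
Definition cv_at (x : 'cV[R]_n) (k : nat) : R :=
  if k is k'.+1 then oapp (fun i => x i 0) 0 (insub k') else 0.

Lemma cv_at_ord x (j : 'I_n) : cv_at x j.+1 = x j 0.
Proof. by rewrite /cv_at valK. Qed.

Lemma qv_resolvent_mulE (a b : R) (x : 'cV[R]_n) (i : 'I_n) :
  let k : R := i.+1%:R in
  ((a%:M - b *: qv_A R n) *m x) i 0 = a * cv_at x i.+1 -
    b * (- k ^+ 2 * cv_at x i.+1 + 2^-1 * k * (k + n%:R) * cv_at x i
         + 2^-1 * k * (k - n%:R) * cv_at x i.+2).
Proof.
move=> k; rewrite mulmxBl mul_scalar_mx -scalemxAl mxE [X in X + _]mxE.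
rewrite [X in _ + X]mxE [X in - X]mxE.
rewrite (@qv_A_mulE x (cv_at x) i erefl); last by move=> j; rewrite cv_at_ord.
by rewrite cv_at_ord.
Qed.

(** With the weights w_k / k, where w_k = binom(2n, n+k), the off-diagonal part of A
    becomes antisymmetric: in the quadratic form of a I - b A it contributes a
    telescoping sum whose two ends are zero, and the diagonal part is positive. *)
Lemma qv_resolvent_unit (a b : R) : 0 <= a -> 0 < b ->
  a%:M - b *: qv_A R n \in unitmx.
Proof.
move=> a0 b0; rewrite -unitmx_tr -row_free_unit; apply: inj_row_free => v vM.
pose x : 'cV_n := v^T; pose F := cv_at x.
have xE : (a%:M - b *: qv_A R n) *m x = 0.
  by apply: trmx_inj; rewrite trmx_mul trmxK vM trmx0.
pose w k : R := 'C(N, n + k)%:R.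
(* The flux of the telescoping sum: it vanishes at k = 0 because F 0 = 0 and at
   k = n because of the factor n - k. *)
pose T k := w k * (n%:R - k%:R) * F k * F k.+1.
have wS k : w k.+1 * (k.+1%:R + n%:R) = w k * (n%:R - k%:R).
  rewrite /w -natrD -natrM addnS mulnC (addnC k.+1) addnS mul_bin_left natrM mulrC.
  have [kN|Nk] := leqP (n + k) N.
    by congr (_ * _); rewrite natrB// natrM natrD; ring.
  by rewrite bin_small// !mul0r.
have FE k : (k < n)%N -> w k.+1 * (a / k.+1%:R + b * k.+1%:R) * F k.+1 ^+ 2 =
    - (b / 2) * (T k.+1 - T k).
  move=> kn; have k0 : k.+1%:R != 0 :> R by rewrite pnatr_eq0.
  have H := qv_resolvent_mulE a b x (Ordinal kn).
  rewrite /= xE mxE -/F in H.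
  rewrite /T -(wS k).
  apply/eqP; rewrite -subr_eq0; apply/eqP.
  transitivity (w k.+1 * F k.+1 / k.+1%:R * (a * F k.+1 - b * (- k.+1%:R ^+ 2 * F k.+1 +
      2^-1 * k.+1%:R * (k.+1%:R + n%:R) * F k +
      2^-1 * k.+1%:R * (k.+1%:R - n%:R) * F k.+2))).
    by field; rewrite nat1r.
  by rewrite -H mulr0.
have S0 : \sum_(k < n) w k.+1 * (a / k.+1%:R + b * k.+1%:R) * F k.+1 ^+ 2 = 0.
  rewrite (eq_bigr (fun k : 'I_n => - (b / 2) * (T k.+1 - T k))).
    rewrite -mulr_sumr -(big_mkord xpredT (fun k => T k.+1 - T k)).
    by rewrite telescope_sumr// /T subrr [F 0%N]/= !(mulr0, mul0r, subrr).
  by move=> k _; exact: FE.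
apply/rowP => j; rewrite mxE.
have /psumr_eq0P/(_ S0)/(_ j isT) : forall k : 'I_n, true ->
    0 <= w k.+1 * (a / k.+1%:R + b * k.+1%:R) * F k.+1 ^+ 2.
  move=> k _; rewrite mulr_ge0 ?sqr_ge0// mulr_ge0// addr_ge0 ?divr_ge0//.
  by rewrite mulr_ge0 ?(ltW b0).
move=> /eqP; rewrite mulf_eq0 mulf_eq0 sqrf_eq0 => /orP[/orP[|]|].
- by rewrite pnatr_eq0 -leqn0 leqNgt bin_gt0; have := ltn_ord j; lia.
- have : 0 < a / j.+1%:R + b * j.+1%:R.
    by rewrite ltr_wpDl ?divr_ge0// mulr_gt0.
  by move=> /lt0r_neq0/negbTE ->.
- by rewrite /F cv_at_ord mxE => /eqP.
Qed.

(** The vectors s_m are i^m times these real vectors.  The initial vector is written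
    in closed form: the rows of A_n sum to 0, except for the omitted entry of the
    first row, so A_n maps the all-ones vector to a multiple of e_n. *)
Fixpoint qv_t (m : nat) : 'cV[R]_n :=
  if m is m'.+1 then
    invmx (m%:R%:M - (2 / n%:R) *: qv_A R n) *m qv_B R n *m qv_t m'
  else const_mx 1.

Let toCM p q r (A : 'M[R]_(p, q)) (B : 'M[R]_(q, r)) :
  toC (A *m B) = toC A *m toC B.
Proof. exact: map_mxM. Qed.

Let two_n_gt0 : 0 < 2 / n%:R :> R.
Proof. by rewrite divr_gt0// ltr0n. Qed.

Lemma qv_A_const : qv_A R n *m const_mx 1 =
  - (n.+1%:R / 2) *: \col_i ((i == 0 :> nat)%:R : R).
Proof.
apply/colP => i; pose F k : R := (0 < k)%:R.
rewrite (@qv_A_mulE _ F) ?mxE//; last by move=> j; rewrite mxE.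
rewrite /F; case: (nat_of_ord i) => [|i'] /=.
  by rewrite -natr1; field.
by rewrite !mulr1 mulr0 -natr1; field.
Qed.

Lemma qv_sE m : qv_s R n m = 'i%C ^+ m *: toC (qv_t m).
Proof.
elim: m => [|m IH] /=.
  have Au : qv_A R n \in unitmx.
    have := qv_resolvent_unit (lexx 0) ltr01.
    by rewrite scale1r raddf0 sub0r -scaleN1r unitmxZ ?unitrN1.
  rewrite expr0 scale1r.
  have -> : qv_e R n = toC (\col_i ((i == 0 :> nat)%:R : R)).
    by apply/colP => i; rewrite !mxE rmorph_nat.
  rewrite -toCM.
  have -> : n.+1%:R / 2 = real_complex R (n.+1%:R / 2) :> C.
    by rewrite fmorph_div !rmorph_nat.
  rewrite -map_mxZ -map_mxN; congr toC.
  have /(canRL (mulKmx Au)) -> := qv_A_const.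
  by rewrite -scalemxAr scaleNr.
rewrite IH -!scalemxAr scalerA -exprS; congr (_ *: _).
by rewrite !toCM.
Qed.

Lemma qv_tS m : (m.+1%:R%:M - (2 / n%:R) *: qv_A R n) *m qv_t m.+1 =
  qv_B R n *m qv_t m.
Proof. by rewrite /= -mulmxA mulKVmx// qv_resolvent_unit. Qed.

(** The sequence t_m(k) for k >= 0, with the value at k = 0 that makes the recurrence
    homogeneous: the vector e_n in the definition of s_0 is the contribution of
    t_0(0) = 1. *)
Definition qv_pos (m k : nat) : R :=
  if k is 0 then (m == 0)%:R else cv_at (qv_t m) k.

Lemma qv_pos_rec m k : (0 < k <= n)%N ->
  m%:R * qv_pos m k = n%:R^-1 *
    (- 2 * k%:R ^+ 2 * qv_pos m k + k%:R * (k%:R + n%:R) * qv_pos m k.-1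
      + k%:R * (k%:R - n%:R) * qv_pos m k.+1)
    + k%:R * lag qv_pos m k.
Proof.
case: k => // k /andP[_ kn]; case: m => [|m].
  have t0 j : (j <= n)%N -> qv_pos 0 j = 1.
    by case: j => // j jn; rewrite /qv_pos (cv_at_ord _ (Ordinal jn)) mxE.
  rewrite [k.+1.-1]/= (t0 k.+1)// (t0 k) ?(ltnW kn)//.
  rewrite mulr0 addr0 mul0r.
  move: kn; rewrite leq_eqVlt => /predU1P[->|kn]; first by field.
  by rewrite t0//; field.
have := qv_resolvent_mulE m.+1%:R (2 / n%:R) (qv_t m.+1) (Ordinal kn).
rewrite qv_tS mul_diag_mx mxE [X in X * _]mxE -(cv_at_ord (qv_t m)) /=.
by case: k kn => [|k] kn /= ->; field.
Qed.

(** The parity extension to k = r - n < 0; changing k to -k exchanges the two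
    off-diagonals of A and changes the sign of B. *)
Definition qv_ext (m r : nat) : R :=
  if (n <= r)%N then qv_pos m (r - n) else (-1) ^+ m * qv_pos m (n - r).

Lemma qv_ext_ge m k : qv_ext m (n + k) = qv_pos m k.
Proof. by rewrite /qv_ext leq_addr addKn. Qed.

Lemma qv_ext_le m r : (r <= n)%N -> qv_ext m r = (-1) ^+ m * qv_pos m (n - r).
Proof.
rewrite /qv_ext leq_eqVlt => /predU1P[->|rn]; last by rewrite leqNgt rn.
by rewrite leqnn subnn; case: m => [|m] /=; rewrite ?mul1r ?mulr0.
Qed.

Lemma qv_ext_rec m r : (r <= N)%N ->
  let k : R := r%:R - n%:R in
  m%:R * qv_ext m r = n%:R^-1 *
    (- 2 * k ^+ 2 * qv_ext m r + k * r%:R * qv_ext m r.-1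
      + k * (r%:R - N%:R) * qv_ext m r.+1)
    + k * lag qv_ext m r.
Proof.
move=> rN /=.
have [rn|nr|->] := ltngtP r n; last 1 first.
- rewrite subrr expr0n /= !(mul0r, mulr0, addr0).
  by rewrite -[X in qv_ext _ X]addn0 qv_ext_ge; case: m => [|m]; rewrite ?mul0r ?mulr0.
- have [k kn rE] : exists2 k, (0 < k <= n)%N & (r = n - k)%N.
    by exists (n - r)%N; lia.
  have rR : r%:R = n%:R - k%:R :> R by rewrite rE natrB//; case/andP: kn.
  have -> : qv_ext m r = (-1) ^+ m * qv_pos m k.
    by rewrite qv_ext_le 1?ltnW// rE subKn//; case/andP: kn.
  have -> : qv_ext m r.+1 = (-1) ^+ m * qv_pos m k.-1.
    by rewrite qv_ext_le//; congr (_ * qv_pos _ _); lia.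
  have -> : lag qv_ext m r = - (-1) ^+ m * lag qv_pos m k.
    case: m => [|m] /=; first by rewrite mulr0.
    rewrite qv_ext_le 1?ltnW// rE subKn//; last by case/andP: kn.
    by rewrite exprS; ring.
  have -> : (r%:R - n%:R) * r%:R * qv_ext m r.-1 =
      (r%:R - n%:R) * r%:R * ((-1) ^+ m * qv_pos m k.+1).
    case: r rE {rN rR} rn => [|r] rE rn; first by rewrite mulr0 !mul0r.
    rewrite [r.+1.-1]/= qv_ext_le; last lia.
    by congr (_ * (_ * qv_pos _ _)); lia.
  rewrite mulrCA (qv_pos_rec _ kn) rR natrM; ring.
have [k kn rE] : exists2 k, (0 < k <= n)%N & (r = n + k)%N.
  by exists (r - n)%N; lia.
have -> : lag qv_ext m r = lag qv_pos m k.
  by case: m => //= m; rewrite rE qv_ext_ge.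
have -> : qv_ext m r.-1 = qv_pos m k.-1.
  by rewrite -qv_ext_ge; congr qv_ext; lia.
rewrite rE -addnS !qv_ext_ge (qv_pos_rec _ kn) natrM natrD; ring.
Qed.

Lemma qv_ext_top : qv_ext 0 N = 1.
Proof.
rewrite mul2n -addnn qv_ext_ge -(prednK n_gt0) /qv_pos.
have n'n : (n.-1 < n)%N by rewrite prednK.
by rewrite (cv_at_ord _ (Ordinal n'n)) mxE.
Qed.

Lemma qv_diff_extE m : qv_diff n qv_ext m 0 =
  qv_weight R n n * (m == 0)%:R
  + (1 + (-1) ^+ m) * \sum_(i < n) qv_v R n i 0 * qv_t m i 0.
Proof.
have sgn a b : (-1) ^+ (a + b.*2) = (-1) ^+ a :> R.
  by rewrite exprD -mul2n exprM sqrrN !expr1n mulr1.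
have wE k : (k <= n)%N -> qv_weight R n (n - k) = qv_weight R n (n + k).
  move=> kn; rewrite /qv_weight; congr (_ * _ / _).
    by rewrite (_ : n + (n + k) = n + (n - k) + k.*2)%N ?sgn//; lia.
  by rewrite -bin_sub; [congr ('C(_, _)%:R)|]; lia.
have vE (i : 'I_n) : qv_v R n i 0 = qv_weight R n (n + i.+1).
  rewrite mxE /qv_weight; congr (_ * _ / _).
  by rewrite addnA addnn addnC sgn.
rewrite /qv_diff -(big_mkord xpredT (fun r => qv_weight R n r * (r ^_ 0)%:R * qv_ext m r)).
rewrite (big_cat_nat (n := n))//=; last lia.
rewrite (_ : N.+1 = n.+1 + n)%N; last lia.
rewrite -{3}[n]add0n big_addn addnK big_nat_rev /= add0n.
rewrite big_nat_recl// add0n -[X in qv_ext _ X]addn0 qv_ext_ge ffactn0 mulr1.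
rewrite addrCA; congr (_ + _).
rewrite mulrDl mul1r addrC !big_mkord mulr_sumr; congr (_ + _).
  apply: eq_bigr => i _; rewrite ffactn0 mulr1 addnC qv_ext_ge -vE /qv_pos.
  by rewrite cv_at_ord.
apply: eq_bigr => i _; have iN := ltn_ord i.
rewrite ffactn0 mulr1 qv_ext_le; last lia.
by rewrite subKn// wE// -vE /qv_pos cv_at_ord mulrCA.
Qed.

(** The terms for k and -k cancel when m is odd. *)
Lemma qv_diff_ext_odd m : odd m -> qv_diff n qv_ext m 0 = 0.
Proof.
move=> om; rewrite qv_diff_extE -signr_odd om expr1 subrr mul0r addr0.
by case: m om => // m _; rewrite mulr0.
Qed.

Lemma qv_term_even j (lambda : C) : (0 < j)%N ->
  2 * (((toC (qv_v R n))^T *m qv_s R n (2 * j)) 0 0 * lambda ^+ (2 * j)) =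
  ('i%C * lambda) ^+ (2 * j) * (qv_diff n qv_ext (2 * j) 0)%:C%C.
Proof.
move=> j0; rewrite qv_diff_extE [(-1) ^+ _]exprM sqrrN !expr1n -[_ == _]negbK -lt0n.
rewrite muln_gt0 j0 /= mulr0 add0r rmorphM rmorphD rmorph1 /=.
rewrite qv_sE -scalemxAr mxE exprMn.
have -> : ((toC (qv_v R n))^T *m toC (qv_t (2 * j))) 0 0 =
   (\sum_(i < n) qv_v R n i 0 * qv_t (2 * j) i 0)%:C%C.
  rewrite mxE rmorph_sum /=; apply: eq_bigr => i _.
  by rewrite !mxE -rmorphM.
by ring.
Qed.

End QuValkoExtension.

(** * Matching the two recurrences *)

Section Coupling.
Variables (R : realType) (n : nat).
Hypothesis n_gt0 : (0 < n)%N.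
Local Notation N := (2 * n)%N.

Let n_neq0 : n%:R != 0 :> R.
Proof. by rewrite pnatr_eq0 -lt0n. Qed.

Variable kappa : nat -> nat -> R.
Hypothesis kappa_rec : forall m p, (p <= N)%N ->
  (m%:R + p%:R * (4 * n%:R + 1 - p%:R) / n%:R) * kappa m p =
  (N%:R - p%:R) * lag kappa m p.+1 + (p%:R - n%:R) * lag kappa m p
    + qv_coef R n p * kappa m p.-1.

(** The coefficients of x^(N+p) J_p when J_p has coefficients [kappa]. *)
Definition moment_shear (m p : nat) : R :=
  if (N + p <= m)%N then kappa (m - (N + p)) p else 0.

Lemma moment_shear_rec m p : (p <= N)%N ->
  (m%:R - gauge_exp R n p) * moment_shear m p =
  (N%:R - p%:R) * moment_shear m p.+1 + (p%:R - n%:R) * lag moment_shear m p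
    + qv_coef R n p * (if p is p'.+1 then lag moment_shear m p' else 0).
Proof.
move=> pN; have [Npm|mNp] := leqP (N + p) m; last first.
  have msE q : (p <= q)%N -> moment_shear m q = 0.
    by move=> pq; rewrite /moment_shear ifF//; lia.
  have lE : lag moment_shear m p = 0.
    by case: m mNp {msE} => //= m mNp; rewrite /moment_shear ifF//; lia.
  have lE' : (if p is p'.+1 then lag moment_shear m p' else 0) = 0.
    case: p {pN lE msE} mNp => // p mNp.
    by case: m mNp => //= m mNp; rewrite /moment_shear ifF//; lia.
  by rewrite !msE// lE lE'; ring.
have [m' mE] : exists m', m = (m' + (N + p))%N.
  by exists (m - (N + p))%N; rewrite subnK.
have -> : m%:R - gauge_exp R n p = m'%:R + p%:R * (4 * n%:R + 1 - p%:R) / n%:R.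
  by rewrite mE /gauge_exp (natrD _ m') (natrD _ N p) natrM; field.
have -> : moment_shear m p = kappa m' p.
  by rewrite /moment_shear Npm mE addnK.
rewrite kappa_rec//; congr (_ * _ + _ * _ + _).
- rewrite /moment_shear mE addnS; case: (m') => [|m''] /=.
    by rewrite ifF//; lia.
  by rewrite ifT; [congr kappa|]; lia.
- rewrite mE; case: (m') => [|m''] /=.
    rewrite add0n; case E : (N + p)%N => [|q] //=.
    by rewrite /moment_shear ifF//; lia.
  by rewrite /moment_shear ifT; [congr kappa|]; lia.
case: p {pN} Npm mE => [|p] Npm mE; first by rewrite /qv_coef !mul0r.
rewrite mE !addnS /= /moment_shear ifT; last lia.
by congr (_ * kappa _ _); lia.
Qed.

Variable t : nat -> nat -> R.
Hypothesis t_rec : forall m r, (r <= N)%N ->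
  let k : R := r%:R - n%:R in
  m%:R * t m r = n%:R^-1 *
    (- 2 * k ^+ 2 * t m r + k * r%:R * t m r.-1 + k * (r%:R - N%:R) * t m r.+1)
    + k * lag t m r.
Hypothesis t00 : t 0 N = 1.

Lemma qv_gauged0 m : qv_gauged n (qv_diff n t) m 0 = qv_diff n t m 0.
Proof.
rewrite /qv_gauged big_ord_recl big1 => [|j _]; last first.
  by rewrite gauge_coef_small// mul0r.
by rewrite /gauge_coef /qv_shear /= !subn0 !ffactn0 bin0 !expr0; field.
Qed.

(** This is where the constant D_n comes from. *)
Lemma qv_diff_lead : qv_diff n t N 0 = (-1) ^+ n * selberg_D R n.
Proof.
have := qv_diff_diag n_gt0 t_rec t00 (leqnn N); rewrite subnn.
have F : ((3 * n) ^_ N * n`! = (3 * n)`!)%N.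
  rewrite -(@ffact_fact (3 * n) N); last lia.
  by congr (_ * _`!)%N; lia.
have F0 m : m`!%:R != 0 :> R by rewrite pnatr_eq0 -lt0n fact_gt0.
rewrite /selberg_D -F !natrM !natrX => H.
have ff0 : ((3 * n) ^_ N)%:R != 0 :> R by rewrite pnatr_eq0 -lt0n ffact_gt0; lia.
transitivity ((qv_diff n t N 0 * (N`!%:R * ((3 * n) ^_ N)%:R)) / (N`!%:R * ((3 * n) ^_ N)%:R)).
  by field; rewrite ff0 F0.
by rewrite H; field; rewrite ff0 !F0.
Qed.

(** Both sides are entries p = 0 of solutions of the same recurrence that vanish for
    m < N and agree at m = N, so [gauged_unique] applies. *)
Lemma qv_diff_moments m :
  kappa 0 0 * qv_diff n t m 0 =
  (-1) ^+ n * selberg_D R n * (if (N <= m)%N then kappa (m - N) 0 else 0).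
Proof.
pose d m p := kappa 0 0 * qv_gauged n (qv_diff n t) m p
  - (-1) ^+ n * selberg_D R n * moment_shear m p.
have lagd q p : lag d q p = kappa 0 0 * lag (qv_gauged n (qv_diff n t)) q p
    - (-1) ^+ n * selberg_D R n * lag moment_shear q p.
  by case: q => //=; rewrite !mulr0 subr0.
have f_top q : qv_diff n t q N.+1 = 0.
  rewrite /qv_diff big1// => r _; rewrite ffact_small ?mulr0 ?mul0r//.
have d0 : d m 0%N = 0.
  apply: (@gauged_unique _ n n_gt0 d) => // [q p pN|q p qN pN|].
  - have H1 := qv_gauged_rec n_gt0 (qv_diff_rec t_rec) f_top q pN.
    have H2 := moment_shear_rec q pN.
    rewrite /d mulrBr mulrCA H1 [X in _ - X]mulrCA H2 !lagd.
    by case: p {pN H1 H2} => [|p]; rewrite ?lagd; ring.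
  - rewrite /d /qv_gauged big1 => [|j _]; last first.
      rewrite /qv_shear; case: ifP => [jq|_]; last by rewrite mulr0.
      by rewrite (qv_diff_small n_gt0 t_rec) ?mulr0//; lia.
    rewrite /moment_shear ifF ?mulr0 ?subr0//; lia.
  - rewrite /d qv_gauged0 qv_diff_lead /moment_shear addn0 leqnn subnn; ring.
move: d0 => /eqP; rewrite subr_eq0 qv_gauged0 => /eqP ->.
by rewrite /moment_shear addn0.
Qed.

End Coupling.

(** * Lebesgue measure on tuples: Fubini and permutations *)

Section TupleLebesgue.
Variable R : realType.
Local Notation RT := (measurableTypeR R).
Local Notation mu := (@lebesgue_measure R).

Definition cube (m : nat) : set (m.-tuple RT) :=
  [set u | forall j : 'I_m, 0 <= (tnth u j : R) <= 1].
Arguments cube : clear implicits.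

Lemma measurable_box m (B : 'I_m -> set RT) : (forall i, measurable (B i)) ->
  measurable [set t : m.-tuple RT | forall i, B i (tnth t i)].
Proof.
move=> mB; rewrite (_ : mkset _ =
    \bigcap_(i in [set: 'I_m]) ((fun t => tnth t i) @^-1` B i)).
  apply: fin_bigcap_measurable => // i _.
  by rewrite -[X in measurable X]setTI; exact: measurable_tnth.
by apply/seteqP; split => t /= tB i => [_|]; exact: tB.
Qed.

Lemma measurable_cube m : measurable (cube m).
Proof.
have -> : cube m = [set t | forall i, [set` `[0, 1]%R] (tnth t i)].
  by apply/seteqP; split => t /= H j; have := H j; rewrite in_itv.
apply: (@measurable_box _ (fun=> [set` `[0, 1]%R])) => i.
exact: measurable_itv.
Qed.

Lemma tuple_lebesgue_cube m : tuple_lebesgue R m (cube m) = 1%E.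
Proof.
have -> : cube m = [set t | forall i, [set` `[0, 1]%R] (tnth t i)].
  by apply/seteqP; split => t /= H j; have := H j; rewrite in_itv.
rewrite (@tuple_lebesgue_box R m (fun=> [set` `[0, 1]%R])); last first.
  by move=> i; exact: measurable_itv.
rewrite big1// => i _; rewrite lebesgue_measure_itv/= lte_fin ltr01.
by rewrite sube0.
Qed.

Lemma cube_cons m (x : R) (t : m.-tuple RT) :
  cube m.+1 (tuple_cons (x, t)) <-> (0 <= x <= 1) /\ cube m t.
Proof.
split=> [H|[x01 H] j].
  split; first exact: (H ord0).
  by move=> j; have := H (lift ord0 j); rewrite tnthS.
by case: (unliftP ord0 j) => [i ->|->//]; rewrite tnthS.
Qed.

Lemma integral_tuple_cons_ge0 m (f : m.+1.-tuple RT -> \bar R) :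
  measurable_fun [set: m.+1.-tuple RT] f -> (forall u, 0 <= f u)%E ->
  (\int[tuple_lebesgue R m.+1]_u f u =
   \int[tuple_lebesgue R m]_t \int[mu]_x f (tuple_cons (x, t)))%E.
Proof.
move=> mf f0.
rewrite (@ge0_integral_pushforward _ _ _ _ _ _ (@measurable_tuple_cons R m)
  (mu \x tuple_lebesgue R m)%E setT f)//.
rewrite preimage_setT fubini_tonelli2// => [|x]; last exact: f0.
by apply: measurableT_comp => //; exact: measurable_tuple_cons.
Qed.

Lemma integral_tuple_cons m (f : m.+1.-tuple RT -> \bar R) :
  (tuple_lebesgue R m.+1).-integrable setT f ->
  (\int[tuple_lebesgue R m.+1]_u f u =
   \int[tuple_lebesgue R m]_t \int[mu]_x f (tuple_cons (x, t)))%E.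
Proof.
move=> intf; have mf := measurable_int _ intf.
have intf' : (mu \x tuple_lebesgue R m)%E.-integrable setT (f \o @tuple_cons R m).
  apply/integrableP; split.
    by apply: measurableT_comp => //; exact: measurable_tuple_cons.
  case/integrableP : intf => _.
  rewrite (@ge0_integral_pushforward _ _ _ _ _ _ (@measurable_tuple_cons R m)
    (mu \x tuple_lebesgue R m)%E setT (fun x => `|f x|%E))//.
  exact: measurableT_comp.
rewrite (@integral_pushforward _ _ _ _ _ _ (@measurable_tuple_cons R m)
    (mu \x tuple_lebesgue R m)%E setT f)//.
by rewrite preimage_setT -(integral21_prod_meas1 intf').
Qed.

Definition tuple_perm m (s : {perm 'I_m}) (t : m.-tuple RT) : m.-tuple RT :=
  [tuple tnth t (s i) | i < m].

Lemma measurable_tuple_perm m (s : {perm 'I_m}) :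
  measurable_fun [set: m.-tuple RT] (tuple_perm s).
Proof.
apply/measurable_fun_tnthP => i.
rewrite (_ : _ \o _ = fun t => tnth t (s i)); first exact: measurable_tnth.
by apply/funext => t /=; rewrite tnth_mktuple.
Qed.

Definition box m : set (set (m.-tuple RT)) :=
  [set A | exists2 B : 'I_m -> set RT, (forall i, measurable (B i)) &
     A = [set t | forall i, B i (tnth t i)]].
Arguments box : clear implicits.

(** Boxes are stable under intersection, unlike the coordinate cylinders that define
    the sigma-algebra, and they generate it as well. *)
Lemma measurable_tuple_boxE m :
  (measurable : set (set (m.-tuple RT))) = <<s box m >>.
Proof.
apply/seteqP; split; last first.
  apply: smallest_sub; first exact: sigma_algebra_measurable.
  by move=> _ [B mB ->]; exact: measurable_box.
apply: smallest_sub; first exact: smallest_sigma_algebra.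
rewrite -bigcup_seq; apply: bigcup_sub => i _ _ [A mA <-].
apply: sub_sigma_algebra; exists (fun j => if j == i then A else setT).
  by move=> j; case: ifP.
rewrite setTI; apply/seteqP; split => [t At j|t /(_ i)].
  by case: eqP => // ->.
by rewrite eqxx.
Qed.

(** The two measures agree on boxes, since a permutation only reorders the product of
    the side lengths. *)
Lemma tuple_lebesgue_perm m (s : {perm 'I_m}) (A : set (m.-tuple RT)) :
  measurable A ->
  tuple_lebesgue R m (tuple_perm s @^-1` A) = tuple_lebesgue R m A.
Proof.
move=> mA.
pose m1 : {measure set (m.-tuple RT) -> \bar R} :=
  measure_function_pushforward__canonical__measure_function_Measure
    (tuple_lebesgue R m) (measurable_tuple_perm s).
apply: esym.
apply: (@measure_unique _ R (m.-tuple RT) (box m)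
  (fun k => [set t | forall i, [set` `[- k%:R, k%:R]%R] (tnth t i : R)])
  (measurable_tuple_boxE m) _ _ _ (tuple_lebesgue R m) m1) => //.
- move=> _ _ [B mB ->] [C mC ->]; exists (fun i => B i `&` C i).
    by move=> i; exact: measurableI.
  apply/seteqP; split => [t [Bt Ct] i|t H]; first by split.
  by split => i; have [] := H i.
- by move=> k; exists (fun=> [set` `[- k%:R, k%:R]%R]) => // i; exact: measurable_itv.
- apply/seteqP; split => // t _.
  exists (Num.truncn (\sum_(i < m) `|tnth t i : R|)).+1 => // i /=.
  rewrite in_itv /= -ler_norml.
  apply/ltW/(le_lt_trans _ (truncnS_gt _)).
  by rewrite (bigD1 i)//= lerDl sumr_ge0.
- move=> _ [B mB ->].
  transitivity (\prod_(i < m) mu (B i))%E; first exact: tuple_lebesgue_box.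
  rewrite /m1 /= /pushforward.
  transitivity (tuple_lebesgue R m [set t | forall i, B ((s^-1)%g i) (tnth t i)]).
    rewrite (@tuple_lebesgue_box R m (fun i => B ((s^-1)%g i)))//.
    by rewrite (reindex_inj (@perm_inj _ (s^-1)%g)).
  congr (tuple_lebesgue R m _); apply/seteqP; split => t /= H i.
    by rewrite tnth_mktuple; have := H (s i); rewrite permK.
  by have := H ((s^-1)%g i); rewrite tnth_mktuple permKV.
- move=> k; have E := @tuple_lebesgue_box R m
    (fun=> [set` `[- k%:R, k%:R]%R]) (fun=> measurable_itv _).
  apply: (eq_ind_r (fun z => (z < +oo)%E) _ E).
  have [r ->] : exists r : R, mu [set` `[- k%:R, k%:R]%R] = r%:E.
    by rewrite lebesgue_measure_itv/=; case: ifP => _; [exists (k%:R + k%:R); rewrite -EFinB opprK|exists 0].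
  suff [z ->] : exists z : R, (\prod_(i < m) r%:E)%E = z%:E by rewrite ltry.
  elim/big_rec: _ => [|i x _ [z ->]]; first by exists 1.
  by exists (r * z); rewrite EFinM.
Qed.

End TupleLebesgue.
Arguments cube R m _ : clear implicits.
Arguments box R m _ : clear implicits.

(** * Integrability of the endpoint singularities *)

(** The fundamental theorem of calculus for functions that are differentiable up to
    and including the endpoints. *)
Lemma FTC_is_derive (R : realType) (a b : R) (F f : R -> R) : a < b ->
  (forall x, a <= x <= b -> is_derive x 1 F (f x)) ->
  (forall x, a <= x <= b -> {for x, continuous f}) ->
  (\int[lebesgue_measure]_(x in `[a, b]) (f x)%:E = (F b - F a)%:E)%E.
Proof.
move=> ab dF cf.
have cF x : a <= x <= b -> {for x, continuous F}.
  move=> /dF H; apply: differentiable_continuous; apply/derivable1_diffP.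
  exact: ex_derive.
rewrite (@continuous_FTC2 _ f F)//.
- apply: continuous_in_subspaceT => x; rewrite inE /= in_itv /= => /cf.
  exact.
- split=> [x| |].
  + by rewrite in_itv /= => /andP[/ltW ax /ltW xb]; apply: ex_derive; apply: dF; rewrite ax.
  + by apply: cvg_at_right_filter; apply: cF; rewrite lexx ltW.
  + by apply: cvg_at_left_filter; apply: cF; rewrite lexx ltW.
- move=> x; rewrite in_itv /= => /andP[/ltW ax /ltW xb].
  by rewrite derive1E; apply: derive_val; apply: dF; rewrite ax.
Qed.

Section SingularWeight.
Variable R : realType.
Local Notation RT := (measurableTypeR R).
Local Notation mu := (@lebesgue_measure R).

Variable al : R.
Hypotheses (al_gtN1 : -1 < al) (al_le0 : al <= 0).

Definition beta_density (x : R) : R := x `^ al * (1 - x) `^ al.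

Lemma beta_density_ge0 x : 0 <= beta_density x.
Proof. by rewrite mulr_ge0// powR_ge0. Qed.

Lemma measurable_beta_density : measurable_fun [set: RT] beta_density.
Proof.
apply: measurable_funM; first exact: measurable_powR.
apply: (measurableT_comp (measurable_powR _)).
by apply: measurable_funB => //.
Qed.

Let al1 : 0 < al + 1. Proof. by rewrite -ltrBlDr sub0r. Qed.

Lemma powR_half_le (y : R) : 2^-1 <= y -> y `^ al <= 2.
Proof.
move=> y2; have h : (0 : R) < 2^-1 by rewrite invr_gt0.
have y0 : 0 < y := lt_le_trans h y2.
have [y1|y1] := leP 1 y.
  apply: (@le_trans _ _ (y `^ 0)); first exact: ler_powR.
  by rewrite powRr0 ler1n.
apply: (@le_trans _ _ (y `^ (-1))).
  by apply: ger_powR; rewrite ?y0 ltW.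
by rewrite powR_inv1 ?(ltW y0)// -[leRHS]invrK lef_pV2 ?posrE.
Qed.

(** One of the two factors is at most 2, because x or 1 - x is at least 1/2 and
    al > -1. *)
Lemma beta_density_le x : 0 <= x <= 1 ->
  beta_density x <= 2 * (x `^ al + (1 - x) `^ al).
Proof.
move=> /andP[x0 x1]; rewrite /beta_density mulrDr.
have [x2|x2] := leP x 2^-1.
  rewrite -[leLHS]addr0 lerD ?mulr_ge0 ?powR_ge0// mulrC ler_wpM2r ?powR_ge0//.
  by apply: powR_half_le; lra.
rewrite -[leLHS]add0r lerD ?mulr_ge0 ?powR_ge0// ler_wpM2r ?powR_ge0//.
by apply: powR_half_le; exact: ltW.
Qed.

(** The integral over [d, 1 - d] is given by an explicit antiderivative and is bounded
    uniformly in d; these intervals exhaust ]0, 1[. *)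
Lemma integral_powR_sum_lty :
  (\int[mu]_(x in `[0%R, 1%R]) (x `^ al + (1 - x) `^ al)%:E < +oo)%E.
Proof.
pose f (x : R) := (x `^ al + (1 - x) `^ al)%:E.
(* Starting at 1/3 keeps d k below 1/2, so that d k < 1 - d k. *)
pose d k : R := k.+3%:R^-1.
have d0 k : 0 < d k by rewrite invr_gt0.
have d2 k : d k < 1 - d k.
  have : d k < 2^-1 by rewrite ltf_pV2 ?posrE// ltr_nat.
  lra.
have mf : measurable_fun [set: RT] f.
  apply/measurable_EFinP; apply: measurable_funD; first exact: measurable_powR.
  by apply: (measurableT_comp (measurable_powR _)); apply: measurable_funB.
pose G (x : R) := (al + 1)^-1 * (x `^ (al + 1) - (1 - x) `^ (al + 1)).
have GE k : (\int[mu]_(x in `[d k, (1 - d k)%R]) f x = (G (1 - d k) - G (d k))%:E)%E.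
  apply: FTC_is_derive => // x /andP[dx xd].
    have x0 : 0 < x by exact: lt_le_trans dx.
    have x1 : 0 < 1 - x by have := d0 k; lra.
    have H1 := is_derive1_powR (al + 1) x0.
    have H2 : is_derive x 1 ((powR (R:=R))^~ (al + 1) \o (fun y : R => 1 - y))
       ((al + 1) * (1 - x) `^ (al + 1 - 1) * (0 - 1)).
      apply: is_derive1_comp; first exact: is_derive1_powR.
    have H3 := @is_deriveZ _ _ _ _ (al + 1)^-1 _ _ _ (is_deriveB H1 H2).
    apply: (is_derive_eq H3).
    rewrite addrK /GRing.scale /=; field.
    by rewrite gt_eqF.
  have x0 : 0 < x by exact: lt_le_trans dx.
  have x1 : 0 < 1 - x by have := d0 k; lra.
  have H1 := is_derive1_powR al x0.
  have H2 : is_derive x 1 ((powR (R:=R))^~ al \o (fun y : R => 1 - y))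
       (al * (1 - x) `^ (al - 1) * (0 - 1)).
    apply: is_derive1_comp; first exact: is_derive1_powR.
  apply: differentiable_continuous; apply/derivable1_diffP.
  by apply: (@ex_derive _ _ _ _ _ _ _ (is_deriveD H1 H2)).
rewrite -integral_itv_obnd_cbnd; last exact: measurable_funTS.
rewrite -integral_itv_bndo_bndc; last exact: measurable_funTS.
have -> : `]0%R, 1%R[%classic = \bigcup_k `[d k, (1 - d k)%R]%classic.
  apply/seteqP; split=> x /=; last first.
    by case=> k _ /=; rewrite !in_itv /= => /andP[h1 h2]; have := d0 k; lra.
  rewrite in_itv /= => /andP[x0 x1].
  have [k kP] : exists k, d k <= x /\ d k <= 1 - x.
    exists (Num.truncn (x^-1 + (1 - x)^-1)).
    have H := truncnS_gt (x^-1 + (1 - x)^-1).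
    have x1' : 0 < 1 - x by lra.
    have ix : 0 < x^-1 by rewrite invr_gt0.
    have ix1 : 0 < (1 - x)^-1 by rewrite invr_gt0.
    have H' : x^-1 + (1 - x)^-1 <= (Num.truncn (x^-1 + (1 - x)^-1)).+3%:R.
      by apply: (le_trans (ltW H)); rewrite ler_nat; exact: (leq_addl 2 _).
    split; rewrite /d -[leRHS]invrK lef_pV2 ?posrE//; apply: (le_trans _ H').
      by rewrite lerDl ltW.
    by rewrite lerDr ltW.
  by exists k => //=; rewrite in_itv /=; lra.
have cv : (\int[mu]_(x in `[d k, (1 - d k)%R]) f x)%E @[k --> \oo] -->
    (\int[mu]_(x in \bigcup_k `[d k, (1 - d k)%R]%classic) f x)%E.
  apply: ge0_nondecreasing_set_cvg_integral => //.
  - move=> k l kl; apply/subsetPset => x /=; rewrite !in_itv /= => /andP[h1 h2].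
    have : d l <= d k by rewrite lef_pV2 ?posrE// ler_nat.
    lra.
  - by move=> k; exact: measurable_funTS.
  - by move=> k x _; rewrite lee_fin addr_ge0// powR_ge0.
apply: (@le_lt_trans _ _ (2 / (al + 1))%:E); last by rewrite ltry.
rewrite -(cvg_lim _ cv)//; apply: lime_le; first by apply/cvg_ex; eexists; exact: cv.
apply: nearW => k; rewrite GE lee_fin /G subKr -mulrBr mulrC ler_wpM2r//.
  by rewrite invr_ge0 ltW.
have h1 : (1 - d k) `^ (al + 1) <= 1.
  have : (1 - d k) `^ (al + 1) <= 1 `^ (al + 1); last by rewrite powR1.
  apply: ge0_ler_powR; rewrite ?nnegrE ?(ltW al1)//.
    by have := d0 k; have := d2 k; lra.
  by have := d0 k; lra.
have h2 := powR_ge0 (d k) (al + 1).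
lra.
Qed.

Lemma beta_density_integrable : mu.-integrable `[0%R, 1%R] (EFin \o beta_density).
Proof.
apply/integrableP; split.
  by apply/measurable_EFinP/measurable_funTS; exact: measurable_beta_density.
under eq_integral do rewrite /= ger0_norm ?beta_density_ge0//.
apply: (@le_lt_trans _ _ (\int[mu]_(x in `[0%R, 1%R]) (2%:E * (x `^ al + (1 - x) `^ al)%:E))%E).
  apply: ge0_le_integral => //=.
  - by move=> x _; rewrite lee_fin beta_density_ge0.
  - by apply/measurable_EFinP/measurable_funTS; exact: measurable_beta_density.
  - apply/measurable_EFinP/measurable_funTS; apply: measurable_funM => //.
    apply: measurable_funD; first exact: measurable_powR.
    by apply: (measurableT_comp (measurable_powR _)); apply: measurable_funB.
  - by move=> x; rewrite in_itv /= lee_fin; exact: beta_density_le.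
rewrite ge0_integralZl//.
- by rewrite lte_mul_pinfty// integral_powR_sum_lty.
- apply/measurable_EFinP/measurable_funTS.
  apply: measurable_funD; first exact: measurable_powR.
  by apply: (measurableT_comp (measurable_powR _)); apply: measurable_funB.
- by move=> x _; rewrite lee_fin addr_ge0// powR_ge0.
Qed.

End SingularWeight.

Section ProductIntegrable.
Variable R : realType.
Local Notation RT := (measurableTypeR R).
Local Notation mu := (@lebesgue_measure R).

Lemma measurable_tuple_prod m (f : R -> R) :
  measurable_fun [set: RT] f ->
  measurable_fun [set: m.-tuple RT] (fun u => \prod_(j < m) f (tnth u j)).
Proof.
move=> mf; apply: measurable_prod => j _.
by apply: (measurableT_comp mf); exact: measurable_tnth.
Qed.

Lemma integral_tuple_prod m (f : R -> R) (c : R) :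
  measurable_fun [set: RT] f -> (forall x, 0 <= f x) ->
  (\int[mu]_x (f x)%:E = c%:E)%E ->
  (\int[tuple_lebesgue R m]_u (\prod_(j < m) f (tnth u j))%:E = (c ^+ m)%:E)%E.
Proof.
move=> mf f0 fc; elim: m => [|m IH].
  rewrite /= integral_dirac//; first by rewrite diracT mul1e big_ord0.
  by apply/measurable_EFinP; exact: measurable_tuple_prod.
etransitivity.
  apply: integral_tuple_cons_ge0.
    by apply/measurable_EFinP; exact: measurable_tuple_prod.
  by move=> u; rewrite lee_fin prodr_ge0.
transitivity (\int[tuple_lebesgue R m]_t (c%:E * (\prod_(j < m) f (tnth t j))%:E))%E.
  apply: eq_integral => t _.
  transitivity (\int[mu]_x ((\prod_(j < m) f (tnth t j))%:E * (f x)%:E))%E.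
    apply: eq_integral => x _; rewrite big_ord_recl -EFinM mulrC; congr EFin.
    by congr (_ * _); apply: eq_bigr => j _; rewrite tnthS.
  rewrite ge0_integralZl//; last 3 first.
  - by apply/measurable_EFinP.
  - by move=> x _; rewrite lee_fin.
  - by rewrite lee_fin prodr_ge0.
  by rewrite fc muleC.
rewrite ge0_integralZl//.
- by rewrite IH -EFinM exprS.
- by apply/measurable_EFinP; exact: measurable_tuple_prod.
- by move=> t _; rewrite lee_fin prodr_ge0.
- by rewrite -fc integral_ge0// => x _; rewrite lee_fin.
Qed.

Lemma integrable_cube_prod m (f : R -> R) :
  measurable_fun [set: RT] f -> (forall x, 0 <= f x) ->
  mu.-integrable `[0%R, 1%R] (EFin \o f) ->
  (tuple_lebesgue R m).-integrable (cube R m)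
    (fun u => (\prod_(j < m) f (tnth u j))%:E).
Proof.
move=> mf f0 intf; apply/integrableP; split.
  by apply/measurable_EFinP/measurable_funTS; exact: measurable_tuple_prod.
pose g (x : R) := (f \_ `[0%R, 1%R]) x.
have g0 x : 0 <= g x by rewrite /g patchE; case: ifP.
have mg : measurable_fun [set: RT] g 
  by apply/(measurable_restrictT f (measurable_itv _)); apply: measurable_funTS.
have gE : (\int[mu]_x (g x)%:E = (fine (\int[mu]_(x in `[0%R, 1%R]) (f x)%:E))%:E)%E.
  rewrite fineK; last exact: integrable_fin_num.
  by rewrite [RHS]integral_mkcond; apply: eq_integral => x _; rewrite /g !patchE; case: ifP.
rewrite integral_mkcond.
have := integral_tuple_prod m mg g0 gE.
rewrite (_ : (fun u => _) = (fun u => `|(\prod_(j < m) f (tnth u j))%:E|)%E \_ (cube R m)).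
  by move=> ->; rewrite ltry.
apply/funext => u; rewrite patchE; case: ifPn => [|nu].
  rewrite inE /= => uQ; rewrite ger0_norm ?prodr_ge0//; congr EFin.
  by apply: eq_bigr => j _; rewrite /g patchE ifT// inE /= in_itv /= uQ.
have [j jP] : exists j, ~ (0 <= (tnth u j : R) <= 1).
  by apply/existsNP => H; move: nu; rewrite notin_setE; apply.
rewrite (bigD1 j)//= {1}/g patchE ifF ?mul0r//.
by apply/negbTE; rewrite notin_setE /= in_itv.
Qed.

End ProductIntegrable.

(** * Weighted means of bounded functions on the cube *)

Section BoundedOnCube.
Variables (R : realType) (N : nat).
Local Notation RT := (measurableTypeR R).
Local Notation pt := (N.-tuple RT).
Local Notation tl := (tuple_lebesgue R N).

(** A class of functions stable under all algebraic operations and whose products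
    with an integrable weight are integrable. *)
Definition cube_bounded (f : pt -> R) : Prop :=
  measurable_fun [set: pt] f /\ exists M, forall u, cube R N u -> `|f u| <= M.

Lemma cube_bounded_cst (c : R) : cube_bounded (fun=> c).
Proof. by split; [exact: measurable_cst|exists `|c|]. Qed.

Lemma cube_bounded_tnth (j : 'I_N) : cube_bounded (fun u => tnth u j).
Proof.
split; first exact: measurable_tnth.
by exists 1 => u /(_ j) /andP[u0 u1]; rewrite ger0_norm.
Qed.

Lemma cube_boundedD f g : cube_bounded f -> cube_bounded g ->
  cube_bounded (fun u => f u + g u).
Proof.
move=> [mf [M fM]] [mg [M' gM]]; split; first exact: measurable_funD.
by exists (M + M') => u uQ; rewrite (le_trans (ler_normD _ _))// lerD ?fM ?gM.
Qed.

Lemma cube_boundedM f g : cube_bounded f -> cube_bounded g ->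
  cube_bounded (fun u => f u * g u).
Proof.
move=> [mf [M fM]] [mg [M' gM]]; split; first exact: measurable_funM.
by exists (M * M') => u uQ; rewrite normrM ler_pM ?fM ?gM.
Qed.

Lemma cube_boundedN f : cube_bounded f -> cube_bounded (fun u => - f u).
Proof.
move=> bf; have -> : (fun u => - f u) = (fun u => (-1) * f u).
  by apply/funext => u; rewrite mulN1r.
by apply: cube_boundedM => //; exact: cube_bounded_cst.
Qed.

Lemma cube_boundedB f g : cube_bounded f -> cube_bounded g ->
  cube_bounded (fun u => f u - g u).
Proof. by move=> bf bg; apply: cube_boundedD => //; exact: cube_boundedN. Qed.

Lemma cube_boundedX f m : cube_bounded f -> cube_bounded (fun u => f u ^+ m).
Proof.
move=> bf; elim: m => [|m IH].
  by under eq_fun do rewrite expr0; exact: cube_bounded_cst.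
by under eq_fun do rewrite exprS; exact: cube_boundedM.
Qed.

Lemma cube_bounded_sum (I : eqType) (s : seq I) (P : pred I) (f : I -> pt -> R) :
  (forall i, cube_bounded (f i)) -> cube_bounded (fun u => \sum_(i <- s | P i) f i u).
Proof.
move=> bf; elim: s => [|i s IH].
  by under eq_fun do rewrite big_nil; exact: cube_bounded_cst.
under eq_fun do rewrite big_cons.
by case: (P i) => //; exact: cube_boundedD.
Qed.

Lemma cube_bounded_prod (I : eqType) (s : seq I) (P : pred I) (f : I -> pt -> R) :
  (forall i, cube_bounded (f i)) -> cube_bounded (fun u => \prod_(i <- s | P i) f i u).
Proof.
move=> bf; elim: s => [|i s IH].
  by under eq_fun do rewrite big_nil; exact: cube_bounded_cst.
under eq_fun do rewrite big_cons.
by case: (P i) => //; exact: cube_boundedM.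
Qed.

Definition cube_mean (w f : pt -> R) : R := \int[tl]_(u in cube R N) (f u * w u).

Lemma eq_cube_mean w f g : (forall u, cube R N u -> f u = g u) ->
  cube_mean w f = cube_mean w g.
Proof. by move=> fg; apply: eq_Rintegral => u; rewrite inE => /fg ->. Qed.

Lemma tuple_perm_cube (s : {perm 'I_N}) u : cube R N (tuple_perm s u) <-> cube R N u.
Proof.
split=> uQ j; last by rewrite tnth_mktuple.
by have := uQ ((s^-1)%g j); rewrite tnth_mktuple permKV.
Qed.

Section Weight.
Variable w : pt -> R.
Hypotheses (mw : measurable_fun [set: pt] w)
  (intw : tl.-integrable (cube R N) (EFin \o w)).

Lemma cube_mean_integrable f : cube_bounded f ->
  tl.-integrable (cube R N) (EFin \o (fun u => f u * w u)).
Proof.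
move=> [mf [M fM]]; have mQ := @measurable_cube R N.
apply: (le_integrable (g := fun u => (`|M|%:E * (w u)%:E)%E) mQ).
- by apply/measurable_EFinP/measurable_funTS; exact: measurable_funM.
- move=> u uQ; rewrite /= lee_fin !normrM ler_wpM2r// normr_id.
  by rewrite (le_trans (fM u uQ))// ler_norm.
- exact: integrableZl.
Qed.

Lemma cube_meanD f g : cube_bounded f -> cube_bounded g ->
  cube_mean w (fun u => f u + g u) = cube_mean w f + cube_mean w g.
Proof.
move=> bf bg; rewrite /cube_mean -RintegralD//; last 3 first.
- exact: measurable_cube.
- exact: cube_mean_integrable.
- exact: cube_mean_integrable.
by apply: eq_Rintegral => u _; rewrite mulrDl.
Qed.

Lemma cube_meanZ c f : cube_bounded f ->
  cube_mean w (fun u => c * f u) = c * cube_mean w f.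
Proof.
move=> bf; rewrite /cube_mean -RintegralZl//; last 2 first.
- exact: measurable_cube.
- exact: cube_mean_integrable.
by apply: eq_Rintegral => u _; rewrite mulrA.
Qed.

Lemma cube_meanB f g : cube_bounded f -> cube_bounded g ->
  cube_mean w (fun u => f u - g u) = cube_mean w f - cube_mean w g.
Proof.
move=> bf bg; rewrite -[- cube_mean w g]mulN1r -cube_meanZ// -cube_meanD//.
  by apply: eq_cube_mean => u _; rewrite mulN1r.
by apply: cube_boundedM => //; exact: cube_bounded_cst.
Qed.

Lemma cube_mean_sum (I : eqType) (s : seq I) (P : pred I) (f : I -> pt -> R) :
  (forall i, cube_bounded (f i)) ->
  cube_mean w (fun u => \sum_(i <- s | P i) f i u) = \sum_(i <- s | P i) cube_mean w (f i).
Proof.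
move=> bf; elim: s => [|i s IH].
  rewrite big_nil -[RHS](mul0r (cube_mean w (fun=> 0))) -cube_meanZ.
    by apply: eq_cube_mean => u _; rewrite big_nil mul0r.
  exact: cube_bounded_cst.
rewrite big_cons -IH; case: ifP => Pi.
  rewrite -cube_meanD//; last exact: cube_bounded_sum.
  by apply: eq_cube_mean => u _; rewrite big_cons Pi.
by apply: eq_cube_mean => u _; rewrite big_cons Pi.
Qed.

Lemma cube_mean_perm (s : {perm 'I_N}) f :
  (forall u, w (tuple_perm s u) = w u) -> cube_bounded f ->
  cube_mean w (fun u => f (tuple_perm s u)) = cube_mean w f.
Proof.
move=> ws bf; rewrite /cube_mean /Rintegral; congr fine.
have Qs : tuple_perm s @^-1` (cube R N) = cube R N.
  by apply/seteqP; split=> u /= /tuple_perm_cube.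
have ints := cube_mean_integrable bf.
have mQ := @measurable_cube R N.
transitivity (\int[pushforward tl (tuple_perm s)]_(u in cube R N) (f u * w u)%:E)%E.
  rewrite (@integral_pushforward _ _ _ _ _ _ (measurable_tuple_perm s) tl (cube R N)
    (fun u => (f u * w u)%:E))//.
  - by rewrite Qs; apply: eq_integral => u _; rewrite /= ws.
  - by apply/measurable_EFinP; apply: measurable_funM => //; case: bf.
  - rewrite Qs; apply: (eq_integrable mQ (fun u => (f (tuple_perm s u) * w u)%:E)).
      by move=> u _; rewrite /= ws.
    apply: cube_mean_integrable; case: bf => mf [M fM]; split.
      by apply: (measurableT_comp mf); exact: measurable_tuple_perm.
    by exists M => u uQ; apply: fM; apply/tuple_perm_cube.
apply: eq_measure_integral => [|mphi A mA _]; first exact: measurable_tuple_perm.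
exact: tuple_lebesgue_perm.
Qed.

End Weight.

Lemma cvg_cube_mean (w_ f_ : nat -> pt -> R) (w f g : pt -> R) (M : R) :
  (forall k, measurable_fun [set: pt] (w_ k)) ->
  (forall k, measurable_fun [set: pt] (f_ k)) ->
  measurable_fun [set: pt] w -> measurable_fun [set: pt] f ->
  tl.-integrable (cube R N) (EFin \o g) ->
  (forall k u, cube R N u -> `|f_ k u| <= M) ->
  {ae tl, forall u, forall k, cube R N u -> `|w_ k u| <= g u} ->
  {ae tl, forall u, cube R N u -> f_ k u * w_ k u @[k --> \oo] --> f u * w u} ->
  cube_mean (w_ k) (f_ k) @[k --> \oo] --> cube_mean w f.
Proof.
move=> mw_ mf_ mw mf intg fM wg cv.
have mQ := @measurable_cube R N.
have [] := @dominated_convergence _ _ R tl _ mQ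
  (fun k u => (f_ k u * w_ k u)%:E) (fun u => (f u * w u)%:E) (fun u => (`|M|%:E * (g u)%:E)%E).
- by move=> k; apply/measurable_EFinP/measurable_funTS; exact: measurable_funM.
- by apply/measurable_EFinP/measurable_funTS; exact: measurable_funM.
- apply: filterS cv => u H uQ; apply: cvg_EFin; first exact: nearW.
  exact: (H uQ).
- exact: integrableZl.
- apply: filterS wg => u H k uQ; rewrite /= lee_fin normrM ler_pM//.
    by rewrite (le_trans (fM k u uQ))// ler_norm.
  exact: H.
move=> ifw _ H; rewrite /cube_mean /Rintegral.
apply: (@fine_cvg _ _ _ _ _ (\int[tl]_(u in cube R N) (f u * w u))).
rewrite /Rintegral fineK//.
exact: integrable_fin_num.
Qed.

End BoundedOnCube.

Lemma cube_one_integrable (R : realType) m :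
  (tuple_lebesgue R m).-integrable (cube R m) (fun=> (1 : R)%:E).
Proof.
apply/integrableP; split; first by apply/measurable_EFinP.
rewrite (eq_integral (cst 1%E)) => [|u _]; last by rewrite /= normr1.
rewrite integral_cst ?mul1e; last exact: measurable_cube.
apply: (eq_ind_r (fun z => (z < +oo)%E) _ (tuple_lebesgue_cube R m)).
by rewrite ltry.
Qed.

(** Integrate first in the variable that Fubini isolates, where the fundamental
    theorem of calculus applies.  The values at the two ends may be nonzero as long
    as they agree. *)
Lemma cube_ibp (R : realType) m (F F' : m.+1.-tuple (measurableTypeR R) -> R) :
  cube_bounded F' ->
  (forall (x : R) (t : m.-tuple (measurableTypeR R)), 0 <= x <= 1 -> cube R m t ->
    is_derive x 1 (fun y : R => F (tuple_cons (y, t))) (F' (tuple_cons (x, t)))) ->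
  (forall (x : R) (t : m.-tuple (measurableTypeR R)), 0 <= x <= 1 -> cube R m t ->
    {for x, continuous (fun y : R => F' (tuple_cons (y, t)))}) ->
  (forall t : m.-tuple (measurableTypeR R), cube R m t ->
     F (tuple_cons (0, t)) = F (tuple_cons (1, t))) ->
  \int[tuple_lebesgue R m.+1]_(u in cube R m.+1) F' u = 0.
Proof.
move=> [mF' [M FM]] dF cF F01.
have mQ := @measurable_cube R m.+1.
have mQ' := @measurable_cube R m.
pose G u := ((F' u)%:E : \bar R).
have intF : (tuple_lebesgue R m.+1).-integrable (cube R m.+1) G.
  have -> : G = EFin \o (fun u => F' u * 1).
    by apply/funext => u; rewrite /= mulr1.
  apply: cube_mean_integrable; [exact: measurable_cst| |by split => //; exists M].
  exact: cube_one_integrable.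
rewrite /Rintegral integral_mkcond.
transitivity (fine (\int[tuple_lebesgue R m]_t
   \int[@lebesgue_measure R]_x (G \_ (cube R m.+1)) (tuple_cons (x, t)))%E).
  congr fine; apply: integral_tuple_cons.
  by apply/(integrable_mkcond _ mQ).
rewrite [X in fine X](_ : _ = 0%E)//; apply: integral0_eq => t _.
have [tQ|tQ] := pselect (cube R m t); last first.
  apply: integral0_eq => x _; rewrite patchE ifF//; apply/negbTE.
  by rewrite notin_setE => /cube_cons[].
transitivity (\int[@lebesgue_measure R]_(x in `[0%R, 1%R]) (F' (tuple_cons (x, t)))%:E)%E.
  rewrite [RHS]integral_mkcond; apply: eq_integral => x _; rewrite !patchE.
  congr (if _ then _ else _); apply/idP/idP; rewrite !inE /= in_itv /=.
    by move/cube_cons => [].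
  by move=> x01; apply/cube_cons.
have E := @FTC_is_derive R 0 1 (fun y => F (tuple_cons (y, t)))
  (fun y => F' (tuple_cons (y, t))) ltr01
  (fun x x01 => dF x t x01 tQ) (fun x x01 => cF x t x01 tQ).
by apply: (etrans E); rewrite F01// subrr.
Qed.

(** * The Selberg weight and its regularisation *)

(** Relates products over ordered pairs, which are visibly invariant under
    permutations, to the products over j < k in the Selberg weight. *)
Lemma big_offdiag (R : comNzRingType) N (F : 'I_N -> 'I_N -> R) :
  \prod_(j < N) \prod_(k < N | k != j) F j k =
  (\prod_(j < N) \prod_(k < N | (j < k)%N) F j k) *
  (\prod_(j < N) \prod_(k < N | (j < k)%N) F k j).
Proof.
transitivity (\prod_(j < N) ((\prod_(k < N | (j < k)%N) F j k) * \prod_(k < N | (k < j)%N) F j k)).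
  apply: eq_bigr => j _; rewrite (bigID (fun k : 'I_N => (j < k)%N))/=.
  by congr (_ * _); apply: eq_bigl => k; rewrite -val_eqE /=; lia.
rewrite big_split /=; congr (_ * _).
by rewrite (exchange_big_dep xpredT).
Qed.

Lemma cvg_prod (R : realType) (I : eqType) (s : seq I) (P : pred I)
    (f : nat -> I -> R) (l : I -> R) :
  (forall i, P i -> f k i @[k --> \oo] --> l i) ->
  (\prod_(i <- s | P i) f k i) @[k --> \oo] --> \prod_(i <- s | P i) l i.
Proof.
move=> fl; elim: s => [|i s IH].
  by rewrite big_nil; under eq_fun do rewrite big_nil; exact: cvg_cst.
rewrite big_cons; under eq_fun do rewrite big_cons.
by case: ifP => // Pi; apply: cvgM => //; exact: fl.
Qed.

Section SelbergWeight.
Variables (R : realType) (al g : R).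
Hypotheses (al_gtN1 : -1 < al) (al_le0 : al <= 0) (g_gt0 : 0 < g).
Local Notation RT := (measurableTypeR R).

Section AnyDimension.
Variable N : nat.
Local Notation pt := (N.-tuple RT).
Local Notation tl := (tuple_lebesgue R N).
Local Notation Q := (cube R N).

Definition selberg_weight (u : pt) : R :=
  let x (j : 'I_N) : R := tnth u j in
  (\prod_(j < N) (x j `^ al * (1 - x j) `^ al)) *
  \prod_(j < N) \prod_(k < N | (j < k)%N) `|x j - x k| `^ g.

(** Summing over ordered pairs k != j makes the invariance under permutations
    evident; each unordered pair occurs twice, hence g / 4 for the exponent g / 2
    of the squared difference. *)
Definition reg_log (e : R) (u : pt) : R :=
  let x (j : 'I_N) : R := tnth u j in
  al * (\sum_(j < N) (ln (x j + e) + ln (1 - x j + e))) +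
  g / 4 * \sum_(j < N) \sum_(k < N | k != j) ln ((x j - x k) ^+ 2 + e).

Definition reg_weight (e : R) (u : pt) : R := expR (reg_log e u).

Lemma measurable_coord (j : 'I_N) : measurable_fun [set: pt] (fun u => tnth u j : R).
Proof. exact: measurable_tnth. Qed.

Lemma measurable_selberg_weight : measurable_fun [set: pt] selberg_weight.
Proof.
apply: measurable_funM.
  apply: measurable_prod => j _; apply: measurable_funM.
    by apply: (measurableT_comp (measurable_powR _)); exact: measurable_coord.
  apply: (measurableT_comp (measurable_powR _)); apply: measurable_funB => //.
  exact: measurable_coord.
apply: measurable_prod => j _.
under eq_fun do rewrite big_mkcond; apply: measurable_prod => k _.
case: (j < k)%N; last exact: measurable_cst.
apply: (measurableT_comp (measurable_powR _)).
apply: (measurableT_comp (@normr_measurable _ _)).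
by apply: measurable_funB; exact: measurable_coord.
Qed.

Lemma measurable_reg_weight e : measurable_fun [set: pt] (reg_weight e).
Proof.
apply: (measurableT_comp (@measurable_expR _)).
apply: measurable_funD; apply: measurable_funM; try exact: measurable_cst.
  apply: measurable_sum => j; apply: measurable_funD.
    apply: (measurableT_comp (@measurable_ln _)); apply: measurable_funD => //.
    exact: measurable_coord.
  apply: (measurableT_comp (@measurable_ln _)); apply: measurable_funD => //.
  by apply: measurable_funB => //; exact: measurable_coord.
apply: measurable_sum => j; under eq_fun do rewrite big_mkcond.
apply: measurable_sum => k; case: (k != j); last exact: measurable_cst.
apply: (measurableT_comp (@measurable_ln _)); apply: measurable_funD => //.
by apply: measurable_funX; apply: measurable_funB; exact: measurable_coord.
Qed.

Lemma perm_offdiag (T : Type) (idx : T) (op : Monoid.com_law idx)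
    (s : {perm 'I_N}) (F : 'I_N -> 'I_N -> T) :
  \big[op/idx]_(j < N) \big[op/idx]_(k < N | k != j) F (s j) (s k) =
  \big[op/idx]_(j < N) \big[op/idx]_(k < N | k != j) F j k.
Proof.
rewrite [RHS](reindex_inj (@perm_inj _ s)); apply: eq_bigr => j _.
rewrite [RHS](reindex_inj (@perm_inj _ s)); apply: eq_bigl => k.
by rewrite (inj_eq perm_inj).
Qed.

Lemma reg_weight_perm e s u : reg_weight e (tuple_perm s u) = reg_weight e u.
Proof.
rewrite /reg_weight; suff -> : reg_log e (tuple_perm s u) = reg_log e u by [].
rewrite /reg_log; congr (al * _ + g / 4 * _).
  rewrite [RHS](reindex_inj (@perm_inj _ s)); apply: eq_bigr => j _.
  by rewrite !tnth_mktuple.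
rewrite -[RHS](perm_offdiag _ s (fun j k => ln ((tnth u j - tnth u k : R) ^+ 2 + e))).
by apply: eq_bigr => j _; apply: eq_bigr => k _; rewrite !tnth_mktuple.
Qed.

(** The Vandermonde factor is nonnegative and its square is a product over ordered
    pairs. *)
Lemma selberg_weight_perm s u : selberg_weight (tuple_perm s u) = selberg_weight u.
Proof.
rewrite /selberg_weight; congr (_ * _).
  rewrite [RHS](reindex_inj (@perm_inj _ s)); apply: eq_bigr => j _.
  by rewrite !tnth_mktuple.
pose F (v : pt) j k := `|tnth v j - tnth v k : R| `^ g.
have FE (v : pt) : (\prod_(j < N) \prod_(k < N | (j < k)%N) F v j k) ^+ 2 =
    \prod_(j < N) \prod_(k < N | k != j) F v j k.
  rewrite big_offdiag expr2; congr (_ * _).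
  by apply: eq_bigr => j _; apply: eq_bigr => k _; rewrite /F distrC.
have F0 (v : pt) : 0 <= \prod_(j < N) \prod_(k < N | (j < k)%N) F v j k.
  by apply: prodr_ge0 => j _; apply: prodr_ge0 => k _; exact: powR_ge0.
apply/eqP; rewrite -(eqrXn2 (isT : 0 < 2)%N (F0 (tuple_perm s u)) (F0 u)); apply/eqP.
rewrite (FE u) (FE (tuple_perm s u)).
rewrite -[RHS](perm_offdiag _ s (F u)).
by apply: eq_bigr => j _; apply: eq_bigr => k _; rewrite /F !tnth_mktuple.
Qed.

Lemma reg_weight_prod e u : 0 < e -> Q u ->
  let x (j : 'I_N) : R := tnth u j in
  reg_weight e u = (\prod_(j < N) ((x j + e) `^ al * (1 - x j + e) `^ al)) *
    \prod_(j < N) \prod_(k < N | k != j) ((x j - x k) ^+ 2 + e) `^ (g / 4).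
Proof.
move=> e0 uQ x; rewrite /reg_weight /reg_log expRD !mulr_sumr !expR_sum.
congr (_ * _); apply: eq_bigr => j _.
  have /andP[x0 x1] := uQ j.
  rewrite mulrDr expRD /powR !gt_eqF//; first by rewrite ltr_wpDl// subr_ge0.
  by rewrite ltr_wpDl.
rewrite mulr_sumr expR_sum; apply: eq_bigr => k _.
by rewrite /powR gt_eqF// ltr_wpDl// sqr_ge0.
Qed.

Lemma le0_ler_powR (x y : R) : 0 < x -> x <= y -> y `^ al <= x `^ al.
Proof.
move=> x0 xy; have y0 : 0 < y := lt_le_trans x0 xy.
rewrite -[al]opprK !(powRN _ (- al)) lef_pV2 ?posrE ?powR_gt0//.
by apply: ge0_ler_powR; rewrite ?nnegrE ?oppr_ge0 ?(ltW x0) ?(ltW y0).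
Qed.

Definition pair_bound : R := \prod_(j < N) \prod_(k < N | k != j) 2 `^ (g / 4).

Lemma sqr_sub_le1 (x y : R) : 0 <= x <= 1 -> 0 <= y <= 1 -> (x - y) ^+ 2 <= 1.
Proof.
move=> /andP[x0 x1] /andP[y0 y1].
by rewrite -[leRHS](expr1n _ 2) -real_normK ?num_real// lerXn2r ?nnegrE// ler_norml; lra.
Qed.

Lemma reg_pairs_le e u : 0 < e <= 1 -> Q u ->
  \prod_(j < N) \prod_(k < N | k != j)
    ((tnth u j - tnth u k : R) ^+ 2 + e) `^ (g / 4) <= pair_bound.
Proof.
move=> /andP[e0 e1] uQ; apply: ler_prod => j _.
rewrite prodr_ge0/=; last by move=> k _; exact: powR_ge0.
apply: ler_prod => k _; rewrite powR_ge0/=.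
apply: ge0_ler_powR.
- by rewrite divr_ge0 ?(ltW g_gt0).
- by rewrite nnegrE addr_ge0 ?sqr_ge0 ?(ltW e0).
- by rewrite nnegrE.
- by have := sqr_sub_le1 (uQ j) (uQ k); lra.
Qed.

Definition interior_point (u : pt) : Prop := forall j : 'I_N, 0 < (tnth u j : R) < 1.

Lemma interior_cube u : interior_point u -> Q u.
Proof. by move=> H j; have /andP[h1 h2] := H j; rewrite !ltW. Qed.

(** Adding e only decreases the factors with nonpositive exponent, and the pair
    factors are at most 2^(g/4).  The bound does not depend on e. *)
Lemma reg_weight_le e u : 0 < e <= 1 -> interior_point u ->
  reg_weight e u <= pair_bound * \prod_(j < N) beta_density al (tnth u j).
Proof.
move=> e01 iu; have uQ := interior_cube iu; have /andP[e0 _] := e01.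
rewrite (reg_weight_prod e0 uQ) mulrC; apply: ler_pM.
- by apply: prodr_ge0 => j _; apply: prodr_ge0 => k _; exact: powR_ge0.
- by apply: prodr_ge0 => j _; rewrite mulr_ge0// powR_ge0.
- exact: reg_pairs_le.
apply: ler_prod => j _; rewrite mulr_ge0 ?powR_ge0//=.
have /andP[x0 x1] := iu j.
by apply: ler_pM; rewrite ?powR_ge0//; apply: le0_ler_powR; lra.
Qed.

Lemma selberg_weight_le u : Q u ->
  0 <= selberg_weight u <= \prod_(j < N) beta_density al (tnth u j).
Proof.
move=> uQ; have B0 : 0 <= \prod_(j < N) beta_density al (tnth u j).
  by apply: prodr_ge0 => j _; exact: beta_density_ge0.
apply/andP; split.
  rewrite /selberg_weight mulr_ge0//.
  by apply: prodr_ge0 => j _; apply: prodr_ge0 => k _; exact: powR_ge0.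
rewrite -[leRHS]mulr1 ler_wpM2l//.
apply: prodr_ile1 => j _; rewrite prodr_ge0 => [|k _]; last exact: powR_ge0.
apply: prodr_ile1 => k _; rewrite powR_ge0/=.
have : `|tnth u j - tnth u k : R| `^ g <= 1 `^ g; last by rewrite powR1.
apply: ge0_ler_powR; rewrite ?nnegrE ?(ltW g_gt0)//.
by have := sqr_sub_le1 (uQ j) (uQ k); rewrite -[X in X <= _]real_normK ?num_real// -[leRHS](expr1n _ 2) ler_pXn2r// ?nnegrE.
Qed.

Lemma selberg_weight_integrable : tl.-integrable Q (EFin \o selberg_weight).
Proof.
have intB := @integrable_cube_prod R N (beta_density al) (measurable_beta_density al)
  (beta_density_ge0 al) (beta_density_integrable al_gtN1 al_le0).
apply: (le_integrable (@measurable_cube R N) _ _ intB).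
  by apply/measurable_EFinP/measurable_funTS; exact: measurable_selberg_weight.
move=> u uQ; rewrite /= lee_fin; have /andP[w0 wB] := selberg_weight_le uQ.
by rewrite !ger0_norm// (le_trans w0).
Qed.

End AnyDimension.
End SelbergWeight.

(** * Removing the regularisation *)

(** The inverse is x (x^2)^(-1) everywhere, including at 0 where both sides are 0. *)
Lemma measurable_invr (R : realType) : measurable_fun [set: R] (fun x : R => x^-1).
Proof.
rewrite (_ : (fun x : R => x^-1) = fun x => x * (x ^+ 2) `^ (-1)).
  apply: measurable_funM => //; apply: (measurableT_comp (measurable_powR _)).
  exact: measurable_funX.
apply/funext => x; rewrite powR_inv1 ?sqr_ge0//.
have [->|x0] := eqVneq x 0; first by rewrite invr0 mul0r.
by field.
Qed.

Section RegularizedMeans.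
Variables (R : realType) (al g : R).
Hypotheses (al_gtN1 : -1 < al) (al_le0 : al <= 0) (g_gt0 : 0 < g).
Local Notation RT := (measurableTypeR R).
Variable N : nat.
Local Notation pt := (N.-tuple RT).
Local Notation tl := (tuple_lebesgue R N).
Local Notation Q := (cube R N).
Local Notation ee := (@harmonic R).
Local Notation W := (@selberg_weight R al g N).
Local Notation We e := (@reg_weight R al g N e).

(** The faces of the cube are boxes with one side of length 0. *)
Lemma ae_interior : {ae tl, forall u, Q u -> interior_point u}.
Proof.
have hyp (c : R) (j : 'I_N) : {ae tl, forall u, (tnth u j : R) != c}.
  exists [set u : pt | forall i, (if i == j then [set c] else setT) (tnth u i)]; split.
  - apply: (@measurable_box R N (fun i => if i == j then [set c] else setT)) => i.
    by case: ifP.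
  - rewrite (@tuple_lebesgue_box R N (fun i => if i == j then [set c] else setT)).
      by rewrite (bigD1 j)//= eqxx lebesgue_measure_set1 mul0e.
    by move=> i; case: ifP.
  - move=> u /= /negP; rewrite negbK => /eqP uj i; case: eqP => // ->.
    exact: uj.
have FF := ae_filter_ringOfSetsType tl.
have h0 : {ae tl, forall u, forall j : 'I_N, (tnth u j : R) != 0}.
  by apply: filter_forall => j; exact: hyp.
have h1 : {ae tl, forall u, forall j : 'I_N, (tnth u j : R) != 1}.
  by apply: filter_forall => j; exact: hyp.
have h01 : {ae tl, forall u, (forall j : 'I_N, (tnth u j : R) != 0) /\
    (forall j : 'I_N, (tnth u j : R) != 1)} by exact: (@filterI _ _ FF _ _ h0 h1).
apply: filterS h01 => u [u0 u1] uQ j; have /andP[l0 l1] := uQ j.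
by rewrite !lt_neqAle l0 l1 eq_sym (u0 j) (u1 j).
Qed.

Lemma harmonic01 k : 0 < ee k <= 1.
Proof. by rewrite /harmonic /= invr_gt0 ltr0n /= invf_le1 ?ltr0n// ler1n. Qed.

(** At x = 0 only positive exponents are allowed; this case is needed on the
    diagonals u_j = u_k. *)
Lemma cvg_powR_harmonic (a x : R) : 0 < x \/ (x = 0 /\ 0 < a) ->
  (x + ee k) `^ a @[k --> \oo] --> x `^ a.
Proof.
case=> [x0|[-> a0]].
  have cx : {for x, continuous (fun y : R => y `^ a)}.
    apply: differentiable_continuous; apply/derivable1_diffP.
    exact: (@ex_derive _ _ _ _ _ _ _ (is_derive1_powR a x0)).
  apply: (cvg_comp (fun k => x + ee k) (fun y => y `^ a)); last exact: cx.
  have H : (fun k => x + ee k) @ \oo --> x + 0.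
    by apply: cvgD; [exact: cvg_cst|exact: cvg_harmonic].
  by rewrite addr0 in H.
rewrite powR0 ?gt_eqF//; under eq_fun do rewrite add0r.
apply: (cvg_at_rightP (fun y => y `^ a) 0 0).1; first exact: powR_cvg0.
split; last exact: cvg_harmonic.
by move=> k; have /andP[] := harmonic01 k.
Qed.

Lemma cvg_reg_weight u : interior_point u ->
  We (ee k) u @[k --> \oo] --> W u.
Proof.
move=> iu; have uQ := interior_cube iu.
have -> : (fun k => We (ee k) u) = (fun k =>
   (\prod_(j < N) ((tnth u j + ee k : R) `^ al * (1 - tnth u j + ee k : R) `^ al)) *
    \prod_(j < N) \prod_(i < N | i != j) ((tnth u j - tnth u i : R) ^+ 2 + ee k) `^ (g / 4)).
  by apply/funext => k; rewrite (reg_weight_prod _ _ _ uQ)//; have /andP[] := harmonic01 k.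
have -> : W u = (\prod_(j < N) ((tnth u j : R) `^ al * (1 - tnth u j : R) `^ al)) *
    \prod_(j < N) \prod_(i < N | i != j) ((tnth u j - tnth u i : R) ^+ 2) `^ (g / 4).
  rewrite /selberg_weight; congr (_ * _); rewrite big_offdiag -big_split.
  apply: eq_bigr => j _ /=; rewrite -big_split; apply: eq_bigr => i _ /=.
  rewrite -[(tnth u i - _) ^+ 2]sqrrN opprB -expr2.
  rewrite -[(_ - _) ^+ 2]real_normK ?num_real//.
  have [->|d0] := eqVneq `|tnth u j - tnth u i : R| 0.
    by rewrite expr0n /= !powR0 ?expr0n ?mulf_eq0 ?invr_eq0 ?gt_eqF//.
  rewrite -!powR_mulrn ?powR_ge0// -!powRrM; congr (_ `^ _).
  by field.
apply: cvgM; apply: cvg_prod => j _.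
  have /andP[u0 u1] := iu j.
  by apply: cvgM; apply: cvg_powR_harmonic; left; rewrite ?subr_gt0.
apply: cvg_prod => i _; apply: cvg_powR_harmonic.
have [->|d0] := eqVneq ((tnth u j - tnth u i : R) ^+ 2) 0.
  by right; split => //; rewrite divr_gt0.
by left; rewrite lt0r d0 sqr_ge0.
Qed.

(** The factors r_k stand for ratios such as d^2 / (d^2 + e), which tend to 1 except
    where d = 0; there the Selberg weight is 0 and the limit of the product is
    still the right one. *)
Lemma cvg_reg_mean (c : pt -> R) (r : nat -> pt -> R) :
  cube_bounded c -> (forall k, measurable_fun [set: pt] (r k)) ->
  (forall k u, Q u -> 0 <= r k u <= 1) ->
  (forall u, interior_point u -> W u = 0 \/ r k u @[k --> \oo] --> (1 : R)) ->
  cube_mean (We (ee k)) (fun u => c u * r k u) @[k --> \oo] --> cube_mean W c.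
Proof.
move=> [mc [M cM]] mr r01 rl.
have intB := @integrable_cube_prod R N (beta_density al) (measurable_beta_density al)
  (beta_density_ge0 al) (beta_density_integrable al_gtN1 al_le0).
apply: (@cvg_cube_mean R N (fun k => We (ee k)) (fun k u => c u * r k u) W c
  (fun u => pair_bound g N * \prod_(j < N) beta_density al (tnth u j)) M).
- by move=> k; exact: measurable_reg_weight.
- by move=> k; apply: measurable_funM.
- exact: measurable_selberg_weight.
- by [].
- exact: (integrableZl (@measurable_cube R N) (pair_bound g N) intB).
- move=> k u uQ; have /andP[r0 r1] := r01 k u uQ.
  rewrite normrM (ger0_norm r0) -[leRHS]mulr1 ler_pM//.
  exact: cM.
- apply: filterS ae_interior => u H k uQ.
  rewrite ger0_norm ?expR_ge0//.
  by apply: reg_weight_le => //; [exact: harmonic01|exact: H].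
- apply: filterS ae_interior => u H uQ.
  have iu := H uQ; have lW := cvg_reg_weight iu.
  (* Where W vanishes, boundedness of c r_k suffices. *)
  have [W0|r1] := rl u iu.
    rewrite W0 mulr0.
    apply/norm_cvg0P/(@squeeze_cvgr _ _ _ _ (fun=> 0) (fun k => `|M| * We (ee k) u)).
    + apply: nearW => k; rewrite normr_ge0 /= !normrM.
      have /andP[r0 r1] := r01 k u uQ.
      rewrite [`|We _ _|]ger0_norm ?expR_ge0// ler_wpM2r ?expR_ge0//.
      rewrite (ger0_norm r0) -[leRHS]mulr1 ler_pM//.
      by rewrite (le_trans (cM u uQ))// ler_norm.
    + exact: cvg_cst.
    + by rewrite -(mulr0 `|M|) -W0; apply: cvgM => //; exact: cvg_cst.
  have H1 : c u * r k u @[k --> \oo] --> c u * 1 by apply: cvgM => //; exact: cvg_cst.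
  by rewrite mulr1 in H1; apply: cvgM.
Qed.

Lemma reg_weight_bounded e : 0 < e <= 1 -> cube_bounded (We e : pt -> R).
Proof.
move=> /[dup] e01 /andP[e0 e1]; split; first exact: measurable_reg_weight.
exists ((\prod_(j < N) (e `^ al * e `^ al)) * pair_bound g N) => u uQ.
rewrite ger0_norm ?expR_ge0// (reg_weight_prod _ _ e0 uQ); apply: ler_pM.
- by apply: prodr_ge0 => j _; rewrite mulr_ge0// powR_ge0.
- by apply: prodr_ge0 => j _; apply: prodr_ge0 => k _; exact: powR_ge0.
- apply: ler_prod => j _; rewrite mulr_ge0 ?powR_ge0//=.
  have /andP[x0 x1] := uQ j.
  by apply: ler_pM; rewrite ?powR_ge0//; apply: le0_ler_powR => //; lra.
- exact: reg_pairs_le.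
Qed.

Lemma cube_boundedV (f : pt -> R) (d : R) : 0 < d -> cube_bounded f ->
  (forall u, Q u -> d <= f u) -> cube_bounded (fun u => (f u)^-1).
Proof.
move=> d0 [mf _] fd; split; first exact: (measurableT_comp (@measurable_invr R)).
exists d^-1 => u uQ; have fu := fd u uQ.
have f0 : 0 < f u := lt_le_trans d0 fu.
by rewrite ger0_norm ?invr_ge0 ?(ltW f0)// lef_pV2 ?posrE.
Qed.

End RegularizedMeans.

(** * Integration by parts for the regularised weight *)

Lemma cvg_bigsum (R : realType) (T I : Type) (F : set_system T) (FF : Filter F)
    (r : seq I) (f : I -> T -> R) (l : I -> R) :
  (forall i, f i x @[x --> F] --> l i) ->
  (\sum_(i <- r) f i x) @[x --> F] --> \sum_(i <- r) l i.
Proof.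
move=> fl; elim: r => [|i r IH].
  by rewrite big_nil; under eq_fun do rewrite big_nil; exact: cvg_cst.
by rewrite big_cons; under eq_fun do rewrite big_cons; exact: cvgD.
Qed.

Lemma is_derive_weighted (R : realType) (q s x L' : R) (M : nat) (L : R -> R) :
  is_derive x 1 L L' ->
  is_derive x 1 (fun y => y * (1 - y) * q * (y + s) ^+ M * expR (L y))
    (((1 - 2 * x) * q * (x + s) ^+ M
      + x * (1 - x) * q * (M%:R * (x + s) ^+ M.-1)
      + x * (1 - x) * q * (x + s) ^+ M * L') * expR (L x)).
Proof.
move=> dL.
have dE : is_derive x 1 (expR \o L) (expR (L x) * L') by exact: is_derive1_comp.
have d1 : is_derive x 1 (fun y : R => y) 1 by exact: is_derive_id.
have d2 : is_derive x 1 (fun y : R => 1 - y) (0 - 1).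
  exact: (is_deriveB (is_derive_cst (1 : R) x 1) d1).
have d3 : is_derive x 1 (fun y : R => y + s) (1 + 0).
  exact: (is_deriveD d1 (is_derive_cst s x 1)).
have d4 : is_derive x 1 (fun y : R => (y + s) ^+ M) (M%:R * (x + s) ^+ M.-1).
  have -> : (fun y : R => (y + s) ^+ M) = (fun y : R => y + s) ^+ M.
    by apply/funext => y; rewrite exprfctE.
  apply: (is_derive_eq (is_deriveX M d3)).
  by rewrite addr0 /GRing.scale /= mulr1.
have d5 := is_deriveM d1 d2.
have d6 := is_deriveM d5 (is_derive_cst q x 1).
have d7 := is_deriveM d6 d4.
have d8 := is_deriveM d7 dE.
apply: (is_derive_eq d8); rewrite !mulrfctE /GRing.scale /= /cst; ring.
Qed.

Section Aomoto.
Variables (R : realType) (al g : R).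
Hypotheses (al_gtN1 : -1 < al) (al_le0 : al <= 0) (g_gt0 : 0 < g).
Local Notation RT := (measurableTypeR R).

Section Moments.
Variable N : nat.
Local Notation pt := (N.-tuple RT).

Definition centered_sum (u : pt) : R := \sum_(j < N) ((tnth u j : R) - 2^-1).

Definition prod_lt (p : nat) (u : pt) : R := \prod_(j < N | (j < p)%N) (tnth u j : R).

(** The product u_2 ... u_p: with zero-based indices, the factors of [prod_lt p]
    other than the first. *)
Definition prod_tail (p : nat) (u : pt) : R :=
  \prod_(j < N | (0 < j < p)%N) (tnth u j : R).

Lemma centered_sum_perm s u : centered_sum (tuple_perm s u) = centered_sum u.
Proof.
rewrite /centered_sum [RHS](reindex_inj (@perm_inj _ s)).
by apply: eq_bigr => j _; rewrite tnth_mktuple.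
Qed.

Lemma cube_bounded_centered_sum : cube_bounded centered_sum.
Proof.
apply: cube_bounded_sum => j; apply: cube_boundedB; last exact: cube_bounded_cst.
exact: cube_bounded_tnth.
Qed.

Lemma cube_bounded_prod_lt p : cube_bounded (prod_lt p).
Proof. by apply: cube_bounded_prod => j; exact: cube_bounded_tnth. Qed.

Lemma cube_bounded_prod_tail p : cube_bounded (prod_tail p).
Proof. by apply: cube_bounded_prod => j; exact: cube_bounded_tnth. Qed.

End Moments.

Section IntegrationByParts.
Variable m : nat.
Local Notation N := m.+1.
Local Notation pt := (N.-tuple RT).
Local Notation Q := (cube R N).
Local Notation W := (@selberg_weight R al g N).
Local Notation We e := (@reg_weight R al g N e).
Local Notation x0 u := (tnth u ord0 : R).

(** The logarithmic derivative of the regularised weight in the first variable. *)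
Definition drift (e : R) (u : pt) : R :=
  al * ((x0 u + e)^-1 - (1 - x0 u + e)^-1) +
  g / 2 * \sum_(j < m) (2 * (x0 u - tnth u (lift ord0 j)) /
    ((x0 u - tnth u (lift ord0 j)) ^+ 2 + e)).

Lemma reg_log_cons e (y : R) (t : m.-tuple RT) :
  reg_log al g e (tuple_cons (y, t)) =
  al * (ln (y + e) + ln (1 - y + e))
  + g / 2 * (\sum_(j < m) ln ((y - tnth t j : R) ^+ 2 + e)) + reg_log al g e t.
Proof.
rewrite /reg_log !big_ord_recl /=.
have tS (j : 'I_m) : tnth (tuple_cons (y, t)) (lift ord0 j) = tnth t j by rewrite tnthS.
have t0 : tnth (tuple_cons (y, t)) ord0 = y by [].
rewrite t0 (eq_bigr (fun j => ln ((tnth t j : R) + e) + ln (1 - (tnth t j : R) + e))); last first.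
  by move=> j _; rewrite tS.
have -> : \sum_(k < N | k != ord0) ln ((y - tnth (tuple_cons (y, t)) k) ^+ 2 + e) =
    \sum_(j < m) ln ((y - tnth t j : R) ^+ 2 + e).
  rewrite big_mkcond big_ord_recl /= add0r; apply: eq_bigr => j _.
  by rewrite tS.
have -> : \sum_(i < m) \sum_(k < N | k != lift ord0 i)
     ln ((tnth (tuple_cons (y, t)) (lift ord0 i)
          - tnth (tuple_cons (y, t)) k : R) ^+ 2 + e) =
   \sum_(i < m) (ln ((y - tnth t i : R) ^+ 2 + e) +
     \sum_(k < m | k != i) ln ((tnth t i - tnth t k : R) ^+ 2 + e)).
  apply: eq_bigr => i _; rewrite big_mkcond big_ord_recl /= t0 tS.
  rewrite -[in LHS]sqrrN opprB.
  congr (_ + _); rewrite [RHS]big_mkcond; apply: eq_bigr => j _.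
  by rewrite tS (inj_eq lift_inj).
by rewrite !big_split /=; field.
Qed.

Lemma reg_log_derive e (x : R) (t : m.-tuple RT) : 0 < e -> 0 <= x <= 1 ->
  is_derive x 1 (fun y : R => reg_log al g e (tuple_cons (y, t)))
    (drift e (tuple_cons (x, t))).
Proof.
move=> e0 /andP[x0' x1].
under eq_fun do rewrite reg_log_cons.
have d1 : is_derive x 1 (fun y : R => y) 1 by exact: is_derive_id.
have xe : 0 < x + e by rewrite ltr_wpDl.
have xe' : 0 < 1 - x + e by rewrite ltr_wpDl// subr_ge0.
have d2 : is_derive x 1 (fun y : R => ln (y + e)) ((x + e)^-1 * (1 + 0)) :=
  @is_derive1_comp _ (@ln R) (fun y => y + e) _ _ _ (is_derive1_ln xe)
    (is_deriveD d1 (is_derive_cst e x 1)).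
have d3 : is_derive x 1 (fun y : R => ln (1 - y + e)) ((1 - x + e)^-1 * (0 - 1 + 0)) :=
  @is_derive1_comp _ (@ln R) (fun y => 1 - y + e) _ _ _ (is_derive1_ln xe')
    (is_deriveD (is_deriveB (is_derive_cst (1 : R) x 1) d1) (is_derive_cst e x 1)).
have d4 (j : 'I_m) : is_derive x 1 (fun y : R => ln ((y - tnth t j : R) ^+ 2 + e))
   (((x - tnth t j : R) ^+ 2 + e)^-1 * (2 * (x - tnth t j))).
  have te : 0 < (x - tnth t j : R) ^+ 2 + e by rewrite ltr_wpDl// sqr_ge0.
  have d := is_deriveD (is_deriveX 2 (is_deriveB d1 (is_derive_cst (tnth t j : R) x 1)))
    (is_derive_cst e x 1).
  have d' := @is_derive1_comp _ (@ln R) (fun y => (y - tnth t j : R) ^+ 2 + e) _ _ _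
    (is_derive1_ln te) d.
  by apply: (is_derive_eq d'); rewrite /GRing.scale /= subr0 !addr0 mulr1.
have d5 := is_deriveZ al (is_deriveD d2 d3).
have d6 := is_deriveZ (g / 2) (is_derive_sum d4).
have d7 := is_deriveD (is_deriveD d5 d6) (is_derive_cst (reg_log al g e t) x 1).
have -> : (fun y : R => al * (ln (y + e) + ln (1 - y + e)) +
   g / 2 * (\sum_(j < m) ln ((y - tnth t j : R) ^+ 2 + e)) + reg_log al g e t) =
  (al \*: ((fun y : R => ln (y + e)) + (fun y : R => ln (1 - y + e)))
   + (g / 2) \*: (\sum_(j < m) (fun y : R => ln ((y - tnth t j : R) ^+ 2 + e)))
   + cst (reg_log al g e t)).
  by apply/funext => y; rewrite /= fct_sumE.
apply: (is_derive_eq d7); rewrite /drift /GRing.scale /= addr0.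
congr (_ * _ + _ * _); first by ring.
apply: eq_bigr => j _; rewrite tnthS; by rewrite mulrC.
Qed.

Lemma drift_continuous e (x : R) (t : m.-tuple RT) : 0 < e -> 0 <= x <= 1 ->
  {for x, continuous (fun y : R => drift e (tuple_cons (y, t)))}.
Proof.
move=> e0 /andP[x0' x1].
have xe : x + e != 0 by rewrite gt_eqF// ltr_wpDl.
have xe' : 1 - x + e != 0 by rewrite gt_eqF// ltr_wpDl// subr_ge0.
have -> : (fun y : R => drift e (tuple_cons (y, t))) = (fun y : R =>
   al * ((y + e)^-1 - (1 - y + e)^-1) + g / 2 * \sum_(j < m)
     (2 * (y - tnth t j) / ((y - tnth t j) ^+ 2 + e))).
  apply/funext => y; rewrite /drift; congr (_ + _ * _).
  by apply: eq_bigr => j _; rewrite tnthS.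
have cid : (fun y : R => y) @ x --> x by exact: cvg_id.
have c1 (f : R -> R) (l : R) : l != 0 -> f @ x --> l -> (fun y => (f y)^-1) @ x --> l^-1.
  by move=> l0 fl; exact: (cvgV l0 fl).
apply: cvgD; apply: cvgM; try exact: cvg_cst.
  apply: cvgB.
    by apply: c1 => //; apply: cvgD => //; exact: cvg_cst.
  apply: c1 => //; apply: cvgD; last exact: cvg_cst.
  by apply: cvgB => //; exact: cvg_cst.
apply: cvg_bigsum => j.
have cd : (fun y : R => y - tnth t j) @ x --> x - tnth t j.
  by apply: cvgB => //; exact: cvg_cst.
apply: cvgM; first by apply: cvgM => //; exact: cvg_cst.
apply: c1; first by rewrite gt_eqF// ltr_wpDl// sqr_ge0.
apply: cvgD; last exact: cvg_cst.
by under eq_fun do rewrite expr2; exact: cvgM.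
Qed.

Lemma cube_bounded_x0 : cube_bounded (fun u : pt => x0 u).
Proof. exact: cube_bounded_tnth. Qed.

Lemma cube_bounded_drift e : 0 < e -> cube_bounded (drift e).
Proof.
move=> e0; have bx := cube_bounded_x0.
have bc c := @cube_bounded_cst R N c.
apply: cube_boundedD; apply: cube_boundedM; try exact: bc.
  apply: cube_boundedB; apply: (cube_boundedV e0).
  - exact: cube_boundedD.
  - by move=> u uQ; have /andP[h _] := uQ ord0; rewrite lerDr.
  - by apply: cube_boundedD => //; apply: cube_boundedB.
  - by move=> u uQ; have /andP[_ h] := uQ ord0; rewrite lerDr subr_ge0.
apply: cube_bounded_sum => j.
have bd : cube_bounded (fun u : pt => x0 u - tnth u (lift ord0 j)).
  by apply: cube_boundedB => //; exact: cube_bounded_tnth.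
apply: cube_boundedM; first exact: cube_boundedM.
apply: (cube_boundedV e0); last by move=> u _; rewrite lerDr sqr_ge0.
by apply: cube_boundedD => //; exact: cube_boundedX.
Qed.

(** The derivative in the first variable of [ibp_test]. *)
Definition ibp_poly (p M : nat) (u : pt) : R :=
  (1 - 2 * x0 u) * prod_tail p u * centered_sum u ^+ M
  + x0 u * (1 - x0 u) * prod_tail p u * (M%:R * centered_sum u ^+ M.-1).

Definition ibp_test (p M : nat) (u : pt) : R :=
  x0 u * (1 - x0 u) * prod_tail p u * centered_sum u ^+ M.

Lemma cube_bounded_ibp_poly p M : cube_bounded (ibp_poly p M).
Proof.
have bx := cube_bounded_x0.
have bc c := @cube_bounded_cst R N c.
have bq := @cube_bounded_prod_tail N p.
have bT k := cube_boundedX k (@cube_bounded_centered_sum N).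
apply: cube_boundedD; last first.
  by repeat apply: cube_boundedM => //; exact: cube_boundedB.
apply: cube_boundedM => //; apply: cube_boundedM => //.
by apply: cube_boundedB => //; exact: cube_boundedM.
Qed.

Lemma cube_bounded_ibp_test p M : cube_bounded (ibp_test p M).
Proof.
have bx := cube_bounded_x0.
have bc c := @cube_bounded_cst R N c.
have bq := @cube_bounded_prod_tail N p.
have bT k := cube_boundedX k (@cube_bounded_centered_sum N).
by repeat apply: cube_boundedM => //; exact: cube_boundedB.
Qed.

(** The test function contains u_1 (1 - u_1), so it vanishes at both ends. *)
Lemma reg_ibp e p M : 0 < e <= 1 ->
  cube_mean (We e) (fun u => ibp_poly p M u + ibp_test p M u * drift e u) = 0.
Proof.
move=> /[dup] e01 /andP[e0 e1].
(* The parts of [prod_tail] and [centered_sum] that do not involve u_1. *)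
pose q (t : m.-tuple RT) := \prod_(j < m | (j.+1 < p)%N) (tnth t j : R).
pose s (t : m.-tuple RT) : R := \sum_(j < m) ((tnth t j : R) - 2^-1) - 2^-1.
have qE y t : prod_tail p (tuple_cons (y, t)) = q t.
  rewrite /prod_tail big_mkcond big_ord_recl /= mul1r /q [RHS]big_mkcond.
  by apply: eq_bigr => j _; rewrite tnthS.
have sE y t : centered_sum (tuple_cons (y, t)) = y + s t.
  rewrite /centered_sum big_ord_recl /= /s.
  under eq_bigr do rewrite tnthS.
  by rewrite (_ : tnth _ ord0 = y)//; ring.
have xE y (t : m.-tuple RT) : x0 (tuple_cons (y, t)) = y by [].
apply: (@cube_ibp R m (fun u => ibp_test p M u * We e u)
  (fun u => (ibp_poly p M u + ibp_test p M u * drift e u) * We e u)).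
- apply: cube_boundedM; last exact: reg_weight_bounded.
  apply: cube_boundedD; first exact: cube_bounded_ibp_poly.
  by apply: cube_boundedM; [exact: cube_bounded_ibp_test|exact: cube_bounded_drift].
- move=> x t x01 tQ.
  have := is_derive_weighted (q t) (s t) M (reg_log_derive t e0 x01).
  rewrite (_ : (fun y : R => _) = (fun y : R => ibp_test p M (tuple_cons (y, t)) * We e (tuple_cons (y, t)))).
    by move=> H; apply: (is_derive_eq H); rewrite /ibp_poly /ibp_test !qE !sE !xE.
  by apply/funext => y; rewrite /ibp_test !qE !sE !xE.
- move=> x t x01 tQ.
  have cid : (fun y : R => y) @ x --> x by exact: cvg_id.
  have cx1 : (fun y : R => 1 - y) @ x --> 1 - x by apply: cvgB => //; exact: cvg_cst.
  have cT k : (fun y : R => (y + s t) ^+ k) @ x --> (x + s t) ^+ k.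
    elim: k => [|k IH].
      by under eq_fun do rewrite expr0; rewrite expr0; exact: cvg_cst.
    under eq_fun do rewrite exprS; rewrite exprS; apply: cvgM => //.
    by apply: cvgD => //; exact: cvg_cst.
  have -> : (fun y : R => (ibp_poly p M (tuple_cons (y, t)) + ibp_test p M (tuple_cons (y, t))
       * drift e (tuple_cons (y, t))) * We e (tuple_cons (y, t))) =
     (fun y : R => ((1 - 2 * y) * q t * (y + s t) ^+ M
        + y * (1 - y) * q t * (M%:R * (y + s t) ^+ M.-1)
        + y * (1 - y) * q t * (y + s t) ^+ M * drift e (tuple_cons (y, t)))
       * expR (reg_log al g e (tuple_cons (y, t)))).
    by apply/funext => y; rewrite /ibp_poly /ibp_test !qE !sE !xE.
  have cL : {for x, continuous (fun y : R => reg_log al g e (tuple_cons (y, t)))}.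
    apply: differentiable_continuous; apply/derivable1_diffP.
    exact: (@ex_derive _ _ _ _ _ _ _ (reg_log_derive t e0 x01)).
  apply: cvgM; last first.
    by apply: (cvg_comp _ expR cL); exact: continuous_expR.
  have cy : (fun y : R => y * (1 - y) * q t) @ x --> x * (1 - x) * q t.
    by apply: cvgM; [exact: cvgM|exact: cvg_cst].
  apply: cvgD; first apply: cvgD.
  + apply: cvgM => //; apply: cvgM; last exact: cvg_cst.
    by apply: cvgB; [exact: cvg_cst|apply: cvgM => //; exact: cvg_cst].
  + by apply: cvgM => //; apply: cvgM => //; exact: cvg_cst.
  + by apply: cvgM; [exact: cvgM|exact: drift_continuous].
- by move=> t _; rewrite /ibp_test !xE subrr; rewrite !(mul0r, mulr0).
Qed.

End IntegrationByParts.
End Aomoto.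

(** * Symmetrisation and the Aomoto identity *)

Section PermutedProducts.
Variables (R : realType) (m : nat).
Local Notation RT := (measurableTypeR R).
Local Notation N := m.+1.
Local Notation pt := (N.-tuple RT).
Local Notation x0 u := (tnth u ord0 : R).
Local Notation T := (@centered_sum R N).

Lemma prod_lt_tperm p (i j : 'I_N) (u : pt) :
  prod_lt p (tuple_perm (tperm i j) u) =
  \prod_(k < N | (tperm i j k < p)%N) (tnth u k : R).
Proof.
rewrite /prod_lt [RHS](reindex_inj (@perm_inj _ (tperm i j))).
by apply: eq_big => [k|k _]; rewrite ?tpermK ?tnth_mktuple.
Qed.

Lemma prod_ltE p (u : pt) : (0 < p)%N -> prod_lt p u = x0 u * prod_tail p u.
Proof.
move=> p0; rewrite /prod_lt /prod_tail (bigD1 ord0)//=; congr (_ * _).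
by apply: eq_bigl => k; rewrite -val_eqE /=; lia.
Qed.

Lemma prod_lt_tperm0_lt p (i : 'I_N) (u : pt) : (i < p)%N ->
  prod_lt p (tuple_perm (tperm ord0 i) u) = prod_lt p u.
Proof.
move=> ip; rewrite prod_lt_tperm; apply: eq_bigl => k.
by case: tpermP => [->|->|//]; rewrite ip (leq_ltn_trans _ ip).
Qed.

(** The transposition replaces u_1 by u_i in the product u_1 ... u_p. *)
Lemma prod_lt_tperm0_ge p (i : 'I_N) (u : pt) : (0 < p)%N -> (p <= i)%N ->
  prod_lt p (tuple_perm (tperm ord0 i) u) = prod_tail p u * tnth u i.
Proof.
move=> p0 ip; rewrite prod_lt_tperm (bigD1 i) /=; last by rewrite tpermR.
rewrite mulrC; congr (_ * _); apply: eq_bigl => k.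
case: tpermP => [->|->|].
- by rewrite ltnNge ip.
- by rewrite eqxx andbF; lia.
- by move=> /eqP k0 /eqP ki; rewrite ki andbT -lt0n in k0 *; rewrite k0.
Qed.

Lemma prod_lt_tperm_succ p (j : 'I_N) (pN : (p < N)%N) (u : pt) : (p <= j)%N ->
  prod_lt p.+1 (tuple_perm (tperm (Ordinal pN) j) u) = tnth u j * prod_lt p u.
Proof.
move=> pj; rewrite prod_lt_tperm (bigD1 j) /=; last by rewrite tpermR /=.
congr (_ * _); apply: eq_bigl => k.
case: tpermP => [->|->|] /=.
- rewrite ltnn; apply/negbTE; rewrite negb_and negbK ltnS -val_eqE /=; lia.
- by rewrite eqxx andbF; lia.
- move=> /eqP kp /eqP kj; rewrite kj andbT; move: kp; rewrite -val_eqE /=; lia.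
Qed.

Lemma prod_lt_tperm_pred p (pN : (p < N)%N) (u : pt) :
  prod_lt p (tuple_perm (tperm ord0 (Ordinal pN)) u) = prod_tail p.+1 u.
Proof.
rewrite prod_lt_tperm; apply: eq_bigl => k.
case: tpermP => [->|->|] /=.
- by rewrite !ltnn.
- by rewrite ltnSn andbT.
- by move=> /eqP k0 /eqP; rewrite -!val_eqE /= in k0 *; lia.
Qed.

(** The quotient by u_1 - u_j of the difference between u_1 (1 - u_1) u_2 ... u_p and
    its image under the exchange of u_1 and u_j; both cases are polynomials. *)
Definition swap_diff (p : nat) (j : 'I_N) (u : pt) : R :=
  if (j < p)%N then - prod_lt p u
  else prod_tail p u * (1 - x0 u - tnth u j).

Lemma cube_bounded_swap_diff p j : cube_bounded (swap_diff p j).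
Proof.
rewrite /swap_diff; case: ltnP => _.
  by apply: cube_boundedN; exact: cube_bounded_prod_lt.
apply: cube_boundedM; first exact: cube_bounded_prod_tail.
apply: cube_boundedB; last exact: cube_bounded_tnth.
by apply: cube_boundedB; [exact: cube_bounded_cst|exact: cube_bounded_x0].
Qed.

Lemma ibp_test_swap p M (j : 'I_N) (u : pt) : (0 < p)%N -> j != ord0 ->
  ibp_test p M u - ibp_test p M (tuple_perm (tperm ord0 j) u) =
  (x0 u - tnth u j) * (swap_diff p j u * T u ^+ M).
Proof.
move=> p0 j0; rewrite /ibp_test centered_sum_perm !tnth_mktuple tpermL.
rewrite /swap_diff; set v := tuple_perm _ _.
have v0 : x0 v = tnth u j by rewrite tnth_mktuple tpermL.
have [jp|pj] := ltnP j p.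
  have E : tnth u j * prod_tail p v = x0 u * prod_tail p u.
    by rewrite -v0 -!prod_ltE// prod_lt_tperm0_lt.
  rewrite prod_ltE//.
  have -> : tnth u j * (1 - tnth u j) * prod_tail p v = (1 - tnth u j) * (tnth u j * prod_tail p v) :> R by ring.
  by rewrite E; ring.
have -> : prod_tail p v = prod_tail p u.
  rewrite /prod_tail; apply: eq_bigr => k /andP[k0 kp].
  rewrite tnth_mktuple tpermD//; first by rewrite -val_eqE /=; lia.
  by rewrite -val_eqE /=; lia.
by ring.
Qed.

End PermutedProducts.

Section AomotoRecursion.
Variables (R : realType) (al g : R).
Hypotheses (al_gtN1 : -1 < al) (al_le0 : al <= 0) (g_gt0 : 0 < g).
Local Notation RT := (measurableTypeR R).
Variable m : nat.
Local Notation N := m.+1.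
Local Notation pt := (N.-tuple RT).
Local Notation Q := (cube R N).
Local Notation W := (@selberg_weight R al g N).
Local Notation We e := (@reg_weight R al g N e).
Local Notation x0 u := (tnth u ord0 : R).
Local Notation T := (@centered_sum R N).
Local Notation ee := (@harmonic R).

Let bT M := cube_boundedX M (@cube_bounded_centered_sum R N).

Lemma reg_weight_integrable e : 0 < e <= 1 ->
  (tuple_lebesgue R N).-integrable Q (EFin \o We e).
Proof.
move=> e01; have mWe := @measurable_reg_weight R al g N e.
have [_ [K WK]] := @reg_weight_bounded R al g al_le0 g_gt0 N e e01.
apply: (le_integrable (@measurable_cube R N) (g := fun u => (`|K|%:E * (1:R)%:E)%E)).
- by apply/measurable_EFinP/measurable_funTS.
- move=> u uQ; rewrite /= lee_fin mulr1 normr_id.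
  by rewrite (le_trans (WK u uQ))// ler_norm.
- exact: (integrableZl (@measurable_cube R N) `|K| (@cube_one_integrable R N)).
Qed.

(** Averaging with the image under the exchange of the two variables replaces the
    singular kernel d / (d^2 + e) by d^2 / (d^2 + e), which lies in [0, 1]. *)
Lemma reg_mean_swap e p M (j : 'I_N) : 0 < e <= 1 -> (0 < p)%N -> j != ord0 ->
  cube_mean (We e) (fun u => ibp_test p M u *
     (2 * (x0 u - tnth u j) / ((x0 u - tnth u j) ^+ 2 + e))) =
  cube_mean (We e) (fun u => (swap_diff p j u * T u ^+ M) *
     ((x0 u - tnth u j) ^+ 2 / ((x0 u - tnth u j) ^+ 2 + e))).
Proof.
move=> e01 p0 j0; have /andP[e0 e1] := e01.
have mWe := @measurable_reg_weight R al g N e.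
have iWe := reg_weight_integrable e01.
pose d (u : pt) : R := x0 u - tnth u j.
have bd : cube_bounded d by apply: cube_boundedB; exact: cube_bounded_tnth.
have bV : cube_bounded (fun u => ((d u) ^+ 2 + e)^-1).
  apply: (cube_boundedV e0); last by move=> u _; rewrite lerDr sqr_ge0.
  by apply: cube_boundedD; [exact: cube_boundedX|exact: cube_bounded_cst].
pose h u := ibp_test p M u * (d u / ((d u) ^+ 2 + e)).
have bh : cube_bounded h.
  apply: cube_boundedM; first exact: cube_bounded_ibp_test.
  exact: cube_boundedM.
pose s := tperm ord0 j.
have hs : cube_mean (We e) (fun u => h (tuple_perm s u)) = cube_mean (We e) h.
  by apply: cube_mean_perm => // u; exact: reg_weight_perm.
have bhs : cube_bounded (fun u => h (tuple_perm s u)).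
  case: bh => mh [K hK]; split.
    by apply: (measurableT_comp mh); exact: measurable_tuple_perm.
  by exists K => u uQ; apply: hK; apply/tuple_perm_cube.
transitivity (cube_mean (We e) h + cube_mean (We e) (fun u => h (tuple_perm s u))).
  rewrite hs; transitivity (2 * cube_mean (We e) h); last by ring.
  rewrite -(cube_meanZ mWe iWe 2 bh).
  by apply: eq_cube_mean => u _; rewrite /h /d; ring.
rewrite -(cube_meanD mWe iWe bh bhs); apply: eq_cube_mean => u _.
have ds : d (tuple_perm s u) = - d u.
  by rewrite /d !tnth_mktuple tpermL tpermR opprB.
rewrite /h ds sqrrN.
transitivity ((ibp_test p M u - ibp_test p M (tuple_perm s u)) * (d u / (d u ^+ 2 + e))).
  by ring.
by rewrite ibp_test_swap// -/(d u); ring.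
Qed.

(** [reg_ibp] after symmetrisation: every term is a bounded function, not depending
    on e, times a ratio with values in [0, 1]. *)
Lemma reg_aomoto e p M : 0 < e <= 1 -> (0 < p)%N ->
  cube_mean (We e) (fun u => ibp_poly p M u * 1) +
  al * (cube_mean (We e) (fun u => ((1 - x0 u) * prod_tail p u * T u ^+ M) *
          (x0 u / (x0 u + e)))
        - cube_mean (We e) (fun u => (x0 u * prod_tail p u * T u ^+ M) *
          ((1 - x0 u) / (1 - x0 u + e))))
  + g / 2 * \sum_(j < m) cube_mean (We e) (fun u =>
      (swap_diff p (lift ord0 j) u * T u ^+ M) *
      ((x0 u - tnth u (lift ord0 j)) ^+ 2 / ((x0 u - tnth u (lift ord0 j)) ^+ 2 + e))) = 0.
Proof.
move=> e01 p0; have /andP[e0 e1] := e01.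
have mWe := @measurable_reg_weight R al g N e.
have iWe := reg_weight_integrable e01.
have bx := @cube_bounded_x0 R m.
have bc c := @cube_bounded_cst R N c.
have bq := @cube_bounded_prod_tail R N p.
have b1x : cube_bounded (fun u : pt => 1 - x0 u) by exact: cube_boundedB.
have bV1 : cube_bounded (fun u : pt => (x0 u + e)^-1).
  apply: (cube_boundedV e0); first exact: cube_boundedD.
  by move=> u uQ; have /andP[h _] := uQ ord0; rewrite lerDr.
have bV2 : cube_bounded (fun u : pt => (1 - x0 u + e)^-1).
  apply: (cube_boundedV e0); first exact: cube_boundedD.
  by move=> u uQ; have /andP[_ h] := uQ ord0; rewrite lerDr subr_ge0.
have bVd (j : 'I_m) : cube_bounded (fun u : pt =>
    ((x0 u - tnth u (lift ord0 j)) ^+ 2 + e)^-1).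
  apply: (cube_boundedV e0); last by move=> u _; rewrite lerDr sqr_ge0.
  apply: cube_boundedD => //; apply: cube_boundedX; apply: cube_boundedB => //.
  exact: cube_bounded_tnth.
have bp := @cube_bounded_ibp_poly R m p M.
have bt := @cube_bounded_ibp_test R m p M.
have bS (j : 'I_m) : cube_bounded (fun u : pt => ibp_test p M u *
     (2 * (x0 u - tnth u (lift ord0 j)) / ((x0 u - tnth u (lift ord0 j)) ^+ 2 + e))).
  apply: cube_boundedM => //; apply: cube_boundedM => //; apply: cube_boundedM => //.
  by apply: cube_boundedB => //; exact: cube_bounded_tnth.
have bA : cube_bounded (fun u : pt => ((1 - x0 u) * prod_tail p u * T u ^+ M) *
          (x0 u / (x0 u + e))).
  by repeat apply: cube_boundedM => //.
have bB : cube_bounded (fun u : pt => (x0 u * prod_tail p u * T u ^+ M) *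
          ((1 - x0 u) / (1 - x0 u + e))).
  by repeat apply: cube_boundedM => //.
rewrite -[RHS](@reg_ibp R al g al_le0 g_gt0 m e p M e01).
transitivity (cube_mean (We e) (fun u => ibp_poly p M u +
    (al * (((1 - x0 u) * prod_tail p u * T u ^+ M) * (x0 u / (x0 u + e))
      - (x0 u * prod_tail p u * T u ^+ M) * ((1 - x0 u) / (1 - x0 u + e)))
     + g / 2 * \sum_(j < m) ibp_test p M u *
     (2 * (x0 u - tnth u (lift ord0 j)) / ((x0 u - tnth u (lift ord0 j)) ^+ 2 + e))))).
  have bAB := cube_boundedB bA bB.
  have bSS := @cube_bounded_sum R N _ (index_enum 'I_m) xpredT _ bS.
  have bC := cube_boundedM (bc al) bAB.
  have bD := cube_boundedM (bc (g / 2)) bSS.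
  rewrite (cube_meanD mWe iWe bp (cube_boundedD bC bD)) (cube_meanD mWe iWe bC bD).
  rewrite (cube_meanZ mWe iWe _ bAB) (cube_meanB mWe iWe bA bB).
  rewrite (cube_meanZ mWe iWe _ bSS) (cube_mean_sum mWe iWe _ _ bS).
  rewrite -addrA; congr (_ + (_ + _ * _)).
    by apply: eq_cube_mean => u _; rewrite mulr1.
  by apply: eq_bigr => j _; rewrite -reg_mean_swap.
apply: eq_cube_mean => u uQ; congr (_ + _); rewrite /drift [RHS]mulrDr.
have /andP[h0 h1] := uQ ord0.
have n1 : x0 u + e != 0 by rewrite gt_eqF// ltr_wpDl.
have n2 : 1 - x0 u + e != 0 by rewrite gt_eqF// ltr_wpDl// subr_ge0.
congr (_ + _); last by rewrite mulrCA -mulr_sumr.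
rewrite /ibp_test; ring.
Qed.

Lemma ratio01 (x e : R) : 0 <= x -> 0 < e -> 0 <= x / (x + e) <= 1.
Proof.
move=> x0 e0; have xe : 0 < x + e by rewrite ltr_wpDl.
by rewrite divr_ge0 ?(ltW xe)//= ler_pdivrMr// mul1r lerDl ltW.
Qed.

Lemma cvg_ratio (x : R) : 0 < x -> x / (x + ee k) @[k --> \oo] --> (1 : R).
Proof.
move=> x0; have H : (fun k => x + ee k) @ \oo --> x + 0.
  by apply: cvgD; [exact: cvg_cst|exact: cvg_harmonic].
rewrite addr0 in H; rewrite -[X in _ --> X](divff (lt0r_neq0 x0)).
by apply: cvgM; [exact: cvg_cst|apply: cvgV => //; exact: lt0r_neq0].
Qed.

Lemma measurable_ratio (f : pt -> R) e : measurable_fun [set: pt] f ->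
  measurable_fun [set: pt] (fun u => f u / (f u + e)).
Proof.
move=> mf; apply: measurable_funM => //.
by apply: (measurableT_comp (@measurable_invr R)); exact: measurable_funD.
Qed.

Lemma selberg_weight_coincide (i j : 'I_N) (u : pt) : i != j ->
  tnth u i = tnth u j -> W u = 0.
Proof.
move=> ij uij; rewrite /selberg_weight.
wlog ltij : i j ij uij / (i < j)%N.
  move=> H; have [|ji|E] := ltngtP i j; first exact: H.
  - by apply: (H j i) => //; rewrite eq_sym.
  - by move: ij; rewrite -val_eqE /= E eqxx.
rewrite [X in _ * X](bigD1 i)//= [X in _ * (X * _)](bigD1 j)//= uij subrr normr0 powR0 ?gt_eqF//.
by rewrite !(mul0r, mulr0).
Qed.

(** The limit of [reg_aomoto] as e tends to 0. *)
Lemma selberg_aomoto p M : (0 < p)%N ->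
  cube_mean W (ibp_poly p M) +
  al * (cube_mean W (fun u => (1 - x0 u) * prod_tail p u * T u ^+ M)
        - cube_mean W (fun u => x0 u * prod_tail p u * T u ^+ M))
  + g / 2 * \sum_(j < m) cube_mean W (fun u =>
      swap_diff p (lift ord0 j) u * T u ^+ M) = 0.
Proof.
move=> p0.
have bx := @cube_bounded_x0 R m.
have bc c := @cube_bounded_cst R N c.
have bq := @cube_bounded_prod_tail R N p.
have b1x : cube_bounded (fun u : pt => 1 - x0 u) by exact: cube_boundedB.
have cvr := @cvg_reg_mean R al g al_gtN1 al_le0 g_gt0 N.
have L1 : cube_mean (We (ee k)) (fun u => ibp_poly p M u * 1) @[k --> \oo] -->
    cube_mean W (ibp_poly p M).
  apply: (cvr _ (fun _ _ => 1)) => //; first exact: cube_bounded_ibp_poly.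
  by move=> k u _; rewrite ler01 lexx.
  by move=> u _; right; exact: cvg_cst.
have L2 : cube_mean (We (ee k)) (fun u => ((1 - x0 u) * prod_tail p u * T u ^+ M) *
     (x0 u / (x0 u + ee k))) @[k --> \oo] -->
     cube_mean W (fun u => (1 - x0 u) * prod_tail p u * T u ^+ M).
  apply: (cvr _ (fun k u => x0 u / (x0 u + ee k))).
  - by repeat apply: cube_boundedM => //.
  - by move=> k; apply: measurable_ratio; exact: measurable_coord.
  - move=> k u uQ; apply: ratio01; first by have /andP[] := uQ ord0.
    by have /andP[] := @harmonic01 R k.
  - by move=> u iu; right; apply: cvg_ratio; have /andP[] := iu ord0.
have L3 : cube_mean (We (ee k)) (fun u => (x0 u * prod_tail p u * T u ^+ M) *
     ((1 - x0 u) / (1 - x0 u + ee k))) @[k --> \oo] -->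
     cube_mean W (fun u => x0 u * prod_tail p u * T u ^+ M).
  apply: (cvr _ (fun k u => (1 - x0 u) / (1 - x0 u + ee k))).
  - by repeat apply: cube_boundedM => //.
  - move=> k; apply: measurable_ratio; apply: measurable_funB => //.
    exact: measurable_coord.
  - move=> k u uQ; apply: ratio01; first by have /andP[] := uQ ord0; rewrite subr_ge0.
    by have /andP[] := @harmonic01 R k.
  - by move=> u iu; right; apply: cvg_ratio; have /andP[] := iu ord0; rewrite subr_gt0.
have L4 (j : 'I_m) : cube_mean (We (ee k)) (fun u =>
      (swap_diff p (lift ord0 j) u * T u ^+ M) *
      ((x0 u - tnth u (lift ord0 j)) ^+ 2 / ((x0 u - tnth u (lift ord0 j)) ^+ 2 + ee k)))
      @[k --> \oo] --> cube_mean W (fun u => swap_diff p (lift ord0 j) u * T u ^+ M).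
  apply: (cvr _ (fun k u => (x0 u - tnth u (lift ord0 j)) ^+ 2 /
     ((x0 u - tnth u (lift ord0 j)) ^+ 2 + ee k))).
  - by apply: cube_boundedM => //; exact: cube_bounded_swap_diff.
  - move=> k; apply: measurable_ratio; apply: measurable_funX.
    by apply: measurable_funB; exact: measurable_coord.
  - move=> k u uQ; apply: ratio01; first exact: sqr_ge0.
    by have /andP[] := @harmonic01 R k.
  - move=> u iu; have [E|d0] := eqVneq (x0 u) (tnth u (lift ord0 j)).
      by left; apply: (@selberg_weight_coincide ord0 (lift ord0 j)).
    by right; apply: cvg_ratio; rewrite lt0r sqrf_eq0 subr_eq0 d0 sqr_ge0.
set E := (X in X = 0).
have L0 : (fun k : nat => (0 : R)) @ \oo --> E.
  have <- : (fun k => cube_mean (We (ee k)) (fun u => ibp_poly p M u * 1) +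
    al * (cube_mean (We (ee k)) (fun u => ((1 - x0 u) * prod_tail p u * T u ^+ M) *
            (x0 u / (x0 u + ee k)))
          - cube_mean (We (ee k)) (fun u => (x0 u * prod_tail p u * T u ^+ M) *
            ((1 - x0 u) / (1 - x0 u + ee k))))
    + g / 2 * \sum_(j < m) cube_mean (We (ee k)) (fun u =>
        (swap_diff p (lift ord0 j) u * T u ^+ M) *
        ((x0 u - tnth u (lift ord0 j)) ^+ 2 /
          ((x0 u - tnth u (lift ord0 j)) ^+ 2 + ee k)))) = (fun=> 0).
    by apply/funext => k; exact: (reg_aomoto M (harmonic01 R k) p0).
  apply: cvgD; first apply: cvgD => //.
    by apply: cvgM; [exact: cvg_cst|exact: cvgB].
  by apply: cvgM; [exact: cvg_cst|exact: cvg_bigsum].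
by rewrite -(cvg_lim (@Rhausdorff R) L0) lim_cst.
Qed.

End AomotoRecursion.

(** * Recursion for the Selberg moments *)

Section MomentRecursion.
Variables (R : realType) (al g : R).
Hypotheses (al_gtN1 : -1 < al) (al_le0 : al <= 0) (g_gt0 : 0 < g).
Local Notation RT := (measurableTypeR R).

Definition selberg_moment (N M p : nat) : R :=
  cube_mean (@selberg_weight R al g N)
    (fun u => prod_lt p u * centered_sum u ^+ M).

Section FixedDimension.
Variable m : nat.
Local Notation N := m.+1.
Local Notation pt := (N.-tuple RT).
Local Notation W := (@selberg_weight R al g N).
Local Notation x0 u := (tnth u ord0 : R).
Local Notation T := (@centered_sum R N).
Local Notation K := (selberg_moment N).

Let mW : measurable_fun [set: pt] W.
Proof. exact: measurable_selberg_weight. Qed.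

Let iW : (tuple_lebesgue R N).-integrable (cube R N) (EFin \o W).
Proof. exact: selberg_weight_integrable. Qed.

Let bT M := cube_boundedX M (@cube_bounded_centered_sum R N).
Let bx := @cube_bounded_tnth R N.
Let bq := @cube_bounded_prod_tail R N.
Let be := @cube_bounded_prod_lt R N.

Lemma selberg_mean_swap (i j : 'I_N) (f : pt -> R) : cube_bounded f ->
  cube_mean W (fun u => f (tuple_perm (tperm i j) u)) = cube_mean W f.
Proof. by move=> bf; apply: cube_mean_perm => // u; exact: selberg_weight_perm. Qed.

Lemma mean_tail_coord M p (j : 'I_N) : (0 < p <= j)%N ->
  cube_mean W (fun u => prod_tail p u * tnth u j * T u ^+ M) = K M p.
Proof.
move=> /andP[p0 pj]; rewrite /selberg_moment -[RHS](selberg_mean_swap ord0 j); last first.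
  exact: cube_boundedM.
by apply: eq_cube_mean => u _; rewrite prod_lt_tperm0_ge// centered_sum_perm.
Qed.

Lemma mean_tail_x0 M p : (0 < p)%N ->
  cube_mean W (fun u => x0 u * prod_tail p u * T u ^+ M) = K M p.
Proof. by move=> p0; apply: eq_cube_mean => u _; rewrite prod_ltE. Qed.

(** A transposition moves the variables u_2, ..., u_p to u_1, ..., u_(p-1). *)
Lemma mean_tail M p : (0 < p <= N)%N ->
  cube_mean W (fun u => prod_tail p u * T u ^+ M) = K M p.-1.
Proof.
case: p => // p /andP[_ pN]; rewrite /= /selberg_moment.
rewrite -[RHS](selberg_mean_swap ord0 (Ordinal pN)); last exact: cube_boundedM.
by apply: eq_cube_mean => u _; rewrite prod_lt_tperm_pred centered_sum_perm.
Qed.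

Lemma mean_coord_ge M p (j : 'I_N) : (p <= j)%N ->
  cube_mean W (fun u => tnth u j * prod_lt p u * T u ^+ M) = K M p.+1.
Proof.
move=> pj; have pN := leq_ltn_trans pj (ltn_ord j).
rewrite /selberg_moment -[RHS](selberg_mean_swap (Ordinal pN) j); last exact: cube_boundedM.
by apply: eq_cube_mean => u _; rewrite prod_lt_tperm_succ// centered_sum_perm.
Qed.

Lemma mean_coord_lt M p (j : 'I_N) : (j < p)%N ->
  cube_mean W (fun u => tnth u j * prod_lt p u * T u ^+ M) =
  cube_mean W (fun u => x0 u * prod_lt p u * T u ^+ M).
Proof.
move=> jp; rewrite -[RHS](selberg_mean_swap ord0 j); last first.
  by apply: cube_boundedM => //; exact: cube_boundedM.
apply: eq_cube_mean => u _.
by rewrite prod_lt_tperm0_lt// centered_sum_perm tnth_mktuple tpermL.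
Qed.

Lemma sum_ord_if (A B : R) n k : (k <= n)%N ->
  \sum_(j < n) (if (j < k)%N then A else B) = k%:R * A + (n%:R - k%:R) * B.
Proof.
move=> kn; rewrite -(big_mkord xpredT (fun j => if (j < k)%N then A else B)).
rewrite (big_cat_nat (n := k))//= (eq_big_nat _ _ (F2 := fun=> A)); last first.
  by move=> i /andP[_ ->].
rewrite [X in _ + X](eq_big_nat _ _ (F2 := fun=> B)); last first.
  by move=> i /andP[ki _]; rewrite ltnNge ki.
by rewrite !sumr_const_nat subn0 -natrB// !mulr_natl.
Qed.

(** Expand one factor T = sum_j u_j - N/2; by symmetry the summands depend only on
    whether u_j already occurs in u_1 ... u_p. *)
Lemma moment_succ M p : (p <= N)%N ->
  K M.+1 p = p%:R * cube_mean W (fun u => x0 u * prod_lt p u * T u ^+ M)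
    + (N%:R - p%:R) * K M p.+1 - N%:R / 2 * K M p.
Proof.
move=> pN; rewrite -(sum_ord_if _ _ pN).
rewrite (eq_bigr (fun j : 'I_N => cube_mean W (fun u => tnth u j * prod_lt p u * T u ^+ M))); last first.
  move=> j _; case: ltnP => jp; first by rewrite mean_coord_lt.
  by rewrite mean_coord_ge.
have bS (j : 'I_N) : cube_bounded (fun u : pt => tnth u j * prod_lt p u * T u ^+ M).
  by apply: cube_boundedM => //; exact: cube_boundedM.
have bP := cube_boundedM (be p) (bT M).
rewrite -(cube_mean_sum mW iW _ _ bS) -(cube_meanZ mW iW _ bP).
rewrite -(cube_meanB mW iW); last 2 first.
- exact: cube_bounded_sum.
- by apply: cube_boundedM => //; exact: cube_bounded_cst.
apply: eq_cube_mean => u _; rewrite exprS.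
have -> : \sum_(j < N) tnth u j * prod_lt p u * T u ^+ M =
  (\sum_(j < N) (tnth u j : R)) * (prod_lt p u * T u ^+ M).
  by rewrite mulr_suml; apply: eq_bigr => j _; rewrite mulrA.
have -> : \sum_(j < N) (tnth u j : R) = T u + N%:R / 2.
  by rewrite /centered_sum sumrB sumr_const card_ord -mulr_natl; ring.
ring.
Qed.

Lemma mean_swap_diff M p (j : 'I_m) : (0 < p <= N)%N ->
  cube_mean W (fun u => swap_diff p (lift ord0 j) u * T u ^+ M) =
  if (j < p.-1)%N then - K M p else K M p.-1 - 2 * K M p.
Proof.
move=> /andP[p0 pN].
have -> : (j < p.-1)%N = (lift ord0 j < p)%N by rewrite /= /bump /=; lia.
rewrite /swap_diff; case: ltnP => jp.
  rewrite -[RHS]mulN1r -(cube_meanZ mW iW); last exact: cube_boundedM.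
  by apply: eq_cube_mean => u _; rewrite mulN1r mulNr.
have b1 := cube_boundedM (bq p) (bT M).
have b2 : cube_bounded (fun u : pt => x0 u * prod_tail p u * T u ^+ M).
  by apply: cube_boundedM => //; exact: cube_boundedM.
have b3 : cube_bounded (fun u : pt => prod_tail p u * tnth u (lift ord0 j) * T u ^+ M).
  by apply: cube_boundedM => //; exact: cube_boundedM.
transitivity (cube_mean W (fun u => prod_tail p u * T u ^+ M
   - x0 u * prod_tail p u * T u ^+ M - prod_tail p u * tnth u (lift ord0 j) * T u ^+ M)).
  by apply: eq_cube_mean => u _; ring.
rewrite (cube_meanB mW iW (cube_boundedB b1 b2) b3) (cube_meanB mW iW b1 b2).
rewrite mean_tail ?p0// mean_tail_x0// mean_tail_coord ?p0//.
ring.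
Qed.

Lemma mean_ibp_poly M p : (0 < p <= N)%N ->
  cube_mean W (ibp_poly p M) = K M p.-1 - 2 * K M p
   + M%:R * (K M.-1 p - cube_mean W (fun u => x0 u * prod_lt p u * T u ^+ M.-1)).
Proof.
move=> /andP[p0 pN].
have b1 := cube_boundedM (bq p) (bT M).
have b2 : cube_bounded (fun u : pt => x0 u * prod_tail p u * T u ^+ M).
  by apply: cube_boundedM => //; exact: cube_boundedM.
have b3 : cube_bounded (fun u : pt => x0 u * prod_tail p u * T u ^+ M.-1).
  by apply: cube_boundedM => //; exact: cube_boundedM.
have b4 : cube_bounded (fun u : pt => x0 u * prod_lt p u * T u ^+ M.-1).
  by apply: cube_boundedM => //; exact: cube_boundedM.
have bc c := @cube_bounded_cst R N c.
have b2' := cube_boundedM (bc 2) b2.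
have b34 := cube_boundedB b3 b4.
transitivity (cube_mean W (fun u => (prod_tail p u * T u ^+ M
   - 2 * (x0 u * prod_tail p u * T u ^+ M))
   + M%:R * (x0 u * prod_tail p u * T u ^+ M.-1 - x0 u * prod_lt p u * T u ^+ M.-1))).
  by apply: eq_cube_mean => u _; rewrite /ibp_poly (prod_ltE _ p0); ring.
rewrite (cube_meanD mW iW (cube_boundedB b1 b2') (cube_boundedM (bc M%:R) b34)).
rewrite (cube_meanB mW iW b1 b2') (cube_meanZ mW iW 2 b2).
rewrite (cube_meanZ mW iW M%:R b34) (cube_meanB mW iW b3 b4).
by rewrite mean_tail ?p0// !mean_tail_x0.
Qed.

(** [selberg_aomoto] contains the mean of u_1^2 u_2 ... u_p, which [moment_succ]
    expresses through moments. *)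
Lemma moment_rec M p : (p <= N)%N ->
  (M%:R + 2 * p%:R * (1 + al + g / 2 * (N%:R - p%:R))
     + g / 2 * p%:R * (p%:R - 1)) * K M p =
  p%:R * (1 + al + g / 2 * (N%:R - p%:R)) * K M p.-1
  + M%:R * ((p%:R - N%:R / 2) * K M.-1 p + (N%:R - p%:R) * K M.-1 p.+1).
Proof.
move=> pN; case: p pN => [|p] pN.
  case: M => [|M]; first by rewrite !(mul0r, mulr0, addr0).
  by rewrite moment_succ//= !mul0r; ring.
have pN' : (0 < p.+1 <= N)%N by [].
have H := @selberg_aomoto R al g al_gtN1 al_le0 g_gt0 m p.+1 M isT.
have b2 : cube_bounded (fun u : pt => x0 u * prod_tail p.+1 u * T u ^+ M).
  by apply: cube_boundedM => //; exact: cube_boundedM.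
have b1 := cube_boundedM (bq p.+1) (bT M).
rewrite mean_ibp_poly//= in H.
have E1 : cube_mean W (fun u => (1 - x0 u) * prod_tail p.+1 u * T u ^+ M) =
    K M p - K M p.+1.
  rewrite -(mean_tail M pN') -(mean_tail_x0 M (isT : (0 < p.+1)%N)).
  rewrite -(cube_meanB mW iW b1 b2).
  by apply: eq_cube_mean => u _; ring.
rewrite E1 mean_tail_x0// in H.
rewrite (eq_bigr _ (fun j _ => mean_swap_diff M j pN')) sum_ord_if// in H.
set V := cube_mean W _ in H.
(* V, the mean of u_1^2 u_2 ... u_(p+1) T^(M-1), is the only term that is not a
   moment; [moment_succ] at M - 1 eliminates it. *)
have E2 : M%:R * (p.+1%:R * V) = M%:R * (K M p.+1 - (N%:R - p.+1%:R) * K M.-1 p.+2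
   + N%:R / 2 * K M.-1 p.+1).
  case: M @V H {E1 b1 b2} => [|M] V H; first by rewrite !mul0r.
  by rewrite [M.+1.-1]/= (moment_succ M pN) -/V; ring.
have := congr1 (fun z => p.+1%:R * z) H; rewrite mulr0 /= => H'.
apply/eqP; rewrite -subr_eq0; apply/eqP; rewrite -[RHS]oppr0 -H'.
move: E2; rewrite -[p.+1%:R]natr1 -[m.+1%:R]natr1 => E2.
transitivity (- ((p%:R + 1) * (K M p - 2 * K M p.+1 + M%:R * K M.-1 p.+1
     + al * (K M p - K M p.+1 - K M p.+1)
     + g / 2 * (p%:R * - K M p.+1 + (m%:R - p%:R) * (K M p - 2 * K M p.+1))))
   + M%:R * (K M p.+1 - (m%:R + 1 - (p%:R + 1)) * K M.-1 p.+2
   + (m%:R + 1) / 2 * K M.-1 p.+1)); last by rewrite -E2; ring.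
by rewrite /=; field.
Qed.

End FixedDimension.

(** The specialisation al = -1 + 1/n, g = 2/n, N = 2n, divided by M!, so that the
    sequences are the Taylor coefficients of the averages J_p. *)
Lemma kappa_rec n M p : (0 < n)%N -> al = -1 + n%:R^-1 -> g = 2 / n%:R ->
  (p <= 2 * n)%N ->
  let kappa q r := selberg_moment (2 * n) q r / q`!%:R in
  (M%:R + p%:R * (4 * n%:R + 1 - p%:R) / n%:R) * kappa M p =
  ((2 * n)%:R - p%:R) * lag kappa M p.+1 + (p%:R - n%:R) * lag kappa M p
    + qv_coef R n p * kappa M p.-1.
Proof.
move=> n0 alE gE pN kappa.
have n0' : n%:R != 0 :> R by rewrite pnatr_eq0 -lt0n.
have H : (M%:R + p%:R * (4 * n%:R + 1 - p%:R) / n%:R) * selberg_moment (2 * n) M p =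
   qv_coef R n p * selberg_moment (2 * n) M p.-1 + M%:R *
   (((2 * n)%:R - p%:R) * selberg_moment (2 * n) M.-1 p.+1
    + (p%:R - n%:R) * selberg_moment (2 * n) M.-1 p).
  have NE : (2 * n = (2 * n).-1.+1)%N by rewrite prednK// muln_gt0.
  have := @moment_rec (2 * n).-1 M p; rewrite -NE => /(_ pN).
  rewrite /qv_coef alE gE natrM => H.
  transitivity ((M%:R + 2 * p%:R * (1 + (-1 + n%:R^-1) + 2 / n%:R / 2 * (2 * n%:R - p%:R))
      + 2 / n%:R / 2 * p%:R * (p%:R - 1)) * selberg_moment (2 * n) M p).
    by congr (_ * _); field.
  by rewrite H; field.
have F0 q : q`!%:R != 0 :> R by rewrite pnatr_eq0 -lt0n fact_gt0.
rewrite /kappa mulrA H; case: M H => [|M] _ /=.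
  by rewrite !(mul0r, mulr0, addr0, add0r) mulrA.
rewrite factS natrM; field.
by rewrite !F0 /= nat1r pnatr_eq0.
Qed.

End MomentRecursion.

(** * The complex exponential and its Taylor polynomials *)

Lemma norm_le_of_derive_le (R : realType) (f f' g g' : R -> R) :
  (forall t : R, 0 <= t <= 1 -> is_derive t 1 f (f' t)) ->
  (forall t : R, 0 <= t <= 1 -> is_derive t 1 g (g' t)) ->
  (forall t : R, 0 <= t <= 1 -> `|f' t| <= g' t) ->
  f 0 = 0 -> g 0 = 0 -> forall t : R, 0 <= t <= 1 -> `|f t| <= g t.
Proof.
move=> df dg fg f0 g0 t /andP[t0 t1].
have mono (h h' : R -> R) : (forall t : R, 0 <= t <= 1 -> is_derive t 1 h (h' t)) ->
    (forall t : R, 0 <= t <= 1 -> 0 <= h' t) -> h 0 <= h t.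
  move=> dh h'0; apply: (@ger0_derive1_ndecr R h 0 1) => //.
  - move=> s; rewrite in_itv /= => /andP[/ltW s0 /ltW s1].
    by apply: ex_derive; apply: dh; rewrite s0.
  - move=> s; rewrite in_itv /= => /andP[/ltW s0 /ltW s1].
    have s01 : 0 <= s <= 1 by rewrite s0.
    have D := dh s s01.
    by rewrite derive1E (@derive_val _ _ _ _ _ _ _ D) h'0.
  - apply: continuous_in_subspaceT => s; rewrite inE /= in_itv /= => /dh D.
    by apply: differentiable_continuous; apply/derivable1_diffP; exact: ex_derive.
have h1 : g 0 - f 0 <= g t - f t.
  apply: (mono (fun s => g s - f s) (fun t => g' t - f' t)) => s s01.
    exact: (is_deriveB (dg s s01) (df s s01)).
  by have := fg s s01; rewrite ler_norml => /andP[_ h]; rewrite subr_ge0.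
have h2 : g 0 + f 0 <= g t + f t.
  apply: (mono (fun s => g s + f s) (fun t => g' t + f' t)) => s s01.
    exact: (is_deriveD (dg s s01) (df s s01)).
  by have := fg s s01; rewrite ler_norml => /andP[h _]; lra.
rewrite ler_norml; lra.
Qed.

Section ComplexExponential.
Variable R : realType.
Local Notation C := (R[i]).
Local Notation Re := (@complex.Re R).
Local Notation Im := (@complex.Im R).

(** A real-valued norm: the norm of R[i] takes its values in R[i], and this one is
    computed from real and imaginary parts, in which the integrals are defined. *)
Definition l1norm (z : C) : R := `|Re z| + `|Im z|.

Lemma l1norm_ge0 z : 0 <= l1norm z.
Proof. by rewrite addr_ge0. Qed.

Lemma ReM (z w : C) : Re (z * w) = Re z * Re w - Im z * Im w.
Proof. by case: z w => [a b] [c d]. Qed.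

Lemma ImM (z w : C) : Im (z * w) = Re z * Im w + Im z * Re w.
Proof. by case: z w => [a b] [c d]. Qed.

Lemma ReD (z w : C) : Re (z + w) = Re z + Re w.
Proof. by case: z w => [a b] [c d]. Qed.

Lemma ImD (z w : C) : Im (z + w) = Im z + Im w.
Proof. by case: z w => [a b] [c d]. Qed.

Lemma ReN (z : C) : Re (- z) = - Re z. Proof. by case: z. Qed.
Lemma ImN (z : C) : Im (- z) = - Im z. Proof. by case: z. Qed.

Lemma l1normM z w : l1norm (z * w) <= l1norm z * l1norm w.
Proof.
rewrite /l1norm ReM ImM.
have := ler_normB (Re z * Re w) (Im z * Im w).
have := ler_normD (Re z * Im w) (Im z * Re w).
rewrite !normrM; lra.
Qed.

Lemma norm_le_l1norm (z : C) : `|z| <= (l1norm z)%:C%C.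
Proof.
case: z => a b; rewrite normc_def /= lecR /l1norm /=.
have s0 : 0 <= `|a| + `|b| by rewrite addr_ge0.
rewrite -[leRHS](ger0_norm s0) -sqrtr_sqr ler_wsqrtr//.
by rewrite sqrrD !real_normK ?num_real// lerD2r lerDl mulrn_wge0// mulr_ge0.
Qed.

Lemma cexpD (z w : C) : cexp (z + w) = cexp z * cexp w.
Proof.
case: z w => [a b] [c d]; rewrite /cexp /=; apply/eqP; rewrite eq_complex /=.
by rewrite expRD cosD sinD; apply/andP; split; apply/eqP; ring.
Qed.

Lemma cexp0 : cexp (0 : C) = 1.
Proof. by rewrite /cexp /= expR0 cos0 sin0 mulr0 mulr1. Qed.

Definition exp_partial (M : nat) (z : C) : C := \sum_(k < M) z ^+ k / k`!%:R.

Section Taylor.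
Variable z : C.
Let x := Re z.
Let y := Im z.
Let c (k : nat) : C := z ^+ k / k`!%:R.
Let pr (M : nat) (t : R) : R := \sum_(k < M) Re (c k) * t ^+ k.
Let pim (M : nat) (t : R) : R := \sum_(k < M) Im (c k) * t ^+ k.
Let er (t : R) : R := expR (t * x) * cos (t * y).
Let ei (t : R) : R := expR (t * x) * sin (t * y).

Let cS k : k.+1%:R * c k.+1 = z * c k.
Proof.
rewrite /c factS exprS natrM; field.
by rewrite nat1r !pnatr_eq0 -lt0n fact_gt0.
Qed.

Let ReZ (n : nat) (w : C) : Re (n%:R * w) = n%:R * Re w.
Proof.
have -> : (n%:R : C) = (n%:R : R)%:C%C by rewrite rmorph_nat.
by rewrite ReM /= mul0r subr0.
Qed.

Let ImZ (n : nat) (w : C) : Im (n%:R * w) = n%:R * Im w.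
Proof.
have -> : (n%:R : C) = (n%:R : R)%:C%C by rewrite rmorph_nat.
by rewrite ImM /= mul0r addr0.
Qed.

Let is_derive_poly_sum (co : nat -> R) M (t : R) :
  is_derive t 1 (fun s : R => \sum_(k < M.+1) co k * s ^+ k)
    (\sum_(k < M) k.+1%:R * co k.+1 * t ^+ k).
Proof.
have d1 : is_derive t 1 (fun s : R => s) 1 by exact: is_derive_id.
have d (k : 'I_M.+1) : is_derive t 1 (fun s : R => co k * s ^+ k) (k%:R * co k * t ^+ k.-1).
  have -> : (fun s : R => co k * s ^+ k) = co k \*: ((fun s : R => s) ^+ k).
    by apply/funext => s; rewrite /= exprfctE.
  apply: (is_derive_eq (is_deriveZ (co k) (is_deriveX k d1))).
  by rewrite /GRing.scale /=; ring.
have -> : (fun s : R => \sum_(k < M.+1) co k * s ^+ k) =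
    \sum_(k < M.+1) (fun s : R => co k * s ^+ k).
  by apply/funext => s; rewrite fct_sumE.
apply: (is_derive_eq (is_derive_sum d)).
by rewrite big_ord_recl !mul0r add0r.
Qed.

Let derive_er (t : R) : is_derive t 1 er (x * er t - y * ei t).
Proof.
have d1 : is_derive t 1 (fun s : R => s) 1 by exact: is_derive_id.
have dx : is_derive t 1 (fun s : R => s * x) x.
  apply: (is_derive_eq (is_deriveM d1 (is_derive_cst x t 1))).
  by rewrite /GRing.scale /= /cst; ring.
have dy : is_derive t 1 (fun s : R => s * y) y.
  apply: (is_derive_eq (is_deriveM d1 (is_derive_cst y t 1))).
  by rewrite /GRing.scale /= /cst; ring.
have de := @is_derive1_comp _ expR (fun s => s * x) _ _ _ (is_derive_expR (t * x)) dx.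
have dc := @is_derive1_comp _ cos (fun s => s * y) _ _ _ (is_derive_cos (t * y)) dy.
apply: (is_derive_eq (is_deriveM de dc)).
by rewrite /GRing.scale /= /er /ei; ring.
Qed.

Let derive_ei (t : R) : is_derive t 1 ei (x * ei t + y * er t).
Proof.
have d1 : is_derive t 1 (fun s : R => s) 1 by exact: is_derive_id.
have dx : is_derive t 1 (fun s : R => s * x) x.
  apply: (is_derive_eq (is_deriveM d1 (is_derive_cst x t 1))).
  by rewrite /GRing.scale /= /cst; ring.
have dy : is_derive t 1 (fun s : R => s * y) y.
  apply: (is_derive_eq (is_deriveM d1 (is_derive_cst y t 1))).
  by rewrite /GRing.scale /= /cst; ring.
have de := @is_derive1_comp _ expR (fun s => s * x) _ _ _ (is_derive_expR (t * x)) dx.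
have ds := @is_derive1_comp _ sin (fun s => s * y) _ _ _ (is_derive_sin (t * y)) dy.
apply: (is_derive_eq (is_deriveM de ds)).
by rewrite /GRing.scale /= /er /ei; ring.
Qed.

Let B := l1norm z.
Let K := expR `|x|.

Let taylor_bound M (t : R) : 0 <= t <= 1 ->
  `|er t - pr M t| <= K * (B * t) ^+ M / M`!%:R /\
  `|ei t - pim M t| <= K * (B * t) ^+ M / M`!%:R.
Proof.
elim: M t => [|M IH] t t01.
  have /andP[t0 t1] := t01.
  rewrite /pr /pim !big_ord0 !subr0 expr0 fact0 divr1 mulr1 /er /ei /K !normrM.
  rewrite !(ger0_norm (expR_ge0 _)).
  have E : expR (t * x) <= expR `|x|.
    rewrite ler_expR; apply: (le_trans (ler_norm _)); rewrite normrM (ger0_norm t0).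
    by rewrite ler_piMl.
  split; rewrite -[leRHS]mulr1; apply: ler_pM => //; rewrite ?expR_ge0//.
    by rewrite ler_norml cos_geN1 cos_le1.
  by rewrite ler_norml sin_geN1 sin_le1.
have dG (s : R) : is_derive s 1 (fun s : R => K * (B * s) ^+ M.+1 / M.+1`!%:R)
    (K * B * (B * s) ^+ M / M`!%:R).
  have d1 : is_derive s 1 (fun s : R => s) 1 by exact: is_derive_id.
  have -> : (fun s : R => K * (B * s) ^+ M.+1 / M.+1`!%:R) =
     (K * B ^+ M.+1 / M.+1`!%:R) \*: ((fun s : R => s) ^+ M.+1).
    by apply/funext => r /=; rewrite exprfctE /GRing.scale /= exprMn; ring.
  apply: (is_derive_eq (is_deriveZ _ (is_deriveX M.+1 d1))).
  rewrite /GRing.scale /= factS natrM exprMn exprS; field.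
  by rewrite nat1r !pnatr_eq0 -lt0n fact_gt0.
have bnd (p q : R) s : 0 <= s <= 1 ->
    `|p| <= K * (B * s) ^+ M / M`!%:R -> `|q| <= K * (B * s) ^+ M / M`!%:R ->
    `|x| * `|p| + `|y| * `|q| <= K * B * (B * s) ^+ M / M`!%:R.
  move=> s01 hp hq.
  have -> : K * B * (B * s) ^+ M / M`!%:R =
    `|x| * (K * (B * s) ^+ M / M`!%:R) + `|y| * (K * (B * s) ^+ M / M`!%:R).
    by rewrite /B /l1norm -/x -/y; ring.
  by apply: lerD; apply: ler_wpM2l.
have prE s : \sum_(k < M) k.+1%:R * Re (c k.+1) * s ^+ k = x * pr M s - y * pim M s.
  rewrite /pr /pim !mulr_sumr -sumrB; apply: eq_bigr => k _.
  by rewrite -ReZ cS ReM; ring.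
have piE s : \sum_(k < M) k.+1%:R * Im (c k.+1) * s ^+ k = x * pim M s + y * pr M s.
  rewrite /pr /pim !mulr_sumr -big_split; apply: eq_bigr => k _ /=.
  by rewrite -ImZ cS ImM; ring.
have G0 : K * (B * 0) ^+ M.+1 / M.+1`!%:R = 0.
  by rewrite mulr0 expr0n /= mulr0 mul0r.
split.
  apply: (@norm_le_of_derive_le R (fun s => er s - pr M.+1 s)
    (fun s => x * (er s - pr M s) - y * (ei s - pim M s)) _
    (fun s => K * B * (B * s) ^+ M / M`!%:R)) => //.
  - move=> s s01; have D := is_derive_poly_sum (fun k => Re (c k)) M s.
    apply: (is_derive_eq (is_deriveB (derive_er s) D)).
    by rewrite prE; ring.
  - move=> s s01; have [h1 h2] := IH s s01.
    by apply: le_trans (ler_normB _ _) _; rewrite !normrM; exact: bnd.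
  - rewrite /er /pr big_ord_recl big1 => [|k _]; last by rewrite expr0n /= mulr0.
    rewrite !mul0r expR0 cos0 expr0 /c expr0 fact0 divr1 /=; ring.
apply: (@norm_le_of_derive_le R (fun s => ei s - pim M.+1 s)
    (fun s => x * (ei s - pim M s) + y * (er s - pr M s)) _
    (fun s => K * B * (B * s) ^+ M / M`!%:R)) => //.
- move=> s s01; have D := is_derive_poly_sum (fun k => Im (c k)) M s.
  apply: (is_derive_eq (is_deriveB (derive_ei s) D)).
  by rewrite piE; ring.
- move=> s s01; have [h1 h2] := IH s s01.
  by apply: le_trans (ler_normD _ _) _; rewrite !normrM; exact: bnd.
- rewrite /ei /pim big_ord_recl big1 => [|k _]; last by rewrite expr0n /= mulr0.
  by rewrite !mul0r sin0 /c expr0 fact0 divr1 /=; ring.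
Qed.

(** Along the segment from 0 to z, the derivative of the remainder of order M + 1 is
    z times the remainder of order M, so the bound follows by induction on M from
    [norm_le_of_derive_le]. *)
Lemma cexp_taylor M :
  l1norm (cexp z - exp_partial M z) <= 2 * (expR `|x| * B ^+ M / M`!%:R).
Proof.
have t01 : 0 <= (1 : R) <= 1 by rewrite ler01 lexx.
have [h1 h2] := taylor_bound M t01.
have sRe : Re (exp_partial M z) = pr M 1.
  rewrite /exp_partial /pr; elim/big_rec2: _ => // k a b _ <-.
  by rewrite ReD expr1n mulr1.
have sIm : Im (exp_partial M z) = pim M 1.
  rewrite /exp_partial /pim; elim/big_rec2: _ => // k a b _ <-.
  by rewrite ImD expr1n mulr1.
rewrite mulr1 in h1 h2; rewrite /l1norm ReD ImD ReN ImN sRe sIm.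
rewrite mulr2n mulrDl mul1r; apply: lerD.
  by move: h1; rewrite /er !mul1r.
by move: h2; rewrite /ei !mul1r.
Qed.

End Taylor.
End ComplexExponential.

(** * Positivity of the Selberg integral *)

Section Positivity.
Variables (R : realType) (al g : R).
Hypotheses (al_gtN1 : -1 < al) (al_le0 : al <= 0) (g_gt0 : 0 < g).
Local Notation RT := (measurableTypeR R).
Variable N : nat.
Local Notation pt := (N.-tuple RT).
Local Notation tl := (tuple_lebesgue R N).
Local Notation W := (@selberg_weight R al g N).

Let h : R := (2 * N).+1%:R^-1.

Let h_gt0 : 0 < h. Proof. by rewrite invr_gt0 ltr0n. Qed.

Let cell (j : 'I_N) : set RT := [set` `[(2 * j).+1%:R * h, (2 * j).+2%:R * h]%R].

Let cells : set pt := [set u | forall j, cell j (tnth u j)].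

Let cell_bounds (u : pt) (j : 'I_N) : cells u ->
  (2 * j).+1%:R * h <= (tnth u j : R) <= (2 * j).+2%:R * h.
Proof. by move=> /(_ j); rewrite /cell /= in_itv. Qed.

Let cells_interior (u : pt) : cells u -> interior_point u.
Proof.
move=> cu j; have /andP[h1 h2] := cell_bounds j cu; apply/andP; split.
  by apply: lt_le_trans h1; rewrite mulr_gt0// ltr0n.
apply: le_lt_trans h2 _; rewrite /h ltr_pdivrMr ?ltr0n// mul1r ltr_nat.
by have := ltn_ord j; lia.
Qed.

Let cells_gap (u : pt) (j k : 'I_N) : cells u -> (j < k)%N ->
  h <= `|tnth u j - tnth u k : R|.
Proof.
move=> cu jk; have /andP[_ h2] := cell_bounds j cu; have /andP[h1 _] := cell_bounds k cu.
have H : (2 * j).+2%:R + 1 <= (2 * k).+1%:R :> R by rewrite natr1 ler_nat; lia.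
have H' : ((2 * j).+2%:R + 1) * h <= (2 * k).+1%:R * h by rewrite ler_pM2r.
rewrite distrC; apply: le_trans (ler_norm _); lra.
Qed.

Let floor : R := \prod_(j < N) \prod_(k < N | (j < k)%N) h `^ g.

Let floor_gt0 : 0 < floor.
Proof. by apply: prodr_gt0 => j _; apply: prodr_gt0 => k _; exact: powR_gt0. Qed.

Let le1_powR (x : R) : 0 < x <= 1 -> 1 <= x `^ al.
Proof.
move=> /andP[x0 x1]; have := le0_ler_powR al_le0 x0 x1; by rewrite powR1.
Qed.

Let floor_le (u : pt) : cells u -> floor <= W u.
Proof.
move=> cu; have iu := cells_interior cu.
rewrite /selberg_weight -[leLHS]mul1r; apply: ler_pM.
- exact: ler01.
- exact: ltW.
- rewrite [X in X <= _](_ : 1 = \prod_(j < N) (1 : R)); last by rewrite big1.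
  apply: ler_prod => j _; rewrite ler01 /=; have /andP[u0 u1] := iu j.
  rewrite -[leLHS]mulr1; apply: ler_pM => //; apply: le1_powR; lra.
- apply: ler_prod => j _; rewrite prodr_ge0 => [/=|k _]; last exact: powR_ge0.
  apply: ler_prod => k jk; rewrite powR_ge0 /=.
  apply: ge0_ler_powR; rewrite ?nnegrE ?(ltW g_gt0) ?(ltW h_gt0)//.
  exact: cells_gap.
Qed.

(** On the box whose j-th side is [(2j+1) h, (2j+2) h] with h = 1/(2N+1) the
    coordinates stay away from each other, so the weight is bounded below. *)
Lemma selberg_weight_mean_gt0 : 0 < \int[tl]_(u in cube R N) W u.
Proof.
have mcell j : measurable (cell j) by exact: measurable_itv.
have mC : measurable cells by exact: measurable_box.
have CQ : cells `<=` cube R N by move=> u /cells_interior/interior_cube.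
have iW := @selberg_weight_integrable R al g al_gtN1 al_le0 g_gt0 N.
have mW : measurable_fun [set: pt] W by exact: measurable_selberg_weight.
have W0 (u : pt) : cube R N u -> 0 <= W u.
  by move=> uQ; have /andP[] := selberg_weight_le al g_gt0 uQ.
rewrite -lte_fin /Rintegral fineK; last exact: (integrable_fin_num (@measurable_cube R N) iW).
apply: (@lt_le_trans _ _ (\int[tl]_(u in cells) floor%:E)%E).
  rewrite integral_cst//.
  have E := @tuple_lebesgue_box R N cell mcell.
  apply: (eq_ind_r (fun z => (0 < floor%:E * z)%E) _ E).
  have -> : (\prod_(i < N) lebesgue_measure (cell i) = (h ^+ N)%:E)%E.
    transitivity (\prod_(i < N) h%:E)%E.
      apply: eq_bigr => j _; rewrite lebesgue_measure_itv /= lte_fin ltr_pM2r// ltr_nat leqnn.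
      by rewrite -EFinB -mulrBl -[(2 * j).+2%:R]natr1 addrAC subrr add0r mul1r.
    by elim: (N) => [|k IH]; rewrite ?big_ord0 ?expr0// big_ord_recl exprS EFinM IH.
  by rewrite -EFinM lte_fin mulr_gt0// exprn_gt0.
apply: (@le_trans _ _ (\int[tl]_(u in cells) (W u)%:E)%E).
  apply: ge0_le_integral => //.
  - by move=> u _; rewrite lee_fin ltW.
  - by apply/measurable_EFinP/measurable_funTS.
apply: ge0_subset_integral => //.
- exact: measurable_cube.
- by apply/measurable_EFinP/measurable_funTS.
Qed.

End Positivity.

(** * The Fourier-Laplace transform of the Selberg weight *)

Section ComplexMeans.
Variables (R : realType) (N : nat).
Local Notation C := (R[i]).
Local Notation RT := (measurableTypeR R).
Local Notation pt := (N.-tuple RT).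
Local Notation tl := (tuple_lebesgue R N).
Local Notation Q := (cube R N).
Local Notation Re := (@complex.Re R).
Local Notation Im := (@complex.Im R).
Local Notation T := (@centered_sum R N).

Variable w : pt -> R.
Hypotheses (mw : measurable_fun [set: pt] w)
  (iw : tl.-integrable Q (EFin \o w)) (w0 : forall u, Q u -> 0 <= w u).
Let S : R := \int[tl]_(u in Q) w u.

Definition cplx_bounded (F : pt -> C) : Prop :=
  cube_bounded (fun u => Re (F u)) /\ cube_bounded (fun u => Im (F u)).

(** The mean of a complex function, taken on real and imaginary parts so as to match
    [cintegral]. *)
Definition cplx_mean (F : pt -> C) : C :=
  (cube_mean w (fun u => Re (F u)) +i* cube_mean w (fun u => Im (F u)))%C.

Lemma eq_cplx_mean F G : (forall u, F u = G u) -> cplx_mean F = cplx_mean G.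
Proof. by move=> FG; congr cplx_mean; apply/funext. Qed.

Lemma cplx_mean_cintegral F :
  cintegral tl Q (fun u => F u * (w u)%:C%C) = cplx_mean F.
Proof.
by congr (_ +i* _)%C; apply: eq_Rintegral => u _;
  rewrite ?ReM ?ImM /= ?mulr0 ?subr0 ?add0r.
Qed.

Lemma cplx_boundedZ c F : cplx_bounded F -> cplx_bounded (fun u => c * F u).
Proof.
move=> [bR bI]; have bc d := @cube_bounded_cst R N d; split.
  by under eq_fun do rewrite ReM; apply: cube_boundedB; apply: cube_boundedM.
by under eq_fun do rewrite ImM; apply: cube_boundedD; apply: cube_boundedM.
Qed.

Lemma cplx_boundedD F G : cplx_bounded F -> cplx_bounded G ->
  cplx_bounded (fun u => F u + G u).
Proof.
move=> [bR bI] [bR' bI']; split.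
  by under eq_fun do rewrite ReD; apply: cube_boundedD.
by under eq_fun do rewrite ImD; apply: cube_boundedD.
Qed.

Lemma cplx_boundedM F G : cplx_bounded F -> cplx_bounded G ->
  cplx_bounded (fun u => F u * G u).
Proof.
move=> [bR bI] [bR' bI']; split.
  by under eq_fun do rewrite ReM; apply: cube_boundedB; apply: cube_boundedM.
by under eq_fun do rewrite ImM; apply: cube_boundedD; apply: cube_boundedM.
Qed.

Lemma cplx_bounded_cst c : cplx_bounded (fun=> c).
Proof. by split; exact: cube_bounded_cst. Qed.

Lemma cplx_bounded_real f : cube_bounded f -> cplx_bounded (fun u => (f u)%:C%C).
Proof. by move=> bf; split => //=; exact: cube_bounded_cst. Qed.

Lemma cplx_meanZ c F : cplx_bounded F ->
  cplx_mean (fun u => c * F u) = c * cplx_mean F.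
Proof.
move=> [bR bI]; have bc d := @cube_bounded_cst R N d.
apply/eqP; rewrite eq_complex /=; apply/andP; split; apply/eqP.
  rewrite ReM /= -(cube_meanZ mw iw _ bR) -(cube_meanZ mw iw _ bI).
  rewrite -(cube_meanB mw iw (cube_boundedM (bc _) bR) (cube_boundedM (bc _) bI)).
  by apply: eq_cube_mean => u _; rewrite ReM.
rewrite ImM /= -(cube_meanZ mw iw _ bR) -(cube_meanZ mw iw _ bI).
rewrite -(cube_meanD mw iw (cube_boundedM (bc _) bI) (cube_boundedM (bc _) bR)).
by apply: eq_cube_mean => u _; rewrite ImM.
Qed.

Lemma cplx_meanD F G : cplx_bounded F -> cplx_bounded G ->
  cplx_mean (fun u => F u + G u) = cplx_mean F + cplx_mean G.
Proof.
move=> [bR bI] [bR' bI'].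
apply/eqP; rewrite eq_complex /=; apply/andP; split; apply/eqP.
  rewrite -(cube_meanD mw iw bR bR').
  by apply: eq_cube_mean => u _; rewrite ReD.
rewrite -(cube_meanD mw iw bI bI').
by apply: eq_cube_mean => u _; rewrite ImD.
Qed.

Lemma cplx_meanB F G : cplx_bounded F -> cplx_bounded G ->
  cplx_mean (fun u => F u - G u) = cplx_mean F - cplx_mean G.
Proof.
move=> bF bG; rewrite -[- cplx_mean G]mulN1r -cplx_meanZ// -cplx_meanD//.
  by apply: eq_cplx_mean => u; rewrite mulN1r.
exact: cplx_boundedZ.
Qed.

Lemma cplx_mean_sum (I : eqType) (s : seq I) (F : I -> pt -> C) :
  (forall i, cplx_bounded (F i)) ->
  cplx_mean (fun u => \sum_(i <- s) F i u) = \sum_(i <- s) cplx_mean (F i) /\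
  cplx_bounded (fun u => \sum_(i <- s) F i u).
Proof.
move=> bF; elim: s => [|i s [IH bs]].
  rewrite big_nil; under eq_fun do rewrite big_nil; split; last exact: cplx_bounded_cst.
  rewrite -[RHS](mul0r (cplx_mean (fun=> 0))) -cplx_meanZ; last exact: cplx_bounded_cst.
  by apply: eq_cplx_mean => u; rewrite mul0r.
under eq_fun do rewrite big_cons; rewrite big_cons -IH; split.
  by rewrite -cplx_meanD.
exact: cplx_boundedD.
Qed.

Lemma cube_mean_norm_le f M : cube_bounded f -> (forall u, Q u -> `|f u| <= M) ->
  `|cube_mean w f| <= M * S.
Proof.
move=> bf fM; have mQ := @measurable_cube R N.
apply: le_trans (le_normr_Rintegral mQ (cube_mean_integrable mw iw bf)) _.
rewrite /S -RintegralZl//; apply: le_Rintegral => //.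
- by apply: (@integrable_norm _ _ _ tl Q (fun u => f u * w u)); exact: cube_mean_integrable.
- by have := cube_mean_integrable mw iw (@cube_bounded_cst R N M).
- by move=> u uQ; rewrite normrM (ger0_norm (w0 uQ)) ler_wpM2r ?w0// fM.
Qed.

Lemma cplx_mean_l1norm_le F M : cplx_bounded F ->
  (forall u, Q u -> l1norm (F u) <= M) -> l1norm (cplx_mean F) <= 2 * (M * S).
Proof.
move=> [bR bI] FM; rewrite mulr2n mulrDl mul1r; apply: lerD.
  apply: cube_mean_norm_le => // u uQ; apply: le_trans (FM u uQ).
  by rewrite /l1norm lerDl.
apply: cube_mean_norm_le => // u uQ; apply: le_trans (FM u uQ).
by rewrite /l1norm lerDr.
Qed.

Lemma centered_sum_le u : Q u -> `|T u| <= N%:R.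
Proof.
move=> uQ; rewrite /centered_sum; apply: le_trans (ler_norm_sum _ _ _) _.
rewrite (_ : N%:R = \sum_(j < N) (1 : R)); last by rewrite sumr_const card_ord.
by apply: ler_sum => j _; have /andP[u0 u1] := uQ j; rewrite ler_norml; lra.
Qed.

Lemma l1normZr (z : C) (t : R) : l1norm (z * t%:C%C) = l1norm z * `|t|.
Proof.
by rewrite /l1norm ReM ImM /= !mulr0 subr0 add0r !normrM -mulrDl.
Qed.

Lemma l1norm_mulT (z : C) u : Q u -> l1norm (z * (T u)%:C%C) <= l1norm z * N%:R.
Proof.
by move=> uQ; rewrite l1normZr ler_wpM2l ?l1norm_ge0// centered_sum_le.
Qed.

Lemma cplx_bounded_cexpT z : cplx_bounded (fun u => cexp (z * (T u)%:C%C)).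
Proof.
have [mT _] := @cube_bounded_centered_sum R N.
have mRe : measurable_fun [set: pt] (fun u => Re z * T u) by exact: measurable_funM.
have mIm : measurable_fun [set: pt] (fun u => Im z * T u) by exact: measurable_funM.
have E u : (Re (z * (T u)%:C%C) = Re z * T u) * (Im (z * (T u)%:C%C) = Im z * T u).
  by rewrite ReM ImM /= !mulr0 subr0 add0r.
have bE u : Q u -> expR (Re z * T u) <= expR (l1norm z * N%:R).
  move=> uQ; rewrite ler_expR; apply: le_trans (ler_norm _) _; rewrite normrM.
  by apply: ler_pM => //; [rewrite /l1norm lerDl|exact: centered_sum_le].
split.
  rewrite /cexp; under eq_fun do rewrite /= !E; split.
    apply: measurable_funM; first exact: (measurableT_comp (@measurable_expR R)).
    exact: (measurableT_comp (continuous_measurable_fun (@continuous_cos R))).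
  exists (expR (l1norm z * N%:R)) => u uQ.
  rewrite normrM (ger0_norm (expR_ge0 _)) -[leRHS]mulr1.
  by apply: ler_pM; rewrite ?expR_ge0// ?bE// ler_norml cos_geN1 cos_le1.
rewrite /cexp; under eq_fun do rewrite /= !E; split.
  apply: measurable_funM; first exact: (measurableT_comp (@measurable_expR R)).
  exact: (measurableT_comp (continuous_measurable_fun (@continuous_sin R))).
exists (expR (l1norm z * N%:R)) => u uQ.
rewrite normrM (ger0_norm (expR_ge0 _)) -[leRHS]mulr1.
by apply: ler_pM; rewrite ?expR_ge0// ?bE// ler_norml sin_geN1 sin_le1.
Qed.

Lemma cplx_bounded_partialT M z : cplx_bounded (fun u => exp_partial M (z * (T u)%:C%C)).
Proof.
have b (k : 'I_M) : cplx_bounded (fun u => (z * (T u)%:C%C) ^+ k / k`!%:R).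
  have -> : (fun u => (z * (T u)%:C%C) ^+ k / k`!%:R) =
      (fun u => z ^+ k / k`!%:R * (T u ^+ k)%:C%C).
    by apply/funext => u; rewrite exprMn rmorphXn /=; ring.
  apply: cplx_boundedZ; apply: cplx_bounded_real; apply: cube_boundedX.
  exact: cube_bounded_centered_sum.
by have [] := cplx_mean_sum (index_enum 'I_M) b.
Qed.

Definition char_fun (z : C) : C := cplx_mean (fun u => cexp (z * (T u)%:C%C)).

Lemma expR_Re_le (z : C) u : Q u ->
  expR `|Re (z * (T u)%:C%C)| <= expR (l1norm z * N%:R).
Proof.
move=> uQ; rewrite ler_expR; apply: le_trans (l1norm_mulT z uQ).
by rewrite /l1norm lerDl.
Qed.

Lemma cexp_taylorT M (z : C) u : Q u ->
  l1norm (cexp (z * (T u)%:C%C) - exp_partial M (z * (T u)%:C%C)) <=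
  2 * (expR (l1norm z * N%:R) * (l1norm z * N%:R) ^+ M / M`!%:R).
Proof.
move=> uQ; apply: le_trans (cexp_taylor _ _) _.
rewrite ler_pM2l// -!mulrA ler_pM ?expR_ge0//.
- by rewrite mulr_ge0 ?exprn_ge0 ?l1norm_ge0// invr_ge0 ler0n.
- exact: expR_Re_le.
- rewrite ler_wpM2r ?invr_ge0 ?ler0n// lerXn2r ?nnegrE ?l1norm_ge0//.
    by rewrite mulr_ge0 ?l1norm_ge0.
  exact: l1norm_mulT.
Qed.

Lemma char_fun_taylor M (z : C) :
  l1norm (char_fun z - \sum_(k < M) z ^+ k * (cube_mean w (fun u => T u ^+ k) / k`!%:R)%:C%C)
  <= 2 * (2 * (expR (l1norm z * N%:R) * (l1norm z * N%:R) ^+ M / M`!%:R) * S).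
Proof.
have b (k : 'I_M) : cplx_bounded (fun u => z ^+ k / k`!%:R * (T u ^+ k)%:C%C).
  apply: cplx_boundedZ; apply: cplx_bounded_real; apply: cube_boundedX.
  exact: cube_bounded_centered_sum.
have -> : \sum_(k < M) z ^+ k * (cube_mean w (fun u => T u ^+ k) / k`!%:R)%:C%C =
   cplx_mean (fun u => exp_partial M (z * (T u)%:C%C)).
  have [E _] := cplx_mean_sum (index_enum 'I_M) b.
  transitivity (cplx_mean (fun u => \sum_(k < M) z ^+ k / k`!%:R * (T u ^+ k)%:C%C)).
    rewrite E; apply: eq_bigr => k _; rewrite cplx_meanZ.
      suff : cplx_mean (fun u => (T u ^+ k)%:C%C) = (cube_mean w (fun u => T u ^+ k))%:C%C.
        by move=> ->; rewrite rmorphM fmorphV rmorph_nat /=; ring.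
      congr (_ +i* _)%C; rewrite -[RHS](mul0r (cube_mean w (fun=> 0))) -(cube_meanZ mw iw).
        by apply: eq_cube_mean => u _; rewrite mul0r.
      exact: cube_bounded_cst.
    apply: cplx_bounded_real; apply: cube_boundedX.
    exact: cube_bounded_centered_sum.
  apply: eq_cplx_mean => u; apply: eq_bigr => k _.
  by rewrite exprMn rmorphXn /=; ring.
rewrite -cplx_meanB; [|exact: cplx_bounded_cexpT|exact: cplx_bounded_partialT].
apply: cplx_mean_l1norm_le; last by move=> u; exact: cexp_taylorT.
apply: cplx_boundedD; first exact: cplx_bounded_cexpT.
have -> : (fun u => - exp_partial M (z * (T u)%:C%C)) =
   (fun u => -1 * exp_partial M (z * (T u)%:C%C)).
  by apply/funext => u; rewrite mulN1r.
by apply: cplx_boundedZ; exact: cplx_bounded_partialT.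
Qed.

Definition char_fun_deriv (z : C) : C :=
  cplx_mean (fun u => cexp (z * (T u)%:C%C) * (T u)%:C%C).

(** The difference is the mean of e^(z T) (e^(h T) - 1 - h T). *)
Lemma char_fun_diff (z : C) : exists K : R, 0 <= K /\ forall h : C, l1norm h <= 1 ->
  l1norm (char_fun (z + h) - char_fun z - h * char_fun_deriv z) <= K * l1norm h ^+ 2.
Proof.
have bE := cplx_bounded_cexpT z.
have bTc : cplx_bounded (fun u => (T u)%:C%C).
  by apply: cplx_bounded_real; exact: cube_bounded_centered_sum.
have bN F : cplx_bounded F -> cplx_bounded (fun u => - F u).
  move=> bF; have -> : (fun u => - F u) = (fun u => -1 * F u).
    by apply/funext => u; rewrite mulN1r.
  exact: cplx_boundedZ.
have [[_ [M1 h1]] [_ [M2 h2]]] := bE.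
have S0 : 0 <= S by apply: Rintegral_ge0 => u; exact: w0.
(* 2 S from [cplx_mean_l1norm_le], M1 + M2 bounds e^(z T), and e^N (N |h|)^2 bounds
   the remainder of order 2 of e^(h T) for |h| at most 1. *)
exists (2 * ((`|M1| + `|M2|) * (expR N%:R * N%:R ^+ 2) * S)); split.
  by rewrite !mulr_ge0// ?expR_ge0// ?addr_ge0// exprn_ge0.
move=> h hle.
have -> : char_fun (z + h) - char_fun z - h * char_fun_deriv z =
  cplx_mean (fun u => cexp (z * (T u)%:C%C) *
    (cexp (h * (T u)%:C%C) - exp_partial 2 (h * (T u)%:C%C))).
  rewrite /char_fun_deriv -cplx_meanZ; last exact: cplx_boundedM.
  rewrite /char_fun -cplx_meanB//; last exact: cplx_bounded_cexpT.
  rewrite -cplx_meanB; last 2 first.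
  - by apply: cplx_boundedD; [exact: cplx_bounded_cexpT|exact: bN].
  - by apply: cplx_boundedZ; exact: cplx_boundedM.
  apply: eq_cplx_mean => u; rewrite /exp_partial !big_ord_recl big_ord0 /= mulrDl cexpD.
  by rewrite /bump /= expr0 expr1 !fact0 !invr1; ring.
rewrite [leRHS](_ : _ = 2 * ((`|M1| + `|M2|) * (expR N%:R * (l1norm h * N%:R) ^+ 2) * S)); last by ring.
apply: cplx_mean_l1norm_le.
  apply: cplx_boundedM => //; apply: cplx_boundedD; first exact: cplx_bounded_cexpT.
  by apply: bN; exact: cplx_bounded_partialT.
move=> u uQ; apply: le_trans (l1normM _ _) _; apply: ler_pM; rewrite ?l1norm_ge0//.
  rewrite /l1norm; apply: lerD.
    exact: le_trans (h1 u uQ) (ler_norm _).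
  exact: le_trans (h2 u uQ) (ler_norm _).
apply: le_trans (cexp_taylorT 2 h uQ) _.
rewrite [leLHS](_ : _ = expR (l1norm h * N%:R) * (l1norm h * N%:R) ^+ 2); last first.
  by rewrite (_ : 2`! = 2)%N//; field.
rewrite ler_wpM2r ?exprn_ge0 ?mulr_ge0 ?l1norm_ge0// ler_expR.
by rewrite ler_piMl.
Qed.

End ComplexMeans.

(** * The two entire functions agree *)

Lemma l1norm_le_norm (R : realType) (z : R[i]) : (l1norm z)%:C%C <= 2 * `|z|.
Proof.
case: z => a b; rewrite normc_def /=.
have -> : 2 * (Num.sqrt (a ^+ 2 + b ^+ 2))%:C%C =
   (2 * Num.sqrt (a ^+ 2 + b ^+ 2))%:C%C :> R[i] by rewrite rmorphM rmorph_nat.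
rewrite lecR /l1norm /= mulr2n mulrDl mul1r; apply: lerD; rewrite -sqrtr_sqr ler_wsqrtr//.
  by rewrite lerDl sqr_ge0.
by rewrite lerDr sqr_ge0.
Qed.

Section TwoSides.
Variables (R : realType) (n : nat).
Hypothesis n_gt0 : (0 < n)%N.
Local Notation C := (R[i]).
Local Notation N := (2 * n)%N.
Local Notation RT := (measurableTypeR R).
Local Notation al := (-1 + n%:R^-1 : R).
Local Notation g := (2 / n%:R : R).
Local Notation W := (@selberg_weight R al g N).
Local Notation pt := (N.-tuple RT).
Local Notation T := (@centered_sum R N).

Let n0 : (0 : R) < n%:R. Proof. by rewrite ltr0n. Qed.

Let al_gtN1 : -1 < al. Proof. by rewrite ltrDl invr_gt0. Qed.

Let al_le0 : al <= 0.
Proof. by rewrite addrC subr_le0 invf_le1// ler1n. Qed.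

Let g_gt0 : 0 < g. Proof. by rewrite divr_gt0. Qed.

Let mW : measurable_fun [set: pt] W.
Proof. exact: measurable_selberg_weight. Qed.

Let iW : (tuple_lebesgue R N).-integrable (cube R N) (EFin \o W).
Proof. exact: selberg_weight_integrable. Qed.

Let W0 (u : pt) : cube R N u -> 0 <= W u.
Proof. by move=> uQ; have /andP[] := selberg_weight_le al g_gt0 uQ. Qed.

Let S_gt0 : 0 < selberg_S R n.
Proof. exact: (@selberg_weight_mean_gt0 R al g al_gtN1 al_le0 g_gt0 N). Qed.

Let kappa q r := selberg_moment al g N q r / q`!%:R.

Lemma moment0E q : selberg_moment al g N q 0 = cube_mean W (fun u => T u ^+ q).
Proof.
by apply: eq_cube_mean => u _; rewrite /prod_lt big_pred0 ?mul1r.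
Qed.

Let kappa00 : kappa 0 0 = selberg_S R n.
Proof.
rewrite /kappa fact0 divr1 moment0E; apply: eq_Rintegral => u _.
by rewrite expr0 mul1r.
Qed.

(** Since N/2 = n, the factor e^(-i n lambda) centres each coordinate at 1/2. *)
Lemma selberg_GE (lambda : C) :
  selberg_G n lambda = char_fun W ('i%C * lambda) / (selberg_S R n)%:C%C.
Proof.
have bT := @cplx_bounded_cexpT R N.
rewrite /selberg_G.
have -> : cintegral (tuple_lebesgue R N) (@unit_cube R n) (fun u =>
    cexp ('i%C * lambda * (\sum_(j < N) (tnth u j : R))%:C%C) * (selberg_W u)%:C%C) =
  cplx_mean W (fun u => cexp ('i%C * lambda * (\sum_(j < N) (tnth u j : R))%:C%C)).
  exact: (@cplx_mean_cintegral R N W).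
set c := cexp _; rewrite mulrAC; congr (_ / _).
have E (u : pt) : cexp ('i%C * lambda * (\sum_(j < N) (tnth u j : R))%:C%C) =
    cexp ('i%C * n%:R * lambda) * cexp ('i%C * lambda * (T u)%:C%C).
  rewrite -cexpD; congr cexp.
  have -> : \sum_(j < N) (tnth u j : R) = T u + n%:R.
    have H : (2^-1 : R) *+ N = n%:R.
      by rewrite -[LHS]mulr_natl natrM; field.
    by rewrite /centered_sum sumrB sumr_const card_ord H subrK.
  by rewrite rmorphD rmorph_nat /=; ring.
rewrite (eq_cplx_mean _ E) (cplx_meanZ mW iW)// mulrA /c -cexpD.
by rewrite addNr cexp0 mul1r.
Qed.

Let f m := qv_diff n (@qv_ext R n) m 0.

Let f_moments m : f m =
  (-1) ^+ n * selberg_D R n / selberg_S R n * (if (N <= m)%N then kappa (m - N) 0 else 0).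
Proof.
have krec q p : (p <= N)%N ->
  (q%:R + p%:R * (4 * n%:R + 1 - p%:R) / n%:R) * kappa q p =
  (N%:R - p%:R) * lag kappa q p.+1 + (p%:R - n%:R) * lag kappa q p
    + qv_coef R n p * kappa q p.-1.
  by move=> pN; exact: (@kappa_rec R al g al_gtN1 al_le0 g_gt0 n q p n_gt0 erefl erefl pN).
have H := @qv_diff_moments R n n_gt0 kappa krec (@qv_ext R n)
  (fun q r rN => @qv_ext_rec R n n_gt0 q r rN) (@qv_ext_top R n n_gt0) m.
have S0 : selberg_S R n != 0 by rewrite gt_eqF.
rewrite kappa00 in H; apply: (mulfI S0); rewrite -/(f m) in H; rewrite H.
by case: ifP => _; field.
Qed.

(** The coefficients of odd order and those of order below N vanish, so the partial
    sum up to 2J is the full Taylor polynomial of degree 2J. *)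
Lemma partial_sum_moments (lambda : C) J : (n <= J)%N ->
  2 * qv_partial_sum n lambda J =
  (selberg_D R n)%:C%C * lambda ^+ N / (selberg_S R n)%:C%C *
  \sum_(k < (2 * J).+1 - N) ('i%C * lambda) ^+ k *
     (cube_mean W (fun u => T u ^+ k) / k`!%:R)%:C%C.
Proof.
move=> nJ; set z := 'i%C * lambda.
have E1 : 2 * qv_partial_sum n lambda J = \sum_(k < (2 * J).+1) z ^+ k * (f k)%:C%C.
  rewrite /qv_partial_sum mulr_sumr; elim: (J) => [|j IH].
    rewrite big_geq// muln0 big_ord_recl big_ord0 f_moments ifF ?mulr0 ?addr0//.
    by apply/negbTE; rewrite -ltnNge muln_gt0.
  rewrite big_nat_recr// IH qv_term_even// -/z -/(f _).
  rewrite (_ : 2 * j.+1 = (2 * j).+2)%N; last by lia.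
  rewrite [RHS]big_ord_recr [X in _ = _ X _]big_ord_recr /=.
  have -> : f (2 * j).+1 = 0.
    by apply: qv_diff_ext_odd => //; rewrite /= mul2n odd_double.
  by rewrite mulr0 addr0.
rewrite E1; set q := ((2 * J).+1 - N)%N.
have -> : (2 * J).+1 = (N + q)%N by rewrite /q; lia.
rewrite big_split_ord /= big1 ?add0r => [|k _]; last first.
  by rewrite f_moments ifF ?mulr0 ?mulr0//; apply/negbTE; rewrite -ltnNge ltn_ord.
rewrite mulr_sumr; apply: eq_bigr => k _.
rewrite f_moments leq_addr addKn /kappa moment0E exprD.
have -> : z ^+ N = (-1) ^+ n * lambda ^+ N.
  by rewrite /z exprMn exprM sqr_i.
have s1 : ((-1) ^+ n * (-1) ^+ n : C) = 1 by rewrite -expr2 sqrr_sign.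
have -> : ((-1) ^+ n * selberg_D R n / selberg_S R n *
   (cube_mean W (fun u => T u ^+ k) / k`!%:R))%:C%C =
   (-1) ^+ n * ((selberg_D R n)%:C%C / (selberg_S R n)%:C%C *
   (cube_mean W (fun u => T u ^+ k) / k`!%:R)%:C%C) :> C.
  by rewrite !rmorphM rmorphXn rmorphN rmorph1 !fmorphV /=; ring.
set X := (cube_mean _ _ / _)%:C%C.
transitivity ((-1) ^+ n * (-1) ^+ n * ((selberg_D R n)%:C%C * lambda ^+ N
  / (selberg_S R n)%:C%C * (z ^+ k * X)) : C); first by ring.
by rewrite s1 mul1r.
Qed.

(** The error is bounded by the remainder of the exponential series. *)
Lemma cvg_partial_sum (lambda : C) :
  qv_partial_sum n lambda @ \oo --> (forrester n lambda / 2 : C^o).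
Proof.
set z := 'i%C * lambda.
set c := (selberg_D R n)%:C%C * lambda ^+ N / (selberg_S R n)%:C%C.
pose A := l1norm z * N%:R.
pose b m := l1norm c * (2 * (2 * (expR A * A ^+ m / m`!%:R) * selberg_S R n)).
have b0 : b m @[m --> \oo] --> (0 : R).
  have H := cvg_series_cvg_0 (is_cvg_series_exp_coeff A).
  have -> : b = fun m => l1norm c * (2 * 2 * expR A * selberg_S R n) * exp_coeff A m.
    by apply/funext => m; rewrite /b /exp_coeff /=; ring.
  rewrite -[X in _ --> X](mulr0 (l1norm c * (2 * 2 * expR A * selberg_S R n))).
  by apply: cvgM => //; exact: cvg_cst.
have bound J : (n <= J)%N ->
    `|forrester n lambda / 2 - qv_partial_sum n lambda J : C| <= (b ((2 * J).+1 - N)%N)%:C%C.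
  move=> nJ; have E := partial_sum_moments lambda nJ.
  have F : forrester n lambda = c * char_fun W z.
    by rewrite /forrester selberg_GE /c /z; ring.
  have -> : forrester n lambda / 2 - qv_partial_sum n lambda J =
     2^-1 * (c * (char_fun W z - \sum_(k < (2 * J).+1 - N) z ^+ k *
       (cube_mean W (fun u => T u ^+ k) / k`!%:R)%:C%C)).
    by rewrite mulrBr -/c in E *; rewrite -F -E; field.
  rewrite normrM ger0_norm ?invr_ge0// -[leRHS]mul1r; apply: ler_pM => //.
    by rewrite invf_le1// ler1n.
  apply: le_trans (norm_le_l1norm _) _; rewrite lecR.
  apply: le_trans (l1normM _ _) _; rewrite ler_wpM2l ?l1norm_ge0//.
  exact: (char_fun_taylor mW iW W0).
apply/cvgrPdist_le => eps eps0.
have eE : eps = (complex.Re eps)%:C%C.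
  by apply/eqP; rewrite eq_complex /= eqxx; move: eps0; rewrite ltcE /= => /andP[].
have e0 : 0 < complex.Re eps by move: eps0; rewrite ltcE /= => /andP[].
have /cvgrPdist_le/(_ _ e0)[m0 _ H] := b0.
exists (m0 + n)%N => // J /= HJ.
apply: le_trans (bound J _) _; first exact: leq_trans (leq_addl _ _) HJ.
rewrite eE lecR; have := H ((2 * J).+1 - N)%N.
rewrite sub0r normrN => H'; apply: le_trans (ler_norm _) (H' _) => /=.
lia.
Qed.

Lemma char_fun_entire (lambda : C^o) :
  derivable (fun l : C^o => char_fun W ('i%C * l) : C^o) lambda 1.
Proof.
have [K [K0 HK]] := char_fun_diff mW iW W0 ('i%C * lambda).
apply/cvg_ex; exists ('i%C * char_fun_deriv W ('i%C * lambda)).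
apply/cvgrPdist_le => eps eps0.
have il (h : C) : l1norm ('i%C * h) = l1norm h.
  by rewrite /l1norm ReM ImM /= !mul0r !mul1r sub0r add0r normrN addrC.
near=> h.
have h0 : h != 0 by near: h; exact: nbhs_dnbhs_neq.
have h1 : `|h| <= 2^-1 by near: h; apply: dnbhs0_le.
(* The factor 4 comes from comparing the squares of [l1norm] h and `|h|; adding 1
   covers the case K = 0. *)
have h2 : `|h| <= eps / (4 * K + 1)%:C%C.
  by near: h; apply: dnbhs0_le; rewrite divr_gt0// ltcR; lra.
have lh : l1norm ('i%C * h) <= 1.
  rewrite il -lecR; apply: le_trans (l1norm_le_norm h) _.
  by rewrite -ler_pdivlMl// mulr1.
have H := HK _ lh; rewrite il in H.
rewrite /= -[h *: 1]/(h * 1) mulr1 [h + lambda]addrC mulrDr.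
set D := char_fun W _ - char_fun W _.
have -> : 'i%C * char_fun_deriv W ('i%C * lambda) - h^-1 *: D =
   - (h^-1 * (D - 'i%C * h * char_fun_deriv W ('i%C * lambda))).
  by rewrite /GRing.scale /=; field.
rewrite normrN normrM normfV ler_pdivrMl ?normr_gt0//.
apply: le_trans (norm_le_l1norm _) _.
apply: (@le_trans _ _ (K * l1norm h ^+ 2)%:C%C); first by rewrite lecR.
apply: (@le_trans _ _ ((4 * K)%:C%C * `|h| ^+ 2)).
  have -> : (4 * K)%:C%C * `|h| ^+ 2 = K%:C%C * (2 * `|h|) ^+ 2.
    by rewrite rmorphM rmorph_nat; ring.
  rewrite rmorphM rmorphXn; apply: ler_wpM2l; first by rewrite lecR.
  by apply: lerXn2r; rewrite ?nnegrE ?lecR ?l1norm_ge0 ?mulr_ge0// l1norm_le_norm.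
rewrite expr2 mulrA mulrC ler_wpM2l//.
apply: (@le_trans _ _ ((4 * K + 1)%:C%C * `|h|)).
  by rewrite ler_wpM2r// lecR lerDl.
by rewrite mulrC -ler_pdivlMr// ltcR; lra.
Unshelve. all: by end_near. Qed.

Lemma forrester_entire : entire (@forrester R n).
Proof.
move=> lambda.
have -> : @forrester R n = (fun l : C^o => (selberg_D R n)%:C%C / (selberg_S R n)%:C%C : C^o)
   * (fun l : C^o => l) ^+ N * (fun l : C^o => char_fun W ('i%C * l) : C^o).
  apply/funext => l; rewrite /forrester selberg_GE !mulrfctE exprfctE; ring.
apply: derivableM; last exact: char_fun_entire.
by apply: derivableM; [exact: derivable_cst|apply: derivableX; exact: derivable_id].
Qed.

End TwoSides.

Theorem theorem1p2 (R : realType) (n : nat) (n_ge1 : (1 <= n)%N) :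
  (forall lambda : R[i],
     cvgn (qv_partial_sum n lambda) /\
     qv_series n lambda = forrester n lambda) /\
  [/\ entire (@qv_series R n), entire (@forrester R n) &
      @qv_series R n = @forrester R n].
Proof.
have key (lambda : R[i]) : cvgn (qv_partial_sum n lambda) /\
    qv_series n lambda = forrester n lambda.
  have cv := @cvg_partial_sum R n n_ge1 lambda.
  split; first by apply/cvg_ex; eexists; exact: cv.
  rewrite /qv_series (cvg_lim (@norm_hausdorff _ _) cv).
  by rewrite mulrC divfK.
have E : @qv_series R n = @forrester R n.
  by apply/funext => lambda; have [] := key lambda.
split => //; split => //; last exact: forrester_entire.
by rewrite E; exact: forrester_entire.
Qed.
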